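(* Let $n \ge 2$, let $K$ be a (non-archimedean) local field whose residue field has $q$ elements, and let $Y_n$ be the graph of special vertices of the affine building $\Delta_n$ of $\mathrm{Sp}_n(K)$. Then the spectral radius of $Y_n$ is $\rho(Y_n) = 2^n q^{n(n+1)/4}$.
   Context: $K$ is a local field with discrete valuation $\mathrm{ord}$, valuation ring $\mathcal{O}$, uniformizer $\pi$, residue field $k\cong\mathbb{F}_q$. $V$ is a $2n$-dimensional $K$-vector space with a non-degenerate alternating bilinear form $\langle\cdot,\cdot\rangle$. A lattice in $V$ is a free rank-$2n$ $\mathcal{O}$-submodule of $V$; lattices $L,L'$ are homothetic if $L'=\alpha L$ for some $\alpha\in K^\times$, and $[L]$ is the homothety class of $L$. A lattice $L$ is primitive if $\langle L,L\rangle\subseteq\mathcal{O}$ and $\langle\cdot,\cdot\rangle$ induces a non-degenerate alternating $k$-bilinear form on $L/\pi L$. The building $\Delta_n$: a vertex of $\Delta_n$ is a homothety class of lattices having a representative $L$ for which there is a primitive lattice $L_0$ with $\langle L,L\rangle\subseteq\pi\mathcal{O}$ and $\pi L_0\subseteq L\subseteq L_0$. Two vertices $t,t'$ are incident if there are representatives $L\in t$, $L'\in t'$ and a primitive lattice $L_0$ with $\langle L,L\rangle\subseteq\pi\mathcal{O}$, $\langle L',L'\rangle\subseteq\pi\mathcal{O}$, and either $\pi L_0\subseteq L\subseteq L'\subseteq L_0$ or $\pi L_0\subseteq L'\subseteq L\subseteq L_0$. Two distinct incident vertices are called adjacent. A basis $\{u_1,\dots,u_n,w_1,\dots,w_n\}$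 of $V$ is symplectic if $\langle u_i,w_j\rangle=\delta_{ij}$ and $\langle u_i,u_j\rangle=0=\langle w_i,w_j\rangle$ for all $i,j$. A vertex $[L]$ of $\Delta_n$ is special if, writing $L=\sum_i\mathcal{O}\pi^{a_i}u_i+\sum_i\mathcal{O}\pi^{b_i}w_i$ in a symplectic basis (with $a_i,b_i\in\mathbb{Z}$), the sum $a_i+b_i$ is the same for all $i$ (this does not depend on the choices). $Y_n$ is the graph whose vertices are the special vertices of $\Delta_n$, two of them being joined by an edge iff they are adjacent in $\Delta_n$. For a connected graph $X$ with infinitely many vertices, regular of finite degree, the adjacency operator $A(X)$ acts on the Hilbert space of functions $f:X\to\mathbb{C}$ on the vertices with $\sum_x|f(x)|^2<\infty$ by $(A(X)f)(x)=\sum_{y\sim x}f(y)$; the spectral radius is $\rho(X)=\sup\{|\lambda|:\lambda\in\mathbb{C},\ A(X)-\lambda I\text{ is not invertible}\}$ (equivalently $\|A(X)\|$). *)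

(* Defs.v *)
From HB Require Import structures.
From mathcomp Require Import all_boot all_order all_algebra sesquilinear complex.
From mathcomp Require Import all_classical all_reals all_analysis.

Set Implicit Arguments.
Unset Strict Implicit.
Unset Printing Implicit Defensive.

Import Order.TTheory GRing.Theory Num.Theory.

Local Open Scope classical_set_scope.
Local Open Scope ring_scope.

Section LocalField.
Variables (K : fieldType) (ord : K -> int) (varpi : K).

(* The valuation is only meaningful on nonzero elements; [ord 0] is arbitrary
   and morally +oo. *)
Definition ord_ge (m : int) : set K := [set x | x = 0 \/ m <= ord x].

Definition valring : set K := ord_ge 0.

Definition uniformizer : Prop := varpi != 0 /\ ord varpi = 1.

Definition piO : set K := [set varpi * x | x in valring].

Definition residue_classes : set (set K) :=
  [set [set x + y | y in piO] | x in valring].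

Definition ord_cauchy (u : nat -> K) : Prop :=
  forall m : int, exists N : nat,
    forall i j, (N <= i)%N -> (N <= j)%N -> ord_ge m (u i - u j).

Definition ord_cvg (u : nat -> K) (l : K) : Prop :=
  forall m : int, exists N : nat,
    forall i, (N <= i)%N -> ord_ge m (u i - l).

(* The valuation is normalized (onto the integers) by [uniformizer]. *)
Record local_field (q : nat) : Prop := LocalField {
  ordM : forall x y, x != 0 -> y != 0 -> ord (x * y) = ord x + ord y;
  ordD : forall x y, x != 0 -> y != 0 -> x + y != 0 ->
    Num.min (ord x) (ord y) <= ord (x + y);
  ord_uniformizer : uniformizer;
  ord_complete : forall u, ord_cauchy u -> exists l, ord_cvg u l;
  card_residue : (residue_classes #= `I_q)%card
}.

End LocalField.

Section Building.
Variables (K : fieldType) (ord : K -> int) (varpi : K).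
Variables (V : vectType K) (form : {biscalar V}) (n : nat).

Local Notation O := (valring ord).
Local Notation piO := (piO ord varpi).

Definition alternating_form : Prop := forall x, form x x = 0.

Definition nondegenerate_form : Prop :=
  forall x, (forall y, form x y = 0) -> x = 0.

Definition scale_set (a : K) (L : set V) : set V := [set a *: x | x in L].

Definition O_span (m : nat) (e : 'I_m -> V) : set V :=
  [set \sum_i c i *: e i | c in [set c : 'I_m -> K | forall i, O (c i)]].

Definition O_free (m : nat) (e : 'I_m -> V) : Prop :=
  forall c : 'I_m -> K, (forall i, O (c i)) ->
    \sum_i c i *: e i = 0 -> forall i, c i = 0.

Definition lattice (L : set V) : Prop :=
  exists e : 'I_(2 * n) -> V, O_free e /\ L = O_span e.

Definition homothety_class (L : set V) : set (set V) :=
  [set L' | exists2 a : K, a != 0 & L' = scale_set a L].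

Definition form_maps_to (L : set V) (S : set K) : Prop :=
  forall x y, L x -> L y -> S (form x y).

(* The last clause says that the form induced on L/(varpi L) with values in the
   residue field O/(varpi O) is non-degenerate. *)
Definition primitive (L : set V) : Prop :=
  [/\ lattice L, form_maps_to L O &
      forall x, L x -> (forall y, L y -> piO (form x y)) ->
        scale_set varpi L x].

Definition vertex (t : set (set V)) : Prop :=
  exists L, [/\ lattice L, t = homothety_class L &
    exists L0, [/\ primitive L0, form_maps_to L piO,
      scale_set varpi L0 `<=` L & L `<=` L0]].

Definition incident (t t' : set (set V)) : Prop :=
  exists L L' L0,
    [/\ lattice L /\ t = homothety_class L,
        lattice L' /\ t' = homothety_class L',
        primitive L0,
        form_maps_to L piO /\ form_maps_to L' piO &
        [/\ scale_set varpi L0 `<=` L, L `<=` L' & L' `<=` L0] \/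
        [/\ scale_set varpi L0 `<=` L', L' `<=` L & L `<=` L0]].

Definition adjacent (t t' : set (set V)) : Prop := t <> t' /\ incident t t'.

Definition symplectic_basis (u w : n.-tuple V) : Prop :=
  [/\ basis_of {:V} (u ++ w),
      forall i j, form (tnth u i) (tnth w j) = (i == j)%:R,
      forall i j, form (tnth u i) (tnth u j) = 0 &
      forall i j, form (tnth w i) (tnth w j) = 0].

Definition symplectic_lattice (u w : n.-tuple V) (a b : 'I_n -> int) : set V :=
  [set x + y | x in O_span (fun i => varpi ^ a i *: tnth u i)
             & y in O_span (fun i => varpi ^ b i *: tnth w i)].

Definition special_vertex : set (set (set V)) :=
  [set t | vertex t /\
    exists u w a b, [/\ symplectic_basis u w,
      t = homothety_class (symplectic_lattice u w a b) &
      exists m : int, forall i, a i + b i = m]].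

(* The vertex set of the graph Y_n is the coercion of [special_vertex] to a
   type; [Y_adj] is its edge relation. *)
Definition Y_adj (s t : special_vertex) : Prop := adjacent (val s) (val t).

End Building.

Section SpectralRadius.
Variables (R : realType) (X : choiceType).

Local Notation C := R[i].
Local Notation normc := ComplexField.Normc.normc.

Definition l2sum (f : X -> C) : \bar R :=
  (\esum_(x in [set: X]) (normc (f x) ^+ 2)%:E)%E.

Definition l2 : set (X -> C) := [set f | (l2sum f < +oo)%E].

Definition l2norm (f : X -> C) : R := Num.sqrt (fine (l2sum f)).

(* Operators on l2 are encoded as maps on all functions, of which only the
   restriction to l2 is relevant. *)
Definition l2_bounded_operator (B : (X -> C) -> X -> C) : Prop :=
  [/\ forall f, l2 f -> l2 (B f),
      forall (c : C) f g, l2 f -> l2 g ->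
        B (fun x => c * f x + g x) = (fun x => c * B f x + B g x) &
      exists M : R, forall f, l2 f -> l2norm (B f) <= M * l2norm f].

Definition l2_invertible (A : (X -> C) -> X -> C) : Prop :=
  exists B, l2_bounded_operator B /\
    forall f, l2 f -> B (A f) = f /\ A (B f) = f.

Definition l2_spectrum (A : (X -> C) -> X -> C) : set C :=
  [set lambda | ~ l2_invertible (fun f x => A f x - lambda * f x)].

(* The sum is a genuine finite sum when the graph is locally finite. *)
Definition adjacency_operator (adj : X -> X -> Prop) (f : X -> C) (x : X) : C :=
  \sum_(y \in [set y | adj x y]) f y.

Definition spectral_radius (adj : X -> X -> Prop) : R :=
  sup [set normc lambda | lambda in l2_spectrum (adjacency_operator adj)].

End SpectralRadius.

Arguments spectral_radius R {X} adj.

(* Main.v *)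
Require Import Defs.
From HB Require Import structures.
From mathcomp Require Import all_boot all_order all_algebra sesquilinear complex.
From mathcomp Require Import all_classical all_reals all_analysis.
From mathcomp Require Import finmap ring lra zify.

Set Implicit Arguments.
Unset Strict Implicit.
Unset Printing Implicit Defensive.

Import Order.TTheory GRing.Theory Num.Theory numFieldNormedType.Exports.

Local Open Scope classical_set_scope.
Local Open Scope ring_scope.

(** Inside its homothety class a special vertex has exactly one representative
    L of level 0 or 1, where L has level m when it is its own dual for the form
    multiplied by [varpi]^-m, that is, L = {v | <v, L> is contained in
    [varpi]^m O}.  Two special vertices are adjacent exactly when their
    representatives have levels 0 and 1 and the second is contained in the first
    ([adjacentP]).  So the graph is bipartite, and every neighbour
    of L, multiplied by [varpi] if L has level 1, is a self-dual M contained in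
    L, of the next level.

    Choose a hyperbolic pair (e, f).  A self-dual L has an exponent a, with
    L meeting K e in [varpi]^a O e, and a reduction, the image of L & e^perp in
    e^perp / K e, which is again self-dual of the same level in dimension two
    less.  Repeating this along an isotropic flag gives L a type in Z^n.
    Passing from L to a neighbour M below it adds a vector of zeros and ones
    to the type, and over a given neighbour M' of the reduction there is exactly
    one M whose exponent stays the same and there are q [L' : M'] = q^c of
    them whose exponent grows, where L' is the reduction of L and c the rank at
    which e is split off
    ([fibre_same], [count_fibre_next], [index_nbr]).  Hence a shift eps is
    realized by q^(sum of the c_i eps_i) neighbours, with c_i running through
    1, ..., n; these are the Schubert cells of the Lagrangian Grassmannian.

    Write s for the square root of q and C for 1 + ... + n.  For the function
    h = s^(- sum of the c_i (2 a_i - m)), the change of h along a shift exactly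
    compensates half of the size of its cell, so each of the 2^n shifts
    contributes s^C and A h = r h with r = 2^n s^C = 2^n q^(n(n+1)/4)
    ([sum_nb], [h_harmonic]).

    Upper bound: A has a positive eigenfunction for r, so the Schur test bounds
    its norm on l2 by r ([schur_test]) and the Neumann series inverts
    A - lambda when |lambda| > r ([resolvent_exists]).

    Lower bound: r itself lies in the spectrum, because the types live in the
    amenable group Z^n.  Inside a box of types there is a finite set F of
    vertices which no edge leaves without leaving the box; it plays the part
    of an orbit of a compact group of unipotent elements.  Counting the edges
    between two types from both ends shows that the sum of h^2 over the
    vertices of F of a given type is the same for all types of the box
    ([mass_const]).  Therefore h, cut off to F and to a slightly smaller box, is
    almost an eigenvector: A - r maps it to a function carried by the boundary
    of the box, whose share of the mass tends to 0 ([window_test_function]).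
    Both F and the counts are produced by induction on the dimension
    ([horocyclic_exists]). *)

Local Notation normc := ComplexField.Normc.normc.

(** * Square sums and Cauchy-Schwarz *)

Section SquareSums.
Variables (R : realType) (X : choiceType).
Local Notation C := R[i].

Lemma normc_ge0 (z : C) : 0 <= normc z.
Proof. by case: z => a b; exact: sqrtr_ge0. Qed.

Lemma normc_sqr (z : C) : normc z ^+ 2 = complex.Re z ^+ 2 + complex.Im z ^+ 2.
Proof. by case: z => a b; rewrite sqr_sqrtr // addr_ge0 ?sqr_ge0. Qed.

Lemma normcR (x : R) : normc (x%:C)%C = `|x|.
Proof. by rewrite /normc /= expr0n addr0 sqrtr_sqr. Qed.

Lemma normcX (w : C) k : normc (w ^+ k) = normc w ^+ k.
Proof.
elim: k => [|k ih]; first by rewrite !expr0 ComplexField.Normc.normc1.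
by rewrite !exprS ComplexField.Normc.normcM ih.
Qed.

Lemma normc_sum (T : Type) (s : seq T) (F : T -> C) :
  normc (\sum_(i <- s) F i) <= \sum_(i <- s) normc (F i).
Proof.
elim/big_ind2: _ => // [|x1 x2 y1 y2 h1 h2].
  by rewrite ComplexField.Normc.normc0.
by apply: le_trans (le_normcD _ _) _; apply: lerD.
Qed.

Lemma le_sum_subset (T : eqType) (s t : seq T) (F : T -> R) :
  uniq s -> uniq t -> {subset s <= t} -> (forall x, 0 <= F x) ->
  \sum_(x <- s) F x <= \sum_(x <- t) F x.
Proof.
move=> us ut st F0.
have ps : perm_eq [seq x <- t | x \in s] s.
  apply: uniq_perm => //; first exact: filter_uniq.
  by move=> x; rewrite mem_filter; case: (boolP (x \in s)) => // /st ->.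
rewrite -(perm_big _ ps) /= big_filter [leRHS](bigID (mem s)) /= lerDl.
by rewrite sumr_ge0.
Qed.

(** This says that [l2sum f] is at most N; stated through finite partial sums,
    it lets all estimates take place in R. *)
Definition sqle (f : X -> C) (N : R) : Prop :=
  forall J : seq X, uniq J -> \sum_(x <- J) normc (f x) ^+ 2 <= N.

Lemma sqle_ge0 f N : sqle f N -> 0 <= N.
Proof. by move=> /(_ [::] isT); rewrite big_nil. Qed.

Lemma sqle_point f N x : sqle f N -> normc (f x) ^+ 2 <= N.
Proof. by move=> /(_ [:: x] isT); rewrite big_seq1. Qed.

Lemma l2sum_le f N : sqle f N -> (l2sum f <= N%:E)%E.
Proof.
move=> fN; apply: ge_ereal_sup => _ [A [finA _] <-].
rewrite fsbig_finite //= sumEFin lee_fin; exact/fN/fset_uniq.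
Qed.

Lemma l2sum_ge0 (f : X -> C) : (0 <= l2sum f)%E.
Proof. by apply: esum_ge0 => x _; rewrite lee_fin sqr_ge0. Qed.

Lemma sqle_l2 f N : sqle f N -> l2 f.
Proof. by move=> /l2sum_le h; apply: le_lt_trans h _; rewrite ltry. Qed.

Lemma l2_fin_num (f : X -> C) : l2 f -> l2sum f \is a fin_num.
Proof. by move=> h; rewrite ge0_fin_numE // l2sum_ge0. Qed.

Lemma l2norm_sqr (f : X -> C) : l2 f -> l2norm f ^+ 2 = fine (l2sum f).
Proof. by move=> _; rewrite sqr_sqrtr // fine_ge0 // l2sum_ge0. Qed.

Lemma l2_sqle (f : X -> C) : l2 f -> sqle f (l2norm f ^+ 2).
Proof.
move=> lf J uJ; rewrite l2norm_sqr // -lee_fin fineK ?l2_fin_num //.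
apply: esum_ge; exists [set` J]; first by split => //; exact: finite_seq.
by rewrite -fsbig_seq // sumEFin.
Qed.

Lemma l2norm_ge0 (f : X -> C) : 0 <= l2norm f.
Proof. exact: sqrtr_ge0. Qed.

Lemma l2norm_sqr_le f N : sqle f N -> l2norm f ^+ 2 <= N.
Proof.
move=> h; rewrite (l2norm_sqr (sqle_l2 h)) -lee_fin fineK; first exact: l2sum_le.
exact/l2_fin_num/(sqle_l2 h).
Qed.

Lemma l2norm_le f N : 0 <= N -> sqle f (N ^+ 2) -> l2norm f <= N.
Proof.
by move=> N0 /l2norm_sqr_le; rewrite ler_pXn2r // ?nnegrE // l2norm_ge0.
Qed.

(** Expand the nonnegative sum of the h x (u x / h x - U / H)^2, where U and H
    are the sums of u and of h. *)
Lemma weighted_cauchy_schwarz (T : eqType) (s : seq T) (h u : T -> R) :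
  (forall x, 0 < h x) ->
  (\sum_(x <- s) u x) ^+ 2 <= (\sum_(x <- s) h x) * \sum_(x <- s) u x ^+ 2 / h x.
Proof.
move=> h0; case: s => [|t s0]; first by rewrite !big_nil mul0r expr0n.
have := mem_head t s0; set s := t :: s0; move: s => {s0} s ts.
set U := \sum_(x <- s) u x; set H := \sum_(x <- s) h x.
have H0 : 0 < H.
  rewrite /H (big_rem t) //=; apply: ltr_wpDr; last exact: h0.
  by apply: sumr_ge0 => x _; exact: ltW.
have : 0 <= \sum_(x <- s) (u x ^+ 2 / h x - 2 * (U / H) * u x + (U / H) ^+ 2 * h x).
  apply: sumr_ge0 => x _.
  have -> : u x ^+ 2 / h x - 2 * (U / H) * u x + (U / H) ^+ 2 * h x =
            h x * (u x / h x - U / H) ^+ 2.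
    by field; rewrite !gt_eqF.
  by rewrite mulr_ge0 ?sqr_ge0 // ltW.
rewrite big_split /= sumrB -!mulr_sumr -/U -/H => h1.
have /(mulr_ge0 (ltW H0)) := h1.
set Q := \sum_(i <- s) _.
have -> : H * (Q - 2 * (U / H) * U + (U / H) ^+ 2 * H) = H * Q - U ^+ 2.
  by field; rewrite gt_eqF.
by rewrite subr_ge0.
Qed.

(** From |a + b|^2 <= 2 |a|^2 + 2 |b|^2; the constant is irrelevant, as only
    finiteness matters. *)
Lemma sqle_lin (c : C) (f g : X -> C) N M : sqle f N -> sqle g M ->
  sqle (fun x => c * f x + g x) (2 * (normc c ^+ 2 * N + M)).
Proof.
move=> fN gM J uJ.
apply: (@le_trans _ _ (\sum_(x <- J)
    (2 * (normc c ^+ 2 * normc (f x) ^+ 2) + 2 * normc (g x) ^+ 2))).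
  apply: ler_sum => x _.
  apply: (@le_trans _ _ ((normc c * normc (f x) + normc (g x)) ^+ 2)).
    rewrite ler_pXn2r ?nnegrE ?normc_ge0 ?addr_ge0 ?mulr_ge0 ?normc_ge0 //.
    by rewrite -ComplexField.Normc.normcM le_normcD.
  rewrite -subr_ge0.
  have -> : 2 * (normc c ^+ 2 * normc (f x) ^+ 2) + 2 * normc (g x) ^+ 2 -
     (normc c * normc (f x) + normc (g x)) ^+ 2 =
     (normc c * normc (f x) - normc (g x)) ^+ 2 by ring.
  exact: sqr_ge0.
rewrite big_split /= -!mulr_sumr mulrDr lerD // ler_wpM2l //.
  by rewrite ler_wpM2l ?sqr_ge0 // fN.
exact: gM.
Qed.

End SquareSums.

(** * The Schur test *)

Section SchurTest.
Variables (R : realType) (X : choiceType) (nb : X -> seq X).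
Local Notation C := R[i].
Variables (h : X -> R) (r : R).
Hypothesis nb_uniq : forall x, uniq (nb x).
Hypothesis nb_sym : forall x y, (y \in nb x) = (x \in nb y).
Hypothesis h_gt0 : forall x, 0 < h x.
Hypothesis r_gt0 : 0 < r.
Hypothesis h_super : forall x, \sum_(y <- nb x) h y <= r * h x.

Definition nbsum (f : X -> C) (x : X) : C := \sum_(y <- nb x) f y.

(** Weighting Cauchy-Schwarz by h bounds |A f (x)|^2 by r h(x) times the sum of
    the |f y|^2 / h y over the neighbours y of x.  After summation over x and
    exchange of the sums, the symmetry of the graph lets the supersolution h
    be used a second time. *)
Lemma schur_test f N : sqle f N -> sqle (nbsum f) (r ^+ 2 * N).
Proof.
move=> fN J uJ.
pose J' := undup (flatten [seq nb x | x <- J]).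
have uJ' : uniq J' by exact: undup_uniq.
have nbJ' x : x \in J -> perm_eq (nb x) [seq y <- J' | y \in nb x].
  move=> xJ; apply: uniq_perm => //; first exact: filter_uniq.
  move=> y; rewrite mem_filter mem_undup; case: (boolP (y \in nb x)) => //= yx.
  by apply/esym/flattenP; exists (nb x) => //; exact: map_f.
pose g y := normc (f y) ^+ 2 / h y.
have g0 y : 0 <= g y by rewrite /g divr_ge0 ?sqr_ge0 // ltW.
have step x : normc (nbsum f x) ^+ 2 <= r * h x * \sum_(y <- nb x) g y.
  apply: (@le_trans _ _ ((\sum_(y <- nb x) normc (f y)) ^+ 2)).
    by rewrite ler_pXn2r ?nnegrE ?normc_ge0 ?sumr_ge0 ?normc_sum // => y _; exact: normc_ge0.
  apply: le_trans (weighted_cauchy_schwarz _ _ h_gt0) _.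
  by apply: ler_wpM2r; [apply: sumr_ge0 => y _; exact: g0 | exact: h_super].
apply: (@le_trans _ _ (\sum_(x <- J) \sum_(y <- J' | y \in nb x) r * h x * g y)).
  rewrite big_seq [leRHS]big_seq; apply: ler_sum => x xJ.
  by rewrite -big_filter -(perm_big _ (nbJ' x xJ)) -mulr_sumr step.
under eq_bigr do rewrite big_mkcond /=.
rewrite exchange_big /=.
apply: (@le_trans _ _ (\sum_(y <- J') r ^+ 2 * normc (f y) ^+ 2)); last first.
  by rewrite -mulr_sumr ler_wpM2l ?sqr_ge0 // fN.
apply: ler_sum => y _; rewrite -big_mkcond /=.
under eq_bigr do rewrite -mulrA mulrCA.
rewrite -mulr_suml -big_filter.
have -> : r ^+ 2 * normc (f y) ^+ 2 = r * h y * (r * g y).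
  by rewrite /g; field; rewrite gt_eqF.
apply: ler_wpM2r; first by rewrite mulr_ge0 // ltW.
apply: le_trans (h_super y); apply: le_sum_subset => //.
- exact: filter_uniq.
- by move=> x; rewrite mem_filter nb_sym => /andP[].
- by move=> x; exact: ltW.
Qed.

Lemma nbsum_lin (c : C) f g :
  nbsum (fun x => c * f x + g x) = (fun x => c * nbsum f x + nbsum g x).
Proof. by apply/funext => x; rewrite /nbsum big_split /= mulr_sumr. Qed.

Lemma iter_nbsum_lin k (c : C) f g :
  iter k nbsum (fun x => c * f x + g x) =
  (fun x => c * iter k nbsum f x + iter k nbsum g x).
Proof. by elim: k => //= k ->; rewrite nbsum_lin. Qed.

Lemma iter_schur k f N : sqle f N -> sqle (iter k nbsum f) (r ^+ k ^+ 2 * N).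
Proof.
move=> fN; elim: k => [|k ih] /=; first by rewrite expr1n mul1r.
have -> : r ^+ k.+1 ^+ 2 * N = r ^+ 2 * (r ^+ k ^+ 2 * N) 
  by rewrite [r ^+ k.+1]exprS exprMn mulrA.
exact: schur_test.
Qed.

End SchurTest.

(** * Limits of complex sequences *)

Section ComplexLimits.
Variable R : realType.
Local Notation C := R[i].

Definition ccvg (u : nat -> C) (l : C) : Prop :=
  ((fun n => complex.Re (u n)) @ \oo --> complex.Re l) /\
  ((fun n => complex.Im (u n)) @ \oo --> complex.Im l).

Lemma ccvg_unique u l l' : ccvg u l -> ccvg u l' -> l = l'.
Proof.
move=> [ur ui] [ur' ui']; apply/eqP; rewrite eq_complex; apply/andP.
by split; apply/eqP; [exact: (cvg_unique _ ur ur') | exact: (cvg_unique _ ui ui')].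
Qed.

Lemma ccvg_cst l : ccvg (fun=> l) l.
Proof. by split; exact: cvg_cst. Qed.

Lemma ReD (z w : C) : complex.Re (z + w) = complex.Re z + complex.Re w.
Proof. by case: z w => a b []. Qed.
Lemma ImD (z w : C) : complex.Im (z + w) = complex.Im z + complex.Im w.
Proof. by case: z w => a b []. Qed.
Lemma ReM (z w : C) : complex.Re (z * w) =
  complex.Re z * complex.Re w - complex.Im z * complex.Im w.
Proof. by case: z w => a b []. Qed.
Lemma ImM (z w : C) : complex.Im (z * w) =
  complex.Re z * complex.Im w + complex.Im z * complex.Re w.
Proof. by case: z w => a b []. Qed.

Lemma ccvgD u v k l : ccvg u k -> ccvg v l -> ccvg (fun n => u n + v n) (k + l).
Proof.
move=> [ur ui] [vr vi]; split.
  by under eq_fun do rewrite ReD; rewrite ReD; apply: cvgD.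
by under eq_fun do rewrite ImD; rewrite ImD; apply: cvgD.
Qed.

Lemma ccvgM u c l : ccvg u l -> ccvg (fun n => c * u n) (c * l).
Proof.
move=> [ur ui]; split.
  under eq_fun do rewrite ReM; rewrite ReM.
  by apply: cvgB; apply: cvgM => //; exact: cvg_cst.
under eq_fun do rewrite ImM; rewrite ImM.
by apply: cvgD; apply: cvgM => //; exact: cvg_cst.
Qed.

Lemma ccvg_sum (T : Type) (s : seq T) (u : T -> nat -> C) (l : T -> C) :
  (forall t, ccvg (u t) (l t)) ->
  ccvg (fun n => \sum_(t <- s) u t n) (\sum_(t <- s) l t).
Proof.
move=> ul; elim: s => [|t s ih].
  by under eq_fun do rewrite big_nil; rewrite big_nil; exact: ccvg_cst.
by under eq_fun do rewrite big_cons; rewrite big_cons; exact: ccvgD.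
Qed.

Lemma ccvg_normc_sqr u l : ccvg u l ->
  (fun n => normc (u n) ^+ 2) @ \oo --> normc l ^+ 2.
Proof.
move=> [ur ui]; under eq_fun do rewrite normc_sqr !expr2.
by rewrite normc_sqr !expr2; apply: cvgD; apply: cvgM.
Qed.

Lemma Re_sum (T : Type) (s : seq T) (F : T -> C) :
  complex.Re (\sum_(t <- s) F t) = \sum_(t <- s) complex.Re (F t).
Proof. by elim/big_ind2: _ => // x1 x2 y1 y2 <- <-; rewrite ReD. Qed.
Lemma Im_sum (T : Type) (s : seq T) (F : T -> C) :
  complex.Im (\sum_(t <- s) F t) = \sum_(t <- s) complex.Im (F t).
Proof. by elim/big_ind2: _ => // x1 x2 y1 y2 <- <-; rewrite ImD. Qed.

Lemma cvg_dominated_geometric (t : nat -> R) (c z : R) :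
  0 <= z < 1 -> (forall k, `|t k| <= c * z ^+ k) -> cvgn (series t).
Proof.
move=> /andP[z0 z1] tc; apply: normed_cvg; apply: (@series_le_cvg _ _ (geometric c z)).
- by move=> n; exact: normr_ge0.
- by move=> n; exact: le_trans (normr_ge0 _) (tc n).
- exact: tc.
- by apply: is_cvg_geometric_series; rewrite ger0_norm.
Qed.

Lemma abs_Re_le (z : C) : `|complex.Re z| <= normc z.
Proof.
by rewrite -sqrtr_sqr; case: z => a b; rewrite ler_wsqrtr //= lerDl sqr_ge0.
Qed.
Lemma abs_Im_le (z : C) : `|complex.Im z| <= normc z.
Proof.
by rewrite -sqrtr_sqr; case: z => a b; rewrite ler_wsqrtr //= lerDr sqr_ge0.
Qed.

Lemma ccvg_geometric (t : nat -> C) (c z : R) :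
  0 <= z < 1 -> (forall k, normc (t k) <= c * z ^+ k) ->
  exists l, ccvg (fun n => \sum_(0 <= k < n) t k) l.
Proof.
move=> z01 tc.
have cr : cvgn (series (fun k => complex.Re (t k))).
  apply: (cvg_dominated_geometric z01) => k.
  exact: le_trans (abs_Re_le _) (tc k).
have ci : cvgn (series (fun k => complex.Im (t k))).
  apply: (cvg_dominated_geometric z01) => k.
  exact: le_trans (abs_Im_le _) (tc k).
exists (Complex (limn (series (fun k => complex.Re (t k)))) (limn (series (fun k => complex.Im (t k))))).
split.
  by under eq_fun do rewrite Re_sum.
by under eq_fun do rewrite Im_sum.
Qed.

End ComplexLimits.

(** * Resolvents and approximate eigenvectors *)

Section Resolvent.
Variables (R : realType) (X : choiceType) (nb : X -> seq X).
Local Notation C := R[i].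
Variables (h : X -> R) (r : R).
Hypothesis nb_uniq : forall x, uniq (nb x).
Hypothesis nb_sym : forall x y, (y \in nb x) = (x \in nb y).
Hypothesis h_gt0 : forall x, 0 < h x.
Hypothesis r_gt0 : 0 < r.
Hypothesis h_super : forall x, \sum_(y <- nb x) h y <= r * h x.
Variable lambda : C.
Hypothesis r_lt : r < normc lambda.

Local Notation A := (nbsum nb).
Local Notation L := (normc lambda).

Let lambda_neq0 : lambda != 0.
Proof.
apply/eqP => l0; move: r_lt; rewrite l0 ComplexField.Normc.normc0.
by rewrite ltNge ltW.
Qed.

Let L_gt0 : 0 < L. Proof. exact: lt_trans r_lt. Qed.

Let z := r / L.
Let z01 : 0 <= z < 1.
Proof. by rewrite /z divr_ge0 ?ltW //= ltr_pdivrMr // mul1r. Qed.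

Let term (f : X -> C) (x : X) k := - (lambda ^- k.+1) * iter k A f x.

Let neumann f x n := \sum_(0 <= k < n) term f x k.

Let normc_term f x k :
  normc (term f x k) = L ^- k.+1 * normc (iter k A f x).
Proof.
by rewrite /term ComplexField.Normc.normcM normcN ComplexField.Normc.normcV normcX.
Qed.

Let iter_point f N x k : sqle f N -> normc (iter k A f x) <= r ^+ k * Num.sqrt N.
Proof.
move=> fN; have N0 := sqle_ge0 fN.
have := sqle_point x (iter_schur nb_uniq nb_sym h_gt0 r_gt0 h_super k fN).
rewrite -[in X in _ <= X -> _](sqr_sqrtr N0) -exprMn.
by rewrite ler_pXn2r // nnegrE ?normc_ge0 // mulr_ge0 ?sqrtr_ge0 // exprn_ge0 // ltW.
Qed.

Let neumann_cvg f N x : sqle f N -> exists l, ccvg (neumann f x) l.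
Proof.
move=> fN; apply: (@ccvg_geometric _ _ (L^-1 * Num.sqrt N) z) => // k.
rewrite normc_term /z exprMn [L ^+ k.+1]exprS invfM exprVn.
have -> : L^-1 * Num.sqrt N * (r ^+ k * L ^- k) =
  L^-1 * L ^- k * (r ^+ k * Num.sqrt N) by ring.
by apply: ler_wpM2l; [rewrite mulr_ge0 ?invr_ge0 ?exprn_ge0 ?normc_ge0 | exact: iter_point].
Qed.

(** Cauchy-Schwarz with the weights z^k, where z = r / |lambda|, turns the
    bounds on the A^k f into one that does not depend on the number of terms. *)
Let neumann_bound f N n : sqle f N ->
  sqle (fun x => neumann f x n) (L ^- 2 / (1 - z) ^+ 2 * N).
Proof.
move=> fN J uJ; have N0 := sqle_ge0 fN.
have /andP[z0 z1] := z01.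
have zp : 0 < z by rewrite divr_gt0.
have geo m : \sum_(0 <= k < m) z ^+ k <= (1 - z)^-1.
  rewrite -[leRHS]mul1r ler_pdivlMr ?subr_gt0 //.
  have -> : (\sum_(0 <= k < m) z ^+ k) * (1 - z) = 1 - z ^+ m.
    by rewrite mulrC big_mkord -(opprB z 1) mulNr -subrX1 opprB.
  by rewrite gerBl exprn_ge0.
have step x : normc (neumann f x n) ^+ 2 <=
   (1 - z)^-1 * \sum_(0 <= k < n) L ^- 2 * (z ^+ k / r ^+ k ^+ 2) * normc (iter k A f x) ^+ 2.
  apply: (@le_trans _ _ ((\sum_(0 <= k < n) normc (term f x k)) ^+ 2)).
    by rewrite ler_pXn2r ?nnegrE ?normc_ge0 ?sumr_ge0 ?normc_sum // => y _; exact: normc_ge0.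
  apply: le_trans (weighted_cauchy_schwarz _ (h := fun k => z ^+ k) _ _) _.
    by move=> k; rewrite exprn_gt0.
  apply: ler_pM => //.
  - by apply: sumr_ge0 => k _; rewrite exprn_ge0.
  - by apply: sumr_ge0 => k _; rewrite divr_ge0 ?sqr_ge0 ?exprn_ge0.
  apply: ler_sum => k _; rewrite normc_term le_eqVlt; apply/orP; left; apply/eqP.
  have L0 : L != 0 by rewrite gt_eqF.
  have r0 : r != 0 by rewrite gt_eqF.
  have Lk0 : L ^+ k != 0 by rewrite expf_neq0.
  have rk0 : r ^+ k != 0 by rewrite expf_neq0.
  rewrite /z expr_div_n [L ^+ k.+1]exprS.
  by move: (L ^+ k) (r ^+ k) Lk0 rk0 => a b a0 b0; field; rewrite L0 a0 b0.
apply: le_trans (ler_sum _ (fun x _ => step x)) _.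
rewrite -mulr_sumr exchange_big /=.
have -> : L ^- 2 / (1 - z) ^+ 2 * N = (1 - z)^-1 * ((1 - z)^-1 * (L ^- 2 * N)).
  have z1' : 1 - z != 0 by rewrite subr_eq0 eq_sym lt_eqF.
  have L0 : L != 0 by rewrite gt_eqF.
  by field; rewrite z1' L0.
apply: ler_wpM2l; first by rewrite invr_ge0 subr_ge0 ltW.
apply: (@le_trans _ _ (\sum_(0 <= k < n) z ^+ k * (L ^- 2 * N))); last first.
  by rewrite -mulr_suml ler_wpM2r // mulr_ge0 // invr_ge0 sqr_ge0.
apply: ler_sum => k _; rewrite -mulr_sumr.
have rk0 : r ^+ k != 0 by rewrite expf_neq0 // gt_eqF.
have -> : z ^+ k * (L ^- 2 * N) =
   L ^- 2 * (z ^+ k / r ^+ k ^+ 2) * (r ^+ k ^+ 2 * N).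
  by field; rewrite rk0 /= gt_eqF.
apply: ler_wpM2l; first by rewrite mulr_ge0 ?invr_ge0 ?sqr_ge0 // divr_ge0 ?sqr_ge0 ?exprn_ge0.
exact: (iter_schur nb_uniq nb_sym h_gt0 r_gt0 h_super k fN).
Qed.

(** The Neumann series, summed pointwise; the default value 0 can only be
    reached outside l2. *)
Let B (f : X -> C) (x : X) : C := xget 0 [set l | ccvg (neumann f x) l].

Let BP f N x : sqle f N -> ccvg (neumann f x) (B f x).
Proof. move=> /(neumann_cvg x) ex; exact: (@xgetPex _ 0 [set l | ccvg (neumann f x) l] ex). Qed.

(** A finite sum of squares is a continuous function of the pointwise limits, so
    the uniform bound on the partial sums passes to the limit. *)
Let B_bound f N : sqle f N -> sqle (B f) (L ^- 2 / (1 - z) ^+ 2 * N).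
Proof.
move=> fN J uJ.
have cv : (fun n => \sum_(x <- J) normc (neumann f x n) ^+ 2) @ \oo -->
    \sum_(x <- J) normc (B f x) ^+ 2.
  elim: (J) => [|x s ih].
    by under eq_fun do rewrite big_nil; rewrite big_nil; exact: cvg_cst.
  under eq_fun do rewrite big_cons; rewrite big_cons; apply: cvgD => //.
  exact/ccvg_normc_sqr/(BP _ fN).
rewrite -(cvg_lim _ cv) //; apply: limr_le; first by apply/cvg_ex; eexists; exact: cv.
by apply: nearW => n; exact: (neumann_bound n fN).
Qed.

Let neumann_lin c f g x n :
  neumann (fun x => c * f x + g x) x n = c * neumann f x n + neumann g x n.
Proof.
rewrite /neumann mulr_sumr -big_split /=; apply: eq_bigr => k _.
by rewrite /term iter_nbsum_lin; ring.
Qed.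

Let B_eq f N x l : sqle f N -> ccvg (neumann f x) l -> B f x = l.
Proof. by move=> fN; apply: ccvg_unique; exact: (BP _ fN). Qed.

(** The sum telescopes. *)
Let shifted_sum f x n :
  A (fun y => neumann f y n) x - lambda * neumann f x n =
  f x + - (lambda ^- n * iter n A f x).
Proof.
rewrite /neumann; elim: n => [|n ih].
  rewrite big_geq // mulr0 subr0 expr0 invr1 mul1r /= subrr.
  by rewrite /nbsum big1 // => y _; rewrite big_geq.
rewrite big_nat_recr //= mulrDr opprD.
have -> : A (fun y => \sum_(0 <= k < n.+1) term f y k) x =
   A (fun y => \sum_(0 <= k < n) term f y k) x + - lambda ^- n.+1 * iter n.+1 A f x.
  rewrite /nbsum mulr_sumr -big_split /=; apply: eq_bigr => y _.
  by rewrite big_nat_recr.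
rewrite addrACA ih /term.
have ln0 : lambda ^+ n != 0 by rewrite expf_neq0.
rewrite [lambda ^+ n.+1]exprS.
rewrite /=; move: (lambda ^+ n) ln0 (iter n A f x) (A (iter n A f) x) => a a0 b c.
by field; rewrite lambda_neq0 a0.
Qed.

Let tail_cvg f N x : sqle f N -> ccvg (fun n => - (lambda ^- n * iter n A f x)) 0.
Proof.
move=> fN; have [l [lr li]] := neumann_cvg x fN.
have Sl : ccvg (fun n => neumann f x n.+1) l.
  by split; [rewrite (cvg_shiftS (fun n => complex.Re (neumann f x n)))
           | rewrite (cvg_shiftS (fun n => complex.Im (neumann f x n)))].
have := ccvgM lambda (ccvgD Sl (ccvgM (-1) (conj lr li))).
rewrite mulN1r subrr mulr0; congr ccvg; apply/funext => n.
rewrite /neumann big_nat_recr //= /term [lambda ^+ n.+1]exprS.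
have ln0 : lambda ^+ n != 0 by rewrite expf_neq0.
move: (lambda ^+ n) ln0 (iter n A f x) (bigop.body _ _ _) => a a0 b c.
by field; rewrite lambda_neq0 a0.
Qed.

(** The inverse is the Neumann series: its partial sums are inverse to
    A - lambda up to lambda^-n A^n f, the general term of a convergent series.
    Since the graph is locally finite, A is a finite sum at each vertex and
    commutes with pointwise limits. *)
Lemma resolvent_exists : l2_invertible (fun f x => A f x - lambda * f x).
Proof.
exists B; split.
  split.
  - by move=> f /l2_sqle fN; exact: sqle_l2 (B_bound fN).
  - move=> c f g /l2_sqle fN /l2_sqle gM; apply/funext => x.
    apply: (B_eq (sqle_lin c fN gM)).
    have -> : neumann (fun x => c * f x + g x) x =
              (fun n => c * neumann f x n + neumann g x n).
      by apply/funext => n; exact: neumann_lin.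
    by apply: ccvgD (BP _ gM); apply: ccvgM; exact: (BP _ fN).
  - exists (L ^-1 / (1 - z)) => f /l2_sqle fN; apply: l2norm_le.
      have /andP[z0 z1] := z01.
      by rewrite mulr_ge0 ?l2norm_ge0 // divr_ge0 // ?invr_ge0 ?subr_ge0 ltW.
    by rewrite exprMn expr_div_n exprVn; exact: B_bound.
move=> f /l2_sqle fN; split; apply/funext => x.
  have gM := sqle_lin (- lambda) fN (schur_test nb_uniq nb_sym h_gt0 r_gt0 h_super fN).
  have gE : (fun x => - lambda * f x + A f x) = (fun x => A f x - lambda * f x).
    by apply/funext => y; rewrite addrC mulNr.
  rewrite gE in gM.
  apply: (B_eq gM).
  have := ccvgD (ccvg_cst (f x)) (tail_cvg x fN); rewrite addr0.
  congr ccvg; apply/funext => n; rewrite -shifted_sum -gE neumann_lin mulNr addrC.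
  congr (_ + _); rewrite /neumann /nbsum exchange_big /=; apply: eq_bigr => k _.
  rewrite /term -mulr_sumr; congr (_ * _).
  by rewrite -/(nbsum nb (iter k A f) x) -iterS iterSr.
have h1 : ccvg (fun n => A (fun y => neumann f y n) x - lambda * neumann f x n)
            (A (B f) x - lambda * B f x).
  rewrite -mulNr; under eq_fun do rewrite -mulNr.
  apply: ccvgD; last by apply: ccvgM; exact: (BP _ fN).
  by apply: ccvg_sum => y; exact: (BP _ fN).
apply: (ccvg_unique h1).
have := ccvgD (ccvg_cst (f x)) (tail_cvg x fN); rewrite addr0.
by congr ccvg; apply/funext => n; rewrite -shifted_sum.
Qed.

End Resolvent.

(** A bounded inverse of A - lambda, of norm M say, would give
    |f| <= M |(A - lambda) f|, which fails as soon as eta M^2 < 1. *)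
Lemma approx_eigenvector_spectrum (R : realType) (X : choiceType)
    (A : (X -> R[i]) -> X -> R[i]) (lambda : R[i]) :
  (forall eta : R, 0 < eta -> exists (f : X -> R[i]) (N : R),
     [/\ l2 f, 0 < N, N <= l2norm f ^+ 2 &
         sqle (fun x => A f x - lambda * f x) (eta * N)]) ->
  l2_spectrum A lambda.
Proof.
move=> approx [B [[_ _ [M BM]] AB]].
have [f [N [lf N0 Nf fN]]] := approx (M ^+ 2 + 1)^-1 ltac:(by rewrite invr_gt0 ltr_wpDl ?sqr_ge0).
have lg := sqle_l2 fN.
have := BM _ lg; rewrite (AB _ lf).1 => h1.
have := l2norm_sqr_le fN; set g := l2norm (fun x => A f x - lambda * f x) in h1 *.
have g0 : 0 <= g := l2norm_ge0 _.
have h2 : l2norm f ^+ 2 <= M ^+ 2 * g ^+ 2.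
  have Mg0 : 0 <= M * g by exact: le_trans (l2norm_ge0 _) h1.
  by rewrite -exprMn ler_pXn2r ?nnegrE ?l2norm_ge0.
rewrite mulrC ler_pdivlMr ?ltr_wpDl ?sqr_ge0 //= mulrDr mulr1 => h3.
have h4 : M ^+ 2 * g ^+ 2 <= N - g ^+ 2 by rewrite lerBrDr mulrC.
have h5 : N <= N - g ^+ 2 by apply: le_trans Nf _; exact: le_trans h2 h4.
have g2 : g ^+ 2 = 0.
  by apply/eqP; rewrite eq_le sqr_ge0 andbT; rewrite lerBrDr gerDl in h5.
move: h2; rewrite g2 mulr0 => h2.
by move: (lt_le_trans N0 (le_trans Nf h2)); rewrite ltxx.
Qed.

Lemma card_deep_box n v : #|[pred a : {ffun 'I_n -> 'I_(v + 4).+1} |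
   [forall i, 2 <= (a i)%:Z <= (v + 4)%:Z - 2]]| = (v.+1 ^ n)%N.
Proof.
pose D : pred 'I_(v + 4).+1 := [pred k : 'I_(v + 4).+1 | 2 <= k <= v + 2]%N.
have -> : v.+1 = #|D|.
  pose g (k : 'I_v.+1) : 'I_(v + 4).+1 := inord k.+2.
  have gE k : g k = k.+2 :> nat by rewrite /g inordK; have := ltn_ord k; lia.
  have g_inj : injective g.
    by move=> k l /(congr1 val); rewrite /= !gE => -[kl]; exact: val_inj.
  rewrite -[v.+1 in LHS]card_ord -(card_codom g_inj); apply: eq_card => k.
  rewrite !inE; apply/codomP/idP => [[l ->]|kD].
    by rewrite gE; have := ltn_ord l; lia.
  have k2 : (k - 2 < v.+1)%N by lia.
  by exists (Ordinal k2); apply: val_inj; rewrite /= gE /=; lia.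
rewrite -[n in RHS]card_ord -card_ffun_on; apply: eq_card => a.
rewrite !inE; apply/forallP/ffun_onP => ad i; move: (ad i) => {ad}; by rewrite !inE; move: (nat_of_ord _) => b; clear; lia.
Qed.

(** * Graphs with horocyclic types *)

(** What is used of the building: its vertices project onto the vertices
    (levels and types) of an apartment, the number of edges at a vertex that lie
    above a given edge of the apartment is a power of q depending only on the
    direction of that edge, and [windows] reflects that the unipotent group
    acting on the fibres is exhausted by compact subgroups, whose orbits are
    finite and closed under moves within a box. *)
Section HorocyclicGraph.
Variables (R : realType) (X : choiceType) (adj : X -> X -> Prop).
Variables (q n : nat) (c : 'I_n -> nat).
Variables (lev : X -> bool) (typ : X -> {ffun 'I_n -> int}).
Local Notation C := R[i].
Local Notation ffb := {ffun 'I_n -> bool}.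

(** The dimension of the Schubert cell of direction e. *)
Definition cost (e : ffb) : nat := \sum_(i | e i) c i.
Definition total_cost : nat := \sum_i c i.
Definition shift (b : bool) (e : ffb) (a : {ffun 'I_n -> int}) : {ffun 'I_n -> int} :=
  [ffun i => if b then a i - (e i)%:Z else a i + (e i)%:Z].
Definition in_box (w : nat) (a : {ffun 'I_n -> int}) : bool :=
  [forall i, 0 <= a i <= w%:Z].

Hypothesis q_gt0 : (0 < q)%N.
Hypothesis adj_sym : forall x y, adj x y -> adj y x.
Hypothesis adj_shift : forall x y, adj x y ->
  lev y = ~~ lev x /\ exists e, typ y = shift (lev x) e (typ x).
Hypothesis adj_count : forall x e,
  ([set y | adj x y /\ typ y = shift (lev x) e (typ x)] #=
   `I_(q ^ (if lev x then total_cost - cost e else cost e)))%card.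
Hypothesis windows : forall w : nat, exists F : set X,
  [/\ finite_set F,
      forall x, F x -> in_box w (typ x),
      exists2 x, F x & lev x = false /\ forall i, typ x i = 0 &
      forall x y, F x -> adj x y -> in_box w (typ y) -> F y].

Let s : R := Num.sqrt q%:R.
Let s_gt0 : 0 < s. Proof. by rewrite sqrtr_gt0 ltr0n. Qed.
Let s_neq0 : s != 0. Proof. by rewrite gt_eqF. Qed.

Let r : R := 2 ^+ n * s ^+ total_cost.
Let r_gt0 : 0 < r. Proof. by rewrite mulr_gt0 ?exprn_gt0. Qed.

(** The function s^(- kappa), with s the square root of q, is a square root of the
    modular function of a Borel subgroup. *)
Let kappa (b : bool) (a : {ffun 'I_n -> int}) : int :=
  \sum_i (c i)%:Z * (2 * a i - b%:Z).
Let h (x : X) : R := s ^ (- kappa (lev x) (typ x)).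
Let h_gt0 x : 0 < h x. Proof. exact: exprz_gt0. Qed.

Lemma cost_le e : (cost e <= total_cost)%N.
Proof. by rewrite /cost /total_cost [leqRHS](bigID (fun i => e i)) leq_addr. Qed.

Let kappa_shift b e a : kappa (~~ b) (shift b e a) =
  kappa b a + (if b then total_cost%:Z - (2 * cost e)%:Z else (2 * cost e)%:Z - total_cost%:Z).
Proof.
have E1 : total_cost%:Z = \sum_i (c i)%:Z by rewrite /total_cost raddf_sum.
have E2 : (2 * cost e)%:Z = \sum_i 2 * ((c i)%:Z * (e i)%:Z).
  rewrite PoszM /cost raddf_sum -mulr_sumr; congr (_ * _).
  by rewrite big_mkcond; apply: eq_bigr => i _; case: (e i); rewrite ?mulr1 ?mulr0.
have -> : (if b then total_cost%:Z - (2 * cost e)%:Z else (2 * cost e)%:Z - total_cost%:Z) =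
  \sum_i (if b then (c i)%:Z - 2 * ((c i)%:Z * (e i)%:Z)
          else 2 * ((c i)%:Z * (e i)%:Z) - (c i)%:Z).
  by case: b; rewrite E1 E2 -sumrB.
rewrite /kappa -big_split /=; apply: eq_bigr => i _; rewrite ffunE.
by case: b => /=; ring.
Qed.

Let adj_finite x : finite_set [set y | adj x y].
Proof.
apply: (@sub_finite_set _ _ (\bigcup_(e in [set: ffb])
    [set y | adj x y /\ typ y = shift (lev x) e (typ x)])).
  by move=> y xy; have [_ [e ye]] := adj_shift xy; exists e.
apply: bigcup_finite; first exact: finite_finset.
by move=> e _; exists (q ^ (if lev x then total_cost - cost e else cost e))%N.
Qed.

Let nb (x : X) : seq X := fset_set [set y | adj x y].
Let nbP x y : reflect (adj x y) (y \in nb x).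
Proof. by rewrite /nb in_fset_set; [apply: (iffP idP) => [/set_mem|/mem_set] | exact: adj_finite]. Qed.
Let nb_uniq x : uniq (nb x). Proof. exact: fset_uniq. Qed.
Let nb_sym x y : (y \in nb x) = (x \in nb y).
Proof. by apply/nbP/nbP; exact: adj_sym. Qed.

Let adjacency_nbsum : adjacency_operator (R := R) adj = nbsum nb.
Proof.
by apply/funext => f; apply/funext => x; rewrite /adjacency_operator fsbig_finite.
Qed.

Let eps (x y : X) : ffb := [ffun i => typ y i != typ x i].

Let eps_shift x y e : typ y = shift (lev x) e (typ x) -> eps x y = e.
Proof.
move=> ye; apply/ffunP => i; rewrite ffunE ye ffunE.
by case: (lev x); case: (e i); apply/eqP; lia.
Qed.

Let epsE x y e : adj x y -> (eps x y == e) = (typ y == shift (lev x) e (typ x)).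
Proof.
move=> xy; apply/eqP/eqP => [<-|]; last exact: eps_shift.
by have [_ [e' ye']] := adj_shift xy; rewrite (eps_shift ye').
Qed.

Let size_nb_eps x e : size [seq y <- nb x | eps x y == e] =
  (q ^ (if lev x then total_cost - cost e else cost e))%N.
Proof.
set D := [set y | adj x y /\ typ y = shift (lev x) e (typ x)].
have cD := adj_count x e.
have finD : finite_set D by exists (q ^ (if lev x then total_cost - cost e else cost e))%N.
rewrite -(card_fset_set cD); apply: perm_size; apply: uniq_perm; rewrite ?filter_uniq ?fset_uniq //.
move=> y; rewrite mem_filter [y \in fset_set D]in_fset_set // andbC; apply/andP/idP.
  by move=> [/nbP xy]; rewrite epsE // => /eqP ye; apply/mem_set.
move=> /set_mem[xy ye]; split; first exact/nbP.
by rewrite epsE // ye.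
Qed.

(** Along a shift e from level false, kappa grows by 2 cost e - C, where C is the
    total cost, and there are q^(cost e) = s^(2 cost e) such neighbours: the
    weight is s^C for every e.  From level true the signs change and C - cost e
    replaces cost e. *)
Let sum_nb x (psi : bool -> {ffun 'I_n -> int} -> R) :
  \sum_(y <- nb x) h y * psi (lev y) (typ y) =
  h x * s ^+ total_cost * \sum_e psi (~~ lev x) (shift (lev x) e (typ x)).
Proof.
rewrite (partition_big (eps x) predT) //= mulr_sumr; apply: eq_bigr => e _.
set v := psi _ _.
rewrite -big_filter big_seq_cond.
rewrite (eq_bigr (fun=> s ^ (- kappa (~~ lev x) (shift (lev x) e (typ x))) * v)); last first.
  move=> y; rewrite andbT mem_filter => /andP[+ /nbP xy].
  by rewrite epsE // /h => /eqP ye; rewrite (adj_shift xy).1 ye.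
rewrite -big_seq_cond big_const_seq count_predT iter_addr_0 size_nb_eps kappa_shift.
rewrite -[_ *+ _]mulr_natl mulrA; congr (_ * _).
have -> : (q ^ (if lev x then total_cost - cost e else cost e))%N%:R =
   s ^ (2 * (if lev x then total_cost%:Z - (cost e)%:Z else (cost e)%:Z)).
  rewrite natrX -[q%:R](sqr_sqrtr (ler0n _ _)) -/s -exprM.
  by case: (lev x); rewrite exprnP; congr (_ ^ _); have := cost_le e; lia.
rewrite /h exprnP -!expfzDr //; congr (_ ^ _).
by case: (lev x); ring.
Qed.


Let card_ffb : #|[set: ffb]%SET| = (2 ^ n)%N.
Proof. by rewrite cardsT card_ffun card_bool card_ord. Qed.

Let h_harmonic x : \sum_(y <- nb x) h y = r * h x.
Proof.
have := sum_nb x (fun _ _ => 1); under eq_bigr do rewrite mulr1.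
move=> ->; rewrite sumr_const -cardsT card_ffb natrX /r; ring.
Qed.

(** The eigenfunction h is a supersolution, so the Schur test applies. *)
Let spectrum_bound lambda :
  l2_spectrum (adjacency_operator (R := R) adj) lambda -> normc lambda <= r.
Proof.
rewrite leNgt => H; apply/negP => rl; apply: H; rewrite adjacency_nbsum.
apply: (resolvent_exists nb_uniq nb_sym h_gt0 r_gt0 _ rl) => x.
by rewrite h_harmonic.
Qed.

Let inner (w : nat) (a : {ffun 'I_n -> int}) : bool := [forall i, 1 <= a i <= w%:Z - 1].
Let deep (w : nat) (a : {ffun 'I_n -> int}) : bool := [forall i, 2 <= a i <= w%:Z - 2].

Let card_deep v : #|[pred a : {ffun 'I_n -> 'I_(v + 4).+1} |
   deep (v + 4) [ffun i => (a i)%:Z]]| = (v.+1 ^ n)%N.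
Proof.
rewrite -card_deep_box; apply: eq_card => a; rewrite !inE; apply: eq_forallb => i.
by rewrite ffunE.
Qed.

(** With t = 4 / (v + 1), convexity gives (1 + t)^n - 1 <= t (2^n - 1). *)
Let small_ratio (eta : R) : 0 < eta -> exists v : nat,
  (v + 5)%N%:R ^+ n - v.+1%:R ^+ n <= eta * v.+1%:R ^+ n.
Proof.
move=> eta0.
have pow (t : R) m : 0 <= t <= 1 -> (1 + t) ^+ m <= 1 + t * (2 ^+ m - 1).
  move=> /andP[t0 t1]; elim: m => [|m ih]; first by rewrite !expr0 subrr mulr0 addr0.
  rewrite exprS; apply: le_trans (ler_wpM2l _ ih) _; first by rewrite addr_ge0.
  have : 1 <= 2 ^+ m :> R by rewrite exprn_ege1 // ler1n.
  rewrite exprS; move: (2 ^+ m) => u u1.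
  have := mulr_ge0 (mulr_ge0 t0 (_ : 0 <= 1 - t)) (_ : 0 <= u - 1).
  by rewrite !subr_ge0 => /(_ t1 u1); lra.
pose d : R := eta / (2 ^+ n).
have d0 : 0 < d by rewrite divr_gt0 ?exprn_gt0.
(* The summand 4 makes t at most 1. *)
pose v := (Num.truncn (4 / d) + 4)%N.
exists v.
have v0 : 0 < v.+1%:R :> R by rewrite ltr0n.
have vd : 4 / d < v.+1%:R.
  apply: lt_le_trans (truncnS_gt _) _; rewrite ler_nat /v; move: (Num.truncn _) => k; clear; lia.
pose t : R := 4 / v.+1%:R.
have t01 : 0 <= t <= 1.
  rewrite divr_ge0 ?ler0n //= ler_pdivrMr // mul1r ler_nat /v; lia.
have -> : (v + 5)%N%:R = v.+1%:R * (1 + t).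
  have -> : (v + 5)%N = (v.+1 + 4)%N by lia.
  by rewrite natrD /t mulrDr mulr1 mulrCA divff ?gt_eqF // mulr1.
rewrite exprMn -[X in _ - X]mulr1 -mulrBr mulrC ler_wpM2r ?exprn_ge0 ?ler0n //.
have td : t <= d.
  by rewrite /t ler_pdivrMr // mulrC -ler_pdivrMr // ltW.
have := pow t n t01; have /andP[t0 _] := t01.
have : eta = d * 2 ^+ n by rewrite /d divfK // expf_neq0.
have : 1 <= 2 ^+ n :> R by rewrite exprn_ege1 // ler1n.
move: (2 ^+ n) ((1 + t) ^+ n) => u y u1 -> h1; nra.
Qed.

Section Window.
Variables (v : nat) (F : set X).
Local Notation w := (v + 4)%N.
Hypothesis finF : finite_set F.
Hypothesis F_box : forall x, F x -> in_box w (typ x).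
Hypothesis F_base : exists2 x, F x & lev x = false /\ forall i, typ x i = 0.
Hypothesis F_closed : forall x y, F x -> adj x y -> in_box w (typ y) -> F y.

Let Fs : seq X := fset_set F.
Let FsP x : reflect (F x) (x \in Fs).
Proof. by rewrite /Fs in_fset_set //; apply: (iffP idP) => [/set_mem|/mem_set]. Qed.
Let Fs_uniq : uniq Fs. Proof. exact: fset_uniq. Qed.

(** The measure h^2 makes the random walk with steps h y / (r h x) reversible;
    this is the mass it gives to a fibre of the projection to types. *)
Let mass (b : bool) (a : {ffun 'I_n -> int}) : R :=
  \sum_(x <- Fs | (lev x == b) && (typ x == a)) h x ^+ 2.

Let shiftK b e a : shift (~~ b) e (shift b e a) = a.
Proof. by apply/ffunP => i; rewrite !ffunE; case: b => /=; ring. Qed.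

Let shift_inj b e e' a : (shift b e a == shift b e' a) = (e == e').
Proof.
apply/eqP/eqP => [/ffunP E|-> //]; apply/ffunP => i.
by move/(_ i): E; rewrite !ffunE; case: b; case: (e i); case: (e' i) => //; lia.
Qed.

(** Edges from F to another type of the box end in F, so the left-hand side can
    be summed over all neighbours of x. *)
Let half_mass b e a : in_box w a -> in_box w (shift b e a) ->
  \sum_(x <- Fs | (lev x == b) && (typ x == a))
    \sum_(y <- Fs | (lev y == ~~ b) && (typ y == shift b e a) && (y \in nb x)) h x * h y =
  s ^+ total_cost * mass b a.
Proof.
move=> wa wb; rewrite /mass mulr_sumr.
rewrite [LHS]big_seq_cond [RHS]big_seq_cond; apply: eq_bigr => x.
move=> /andP[/FsP Fx /andP[/eqP xb /eqP xa]].
pose P y := (lev y == ~~ b) && (typ y == shift b e a).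
have := sum_nb x (fun b' a' => ((b' == ~~ b) && (a' == shift b e a))%:R).
rewrite xb xa eqxx /=.
under [X in _ = _ * X]eq_bigr do rewrite shift_inj.
rewrite (bigD1 e) //= eqxx [X in _ + X]big1 => [|e' /negPf ->] //.
rewrite addr0 mulr1 => E.
rewrite -mulr_sumr expr2 mulrCA [s ^+ _ * _]mulrC -E; congr (_ * _).
rewrite -[LHS]big_filter (perm_big [seq y <- nb x | P y]); last first.
  apply: uniq_perm; rewrite ?filter_uniq // => y; rewrite !mem_filter /P.
  case: (lev y == ~~ b) => //=; case: (typ y =P shift b e a) => //= yt; apply/andP/idP => [[]//|yx].
  split => //; apply/FsP; apply: F_closed Fx _ _; first exact/nbP.
  by rewrite yt.
rewrite big_filter big_mkcond; apply: eq_bigr => y _.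
by rewrite -/(P y); case: (P y); rewrite ?mulr1 ?mulr0.
Qed.

(** Both sides count the edges between the two types with the weight h x * h y,
    once from each end. *)
Let mass_shift b e a : in_box w a -> in_box w (shift b e a) ->
  mass (~~ b) (shift b e a) = mass b a.
Proof.
move=> wa wb; apply/(mulfI (_ : s ^+ total_cost != 0)).
  by rewrite expf_neq0.
rewrite -(@half_mass b e a) // -(@half_mass (~~ b) e (shift b e a)) ?shiftK //.
under [LHS]eq_bigr do rewrite big_mkcondr.
rewrite exchange_big /= negbK; apply: eq_bigr => x _.
rewrite [RHS]big_mkcondr; apply: eq_bigr => y _.
by rewrite nb_sym mulrC.
Qed.

Let zero : {ffun 'I_n -> int} := [ffun _ => 0].

(** Going up by a 0-1 vector and back by zero moves from any type of level false
    to that type plus a unit vector; induction on the sum of the coordinates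
    then brings every type to the origin. *)
Let mass_const b a : in_box w a -> mass b a = mass false zero.
Proof.
have main a' : in_box w a' -> mass false a' = mass false zero.
  have [m] := ubnP (\sum_i `|a' i|)%N; elim: m a' => // m ih a' am wa.
  have [/forallP a0|] := boolP [forall i, a' i == 0].
    by congr (mass _ _); apply/ffunP => i; rewrite ffunE; apply/eqP.
  rewrite negb_forall => /existsP[i ai0].
  have aw j : 0 <= a' j <= w%:Z by exact: (forallP wa).
  pose e : ffb := [ffun j => j == i].
  pose e0 : ffb := [ffun _ => false].
  have wb : in_box w (shift true e a').
    apply/forallP => j; rewrite !ffunE; have := aw j.
    by case: eqP => [->|_] /=; move: ai0; lia.
  have e0E b' c' : shift b' e0 c' = c'.
    by apply/ffunP => j; rewrite !ffunE; case: b'; rewrite ?subr0 ?addr0.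
  have := @mass_shift false e0 a'; rewrite e0E => <- //.
  rewrite -(@mass_shift true e a') // ih //.
  rewrite ltnS in am; apply: leq_trans am; rewrite [leqRHS](bigD1 i) //= [X in (X < _)%N](bigD1 i) //=.
  rewrite (eq_bigr (fun j => `|a' j|%N)); last first.
    by move=> j /negPf ji; rewrite !ffunE ji subr0.
  by rewrite ltn_add2r !ffunE eqxx /=; have := aw i; move: ai0; lia.
move=> wa; case: b; last exact: main.
rewrite -(main a) //.
pose e0 : ffb := [ffun _ => false].
have e0E b' c' : shift b' e0 c' = c'.
  by apply/ffunP => j; rewrite !ffunE; case: b'; rewrite ?subr0 ?addr0.
by have := @mass_shift false e0 a; rewrite e0E; apply.
Qed.

Let mass_gt0 : 0 < mass false zero.
Proof.
have [x Fx [lx tx]] := F_base; rewrite /mass (big_rem x) //=; last exact/FsP.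
have -> : (lev x == false) && (typ x == zero).
  by rewrite lx eqxx /=; apply/eqP/ffunP => i; rewrite tx ffunE.
by apply: ltr_wpDr; [apply: sumr_ge0 => y _; exact: sqr_ge0 | exact: exprn_gt0].
Qed.

Let code (x : X) : bool * {ffun 'I_n -> 'I_w.+1} :=
  (lev x, [ffun i => inord `|typ x i|%N]).

Let decode (a : {ffun 'I_n -> 'I_w.+1}) : {ffun 'I_n -> int} := [ffun i => (a i)%:Z].

Let sum_types (P : pred {ffun 'I_n -> int}) :
  \sum_(x <- Fs | P (typ x)) h x ^+ 2 =
  mass false zero * (2 * #|[pred a | P (decode a)]|)%N%:R.
Proof.
pose Q (ba : bool * {ffun 'I_n -> 'I_w.+1}) := P (decode ba.2).
have codeK x : x \in Fs -> decode (code x).2 = typ x.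
  move=> /FsP/F_box/forallP xw; apply/ffunP => i; rewrite !ffunE.
  have /andP[x0 xw'] := xw i; rewrite inordK ?gez0_abs //.
  by rewrite -ltz_nat gez0_abs //; apply: le_lt_trans xw' _.
rewrite big_seq_cond (partition_big code Q) /=; last first.
  by move=> x /andP[xF]; rewrite /Q codeK.
rewrite (eq_bigr (fun=> mass false zero)); last first.
  move=> [b a] Pa; rewrite -(@mass_const b (decode a)); last first.
    by apply/forallP => i; rewrite ffunE; have := ltn_ord (a i); lia.
  rewrite /mass [RHS]big_seq_cond; apply: eq_bigl => x.
  case: (boolP (x \in Fs)) => //= xF; apply/andP/andP.
    move=> [Px /eqP E]; rewrite -(codeK x xF) E /=.
    by move: E => [<- _]; rewrite !eqxx.
  move=> [/eqP lx /eqP tx]; rewrite tx; split => //.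
  apply/eqP; rewrite /code lx tx; congr pair; apply/ffunP => i; rewrite !ffunE.
  by apply: val_inj; rewrite /= inordK.
rewrite sumr_const -[_ *+ _]mulr_natr; congr (_ * _%:R).
rewrite -[X in (X * _)%N]card_bool -cardX.
by apply: eq_card => -[b a]; rewrite !inE.
Qed.


Let supported_sqle (g : X -> C) (D : pred {ffun 'I_n -> int}) (k : R) :
  (forall x, x \notin Fs -> g x = 0) ->
  (forall x, x \in Fs -> normc (g x) ^+ 2 <= k * (if D (typ x) then h x ^+ 2 else 0)) ->
  sqle g (k * (mass false zero * (2 * #|[pred a | D (decode a)]|)%N%:R)).
Proof.
move=> g0 gk J uJ; rewrite -sum_types.
have -> : \sum_(x <- J) normc (g x) ^+ 2 = \sum_(x <- J | x \in Fs) normc (g x) ^+ 2.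
  rewrite [RHS]big_mkcond; apply: eq_bigr => x _; case: ifPn => // /g0 ->.
  by rewrite ComplexField.Normc.normc0 expr0n.
rewrite -big_filter; apply: (@le_trans _ _ (\sum_(x <- Fs) normc (g x) ^+ 2)).
  apply: le_sum_subset => //; first exact: filter_uniq.
    by move=> x; rewrite mem_filter => /andP[].
  by move=> x; exact: sqr_ge0.
rewrite mulr_sumr [leRHS]big_mkcond /= big_seq [leRHS]big_seq; apply: ler_sum => x /gk.
by case: ifP => _; rewrite ?mulr0.
Qed.

(** The test function is h on the vertices of F with inner types.  At a
    deep vertex of F all neighbours are inner and in F, so (A - r) f vanishes there
    as (A - r) h does.
    A vertex outside F has no inner neighbour in F, since such a neighbour would
    put its type in the box.  At the other vertices |(A - r) f| <= r h, and
    by constancy of the mass it remains to count types. *)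
Lemma window_test_function (eta : R) :
  (v + 5)%N%:R ^+ n - v.+1%:R ^+ n <= eta / r ^+ 2 * v.+1%:R ^+ n ->
  exists (f : X -> C) (N : R), [/\ l2 f, 0 < N, N <= l2norm f ^+ 2 &
    sqle (fun x => adjacency_operator adj f x - (r%:C)%C * f x) (eta * N)].
Proof.
move=> vP.
pose k0 := mass false zero.
have k0_gt0 : 0 < k0 := mass_gt0.
pose f (x : X) : R := if (x \in Fs) && inner w (typ x) then h x else 0.
exists (fun x => (f x)%:C%C), (k0 * (2 * v.+1 ^ n)%N%:R).
have inner_box a b e : inner w a -> in_box w (shift b e a).
  move=> /forallP ia; apply/forallP => i; rewrite ffunE; have := ia i.
  by case: b; case: (e i); move: (a i) => k; clear; lia.
have deep_inner a b e : deep w a -> inner w (shift b e a).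
  move=> /forallP ia; apply/forallP => i; rewrite ffunE; have := ia i.
  by case: b; case: (e i); move: (a i) => k; clear; lia.
have deep_inner' a : deep w a -> inner w a.
  by move=> /forallP ia; apply/forallP => i; have := ia i; lia.
have f0 x : x \notin Fs -> f x = 0 by rewrite /f => /negPf ->.
have lf : l2 (fun x => (f x)%:C%C).
  apply: (sqle_l2 (@supported_sqle (fun x => (f x)%:C%C) (inner w) 1 _ _)).
    by move=> x /f0 ->.
  move=> x xF; rewrite normcR real_normK ?num_real // mul1r /f xF /=.
  by case: ifP => _; rewrite ?expr0n.
split => //.
- by rewrite mulr_gt0 // ltr0n muln_gt0 /= expn_gt0.
- apply: le_trans (l2_sqle lf Fs_uniq).
  rewrite -(card_deep v) -sum_types big_mkcond big_seq [leRHS]big_seq.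
  apply: ler_sum => x xF.
  rewrite normcR real_normK ?num_real // /f xF /=.
  case: ifP => [/deep_inner' -> //|_]; exact: sqr_ge0.
have Af x : adjacency_operator (R := R) adj (fun x => (f x)%:C%C) x =
    (\sum_(y <- nb x) f y)%:C%C.
  by rewrite adjacency_nbsum /nbsum rmorph_sum.
have sum_f x : x \in Fs -> \sum_(y <- nb x) f y =
    h x * s ^+ total_cost * \sum_e (inner w (shift (lev x) e (typ x)))%:R.
  move=> /FsP xF; rewrite -(sum_nb x (fun _ a => (inner w a)%:R)).
  rewrite big_seq [RHS]big_seq; apply: eq_bigr => y /nbP xy; rewrite /f.
  case: (boolP (inner w (typ y))) => yi; last by rewrite andbF mulr0.
  rewrite andbT mulr1 ifT //; apply/FsP; apply: F_closed xF xy _.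
  by have := inner_box (typ y) false [ffun=> false] yi; congr in_box; apply/ffunP => i; rewrite !ffunE addr0.
have gE x : adjacency_operator (R := R) adj (fun x => (f x)%:C%C) x - r%:C%C * (f x)%:C%C =
    (\sum_(y <- nb x) f y - r * f x)%:C%C by rewrite Af rmorphB [X in _ = _ - X]rmorphM.
have bound : sqle (fun x => adjacency_operator (R := R) adj (fun x => (f x)%:C%C) x -
    r%:C%C * (f x)%:C%C) (r ^+ 2 * (k0 * (2 * ((v + 5) ^ n - v.+1 ^ n))%N%:R)).
  have -> : ((v + 5) ^ n - v.+1 ^ n)%N =
     #|[pred a : {ffun 'I_n -> 'I_w.+1} | ~~ deep w [ffun i => (a i)%:Z]]|.
    rewrite -(card_deep v).
    set D := [pred a : {ffun 'I_n -> 'I_(v + 4).+1} | deep (v + 4) [ffun i => (a i)%:Z]].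
    rewrite (_ : #|[pred a | ~~ _]| = #|[predC D]|); last by apply: eq_card.
    have := cardC D; rewrite card_ffun !card_ord => cD.
    by rewrite (_ : v + 5 = w.+1)%N; [rewrite -cD addnC addnK | lia].
  apply: (@supported_sqle _ (fun a => ~~ deep w a)) => x xF; rewrite gE.
    rewrite f0 // mulr0 subr0 big_seq big1 // => y /nbP xy; rewrite /f.
    case: ifP => // /andP[/FsP yF yi]; case/negP: xF; apply/FsP.
    apply: F_closed yF (adj_sym xy) _.
    by have [_ [e ->]] := adj_shift (adj_sym xy); exact: inner_box.
  rewrite normcR real_normK ?num_real // sum_f //.
  case: ifPn => [_|/negPn dx]; last first.
    rewrite /f xF (deep_inner' _ dx) /= (eq_bigr (fun=> 1)); last first.
      by move=> e _; rewrite deep_inner.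
    rewrite sumr_const -cardsT card_ffb natrX.
    have -> : h x * s ^+ total_cost * 2 ^+ n - r * h x = 0 by rewrite /r; ring.
    by rewrite expr0n mulr0.
  set m := \sum_e _.
  have m_le : 0 <= s ^+ total_cost * m <= r.
    rewrite mulr_ge0 ?exprn_ge0 ?sumr_ge0 //= ?(ltW s_gt0) //.
    rewrite /r mulrC ler_wpM2r ?exprn_ge0 // ?(ltW s_gt0) //.
    rewrite -natrX -card_ffb cardsT -sumr_const; apply: ler_sum => e _.
    by rewrite lern1 leq_b1.
  have b_le : 0 <= r * (inner w (typ x))%:R <= r.
    by case: (inner w _); rewrite ?mulr1 ?mulr0 lexx ?andbT ltW.
  have -> : f x = h x * (inner w (typ x))%:R.
    by rewrite /f xF /=; case: (inner w _); rewrite ?mulr1 ?mulr0.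
  have -> : h x * s ^+ total_cost * m - r * (h x * (inner w (typ x))%:R) =
     h x * (s ^+ total_cost * m - r * (inner w (typ x))%:R) by ring.
  rewrite exprMn mulrC ler_wpM2r ?sqr_ge0 //.
  move: (s ^+ _ * m) (r * (_)%:R) m_le b_le => u u' /andP[u0 u1] /andP[u'0 u'1].
  by rewrite -(real_normK (num_real (u - u'))) ler_pXn2r ?nnegrE ?(ltW r_gt0) // ler_norml; lra.
move=> J uJ; apply: le_trans (bound J uJ) _.
have -> : r ^+ 2 * (k0 * (2 * ((v + 5) ^ n - v.+1 ^ n))%N%:R) =
   (2 * k0) * (r ^+ 2 * ((v + 5)%N%:R ^+ n - v.+1%:R ^+ n)).
  rewrite natrM natrB ?natrX; first by ring.
  by rewrite -(ler_nat R) !natrX lerXn2r ?nnegrE ?ler0n // ler_nat; lia.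
have -> : eta * (k0 * (2 * v.+1 ^ n)%N%:R) = (2 * k0) * (eta * v.+1%:R ^+ n).
  by rewrite natrM natrX; ring.
rewrite ler_pM2l ?mulr_gt0 // mulrC -ler_pdivlMr ?exprn_gt0 //.
by apply: le_trans vP _; rewrite mulrAC.
Qed.

End Window.

Let spectrum_attained : l2_spectrum (adjacency_operator (R := R) adj) (r%:C)%C.
Proof.
apply: approx_eigenvector_spectrum => eta eta0.
have [v vP] := small_ratio (divr_gt0 eta0 (exprn_gt0 2 r_gt0)).
have [F [finF Fbox Fbase Fclosed]] := windows (v + 4).
exact: (window_test_function finF Fbox Fbase Fclosed vP).
Qed.

(** The spectrum lies in the disc of radius r and contains r. *)
Lemma spectral_radius_horocyclic : spectral_radius R adj = 2 ^+ n * s ^+ total_cost.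
Proof.
rewrite /spectral_radius -/r; set S := [set _ | _ in _].
have Sr : S r by exists (r%:C)%C; [exact: spectrum_attained | rewrite normcR gtr0_norm].
have ubr : ubound S r by move=> _ [lambda /spectrum_bound lr <-].
apply/eqP; rewrite eq_le; apply/andP; split.
  by apply: ge_sup => //; exists r.
by apply: ub_le_sup => //; exists r.
Qed.

End HorocyclicGraph.

(** * Discrete valuations *)

Section Valuation.
Variables (K : fieldType) (ord : K -> int) (varpi : K) (q : nat).
Hypothesis hK : local_field ord varpi q.
Local Notation P := (ord_ge ord).
Local Notation pi := varpi.

Lemma ord_one : ord 1 = 0.
Proof.
have h : ord (1 * 1) = ord 1 + ord 1 by apply: (ordM hK); exact: oner_neq0.
by rewrite mulr1 in h; lia.
Qed.

Lemma ord_opp x : x != 0 -> ord (- x) = ord x.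
Proof.
move=> x0; rewrite -mulN1r (ordM hK) ?oppr_eq0 ?oner_neq0 //.
have h : ord (-1 * -1) = ord (-1) + ord (-1).
  by apply: (ordM hK); rewrite oppr_eq0 oner_neq0.
by rewrite mulrNN mulr1 ord_one in h; lia.
Qed.

Lemma ord_inv x : x != 0 -> ord x^-1 = - ord x.
Proof.
move=> x0; have h : ord (x * x^-1) = ord x + ord x^-1.
  by apply: (ordM hK) => //; rewrite invr_eq0.
by rewrite divff // ord_one in h; lia.
Qed.

Lemma pi_neq0 : pi != 0. Proof. by have [] := ord_uniformizer hK. Qed.
Lemma ord_pi : ord pi = 1. Proof. by have [] := ord_uniformizer hK. Qed.

Lemma pi_exp_neq0 (k : int) : pi ^ k != 0.
Proof. by rewrite expfz_neq0 // pi_neq0. Qed.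

Lemma ord_pi_exp (k : int) : ord (pi ^ k) = k.
Proof.
have N j : ord (pi ^+ j) = j%:Z.
  elim: j => [|j ih]; first by rewrite expr0 ord_one.
  by rewrite exprS (ordM hK) ?expf_neq0 ?pi_neq0 // ih ord_pi; lia.
case: k => j; first by rewrite -exprnP N.
by rewrite NegzE -exprnN ord_inv ?expf_neq0 ?pi_neq0 // N.
Qed.

Lemma ord_geD m x y : P m x -> P m y -> P m (x + y).
Proof.
case: (eqVneq x 0) => [->|x0]; first by rewrite add0r.
case: (eqVneq y 0) => [->|y0]; first by rewrite addr0.
case=> [/eqP|mx]; first by rewrite (negPf x0).
case=> [/eqP|my]; first by rewrite (negPf y0).
case: (eqVneq (x + y) 0) => [->|xy0]; first by left.
by right; apply: le_trans (ordD hK x0 y0 xy0); rewrite le_min mx my.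
Qed.

Lemma ord_geN m x : P m x -> P m (- x).
Proof.
case: (eqVneq x 0) => [->|x0]; first by rewrite oppr0.
by case=> [/eqP|mx]; [rewrite (negPf x0) | right; rewrite ord_opp].
Qed.

Lemma ord_geB m x y : P m x -> P m y -> P m (x - y).
Proof. by move=> mx my; apply: ord_geD => //; exact: ord_geN. Qed.

Lemma ord_geM m k x y : P m x -> P k y -> P (m + k) (x * y).
Proof.
case: (eqVneq x 0) => [->|x0]; first by rewrite mul0r => *; left.
case: (eqVneq y 0) => [->|y0]; first by rewrite mulr0 => *; left.
case=> [/eqP|mx]; first by rewrite (negPf x0).
case=> [/eqP|my]; first by rewrite (negPf y0).
by right; rewrite (ordM hK) // lerD.
Qed.

Lemma ord_ge_le m k x : k <= m -> P m x -> P k x.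
Proof. by move=> km [->|mx]; [left | right; exact: le_trans mx]. Qed.

Lemma ord_ge_pi (k : int) : P k (pi ^ k).
Proof. by right; rewrite ord_pi_exp. Qed.

Lemma ord_ge1 : P 0 1. Proof. by right; rewrite ord_one. Qed.

Lemma ord_ge_mull m c x : c != 0 -> P m (c * x) <-> P (m - ord c) x.
Proof.
move=> c0; split.
  have Pc : P (- ord c) c^-1 by right; rewrite ord_inv.
  by move=> /(ord_geM Pc); rewrite mulKf // addrC.
have Pc : P (ord c) c by right.
by move=> /(ord_geM Pc); rewrite addrC subrK.
Qed.

Lemma ord_ge_pi_mul m (k : int) x : P m (pi ^ k * x) <-> P (m - k) x.
Proof. by rewrite ord_ge_mull ?pi_exp_neq0 // ord_pi_exp. Qed.

Lemma ord_ge_mono m k : (forall x, P m x -> P k x) -> k <= m.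
Proof.
move=> /(_ _ (ord_ge_pi m)) [/eqP|]; first by rewrite (negPf (pi_exp_neq0 _)).
by rewrite ord_pi_exp.
Qed.

Lemma ord_ge_inj m k : (forall x, P m x <-> P k x) -> m = k.
Proof. by move=> mk; apply/eqP; rewrite eq_le !ord_ge_mono // => x /mk. Qed.

Lemma ord_ge_not_all C : ~ (forall x, P C x).
Proof.
move=> /(_ (pi ^ (C - 1))) [/eqP|]; first by rewrite (negPf (pi_exp_neq0 _)).
by rewrite ord_pi_exp; lia.
Qed.

(** J is generated by any element of least valuation. *)
Lemma fractional_ideal (J : set K) C x0 :
  (forall x y, J x -> P 0 y -> J (y * x)) -> J x0 -> x0 != 0 ->
  (forall x, J x -> P C x) -> exists b, forall x, J x <-> P b x.
Proof.
move=> JZ Jx0 x00 JC.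
pose D (k : nat) : Prop := exists2 x, J x & x != 0 /\ ord x = C + k%:Z.
have D0 x : J x -> x != 0 -> D `|ord x - C|%N.
  move=> Jx xn; exists x => //; split => //.
  by have [/eqP|] := JC x Jx; [rewrite (negPf xn) | lia].
have [k Dk kmin] : exists2 k, D k & forall j, D j -> (k <= j)%N.
  have exD : exists k, `[< D k >] by exists `|ord x0 - C|%N; apply/asboolP/D0.
  exists (ex_minn exD); first by case: ex_minnP => k /asboolP.
  by move=> j Dj; case: ex_minnP => k _; apply; exact/asboolP.
have [y Jy [y0 oy]] := Dk; exists (C + k%:Z) => x; split.
  case: (eqVneq x 0) => [->|xn]; first by left.
  move=> Jx; right; have := kmin _ (D0 x Jx xn).
  by have [/eqP|] := JC x Jx; [rewrite (negPf xn) | lia].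
move=> Px; rewrite -(divfK y0 x); apply: JZ => //.
by rewrite mulrC ord_ge_mull ?invr_eq0 // ord_inv // opprK oy add0r.
Qed.

Lemma residue_reps : exists rep : 'I_q -> K,
  (forall i, P 0 (rep i)) /\
  (forall x, P 0 x -> exists2 i, P 1 (x - rep i) & forall j, P 1 (x - rep j) -> j = i).
Proof.
have /card_set_bijP[g [gf gi gs]] : (`I_q #= residue_classes ord varpi)%card.
  by rewrite card_eq_sym; exact: card_residue hK.
have piOE x : piO ord varpi x <-> P 1 x.
  split; first by move=> [y Oy <-]; rewrite ord_ge_mull ?pi_neq0 // ord_pi subrr.
  move=> Px; exists (varpi^-1 * x); last by rewrite mulVKf ?pi_neq0.
  by rewrite /valring ord_ge_mull ?invr_eq0 ?pi_neq0 // ord_inv ?pi_neq0 // ord_pi.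
have ex (i : 'I_q) : exists x, P 0 x /\ g i = [set x + y | y in piO ord varpi].
  by have [x Ox <-] := gf _ (ltn_ord i); exists x.
have [rep repP] := choice ex; exists rep; split => [i|x Px].
  by have [] := repP i.
have cosetE y y' : P 1 (y - y') ->
    [set y + z | z in piO ord varpi] = [set y' + z | z in piO ord varpi].
  move=> yy'; apply/seteqP; split => _ [z /piOE Pz <-].
    exists (y - y' + z); last by ring.
    by apply/piOE; exact: ord_geD.
  exists (z - (y - y')); last by ring.
  by apply/piOE; exact: ord_geB.
have cosetP y y' : [set y + z | z in piO ord varpi] = [set y' + z | z in piO ord varpi] ->
    P 1 (y - y').
  move=> E; have : [set y + z | z in piO ord varpi] y.
    by exists 0; rewrite ?addr0 //; apply/piOE; left.
  by rewrite E => -[z /piOE Pz <-]; rewrite addrAC subrr add0r.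
have : residue_classes ord varpi [set x + z | z in piO ord varpi] by exists x.
move=> /gs [j jq gj]; exists (Ordinal jq).
  by apply: cosetP; rewrite -gj -[j]/(nat_of_ord (Ordinal jq)) (repP (Ordinal jq)).2.
move=> k /cosetE; rewrite -gj -(repP k).2 => gk; apply: val_inj => /=.
by apply: (gi _ _ (mem_set (ltn_ord k)) (mem_set jq)); rewrite gk.
Qed.

Lemma q_gt0 : (0 < q)%N.
Proof.
have [rep [_ /(_ 0 (or_introl erefl))[i _ _]]] := residue_reps.
exact: leq_ltn_trans (ltn_ord i).
Qed.

End Valuation.

(** * Self-dual modules *)

Section SelfDual.
Variables (K : fieldType) (ord : K -> int) (varpi : K) (q : nat).
Hypothesis hK : local_field ord varpi q.
Variables (V : vectType K) (form : {biscalar V}).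
Hypothesis halt : alternating_form form.
Local Notation P := (ord_ge ord).
Local Notation pi := varpi.

Lemma formDl x y z : form (x + y) z = form x z + form y z.
Proof. exact: linearDl. Qed.
Lemma formDr x y z : form z (x + y) = form z x + form z y.
Proof. exact: linearDr. Qed.
Lemma formBl x y z : form (x - y) z = form x z - form y z.
Proof. exact: linearBl. Qed.
Lemma formBr x y z : form z (x - y) = form z x - form z y.
Proof. exact: linearBr. Qed.
Lemma formZl c y z : form (c *: y) z = c * form y z.
Proof. exact: linearZl_LR. Qed.
Lemma formZr c y z : form z (c *: y) = c * form z y.
Proof. exact: linearZr_LR. Qed.
Lemma form0l z : form 0 z = 0. Proof. exact: linear0l. Qed.
Lemma form0r z : form z 0 = 0. Proof. exact: linear0r. Qed.

Lemma form_anti x y : form x y = - form y x.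
Proof.
have := halt (x + y); rewrite formDl !formDr !halt add0r addr0.
by move/eqP; rewrite addr_eq0 => /eqP.
Qed.

Definition formE := (formBl, formBr, formDl, formDr, formZl, formZr, form0l, form0r).

(** L is its own dual for the form divided by [varpi]^m, m being its level.  The
    second clause excludes subspaces such as Lagrangians, which are also
    their own duals; if the form is non-degenerate on U, the two clauses
    together force L to be a lattice of U. *)
Definition selfdual (U : {vspace V}) (m : int) (L : set V) : Prop :=
  (forall v, L v <-> v \in U /\ forall y, L y -> P m (form v y)) /\
  (forall v, v \in U -> exists C, forall y, L y -> P C (form y v)).

Section Basic.
Variables (U : {vspace V}) (m : int) (L : set V).
Hypothesis sL : selfdual U m L.

Lemma sd_sub v : L v -> v \in U. Proof. by move/(sL.1 v).1 => []. Qed.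

Lemma sd_form v y : L v -> L y -> P m (form v y).
Proof. by move/(sL.1 v).1 => [_]; apply. Qed.

Lemma sd_mem v : v \in U -> (forall y, L y -> P m (form v y)) -> L v.
Proof. by move=> *; apply/sL.1. Qed.

Lemma sd0 : L 0.
Proof. by apply: sd_mem; rewrite ?mem0v // => y _; rewrite form0l; left. Qed.

Lemma sdD x y : L x -> L y -> L (x + y).
Proof.
move=> Lx Ly; apply: sd_mem; first by rewrite memvD ?sd_sub.
by move=> z Lz; rewrite formDl; apply: (ord_geD hK); exact: sd_form.
Qed.

Lemma sdZ c x : P 0 c -> L x -> L (c *: x).
Proof.
move=> Oc Lx; apply: sd_mem; first by rewrite memvZ ?sd_sub.
by move=> z Lz; rewrite formZl -[m]add0r; apply: (ord_geM hK) => //; exact: sd_form.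
Qed.

Lemma sdN x : L x -> L (- x).
Proof.
by rewrite -scaleN1r; apply: sdZ; apply: (ord_geN hK); exact: (ord_ge1 hK).
Qed.

Lemma sdB x y : L x -> L y -> L (x - y).
Proof. by move=> Lx Ly; apply: sdD => //; exact: sdN. Qed.

End Basic.

(** Duality reverses inclusions. *)
Lemma sd_eq U m L M : selfdual U m L -> selfdual U m M -> (L `<=` M) -> L = M.
Proof.
move=> sL sM LM; apply/seteqP; split => // x Mx; apply: (sd_mem sL).
  exact: sd_sub sM _ Mx.
by move=> y /LM; exact: sd_form sM _ _ Mx.
Qed.

Lemma scale_setE (c : K) (L : set V) v : c != 0 -> scale_set c L v <-> L (c^-1 *: v).
Proof.
move=> c0; split; first by move=> [x Lx <-]; rewrite scalerA mulVf // scale1r.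
by move=> Lv; exists (c^-1 *: v) => //; rewrite scalerA mulfV // scale1r.
Qed.

Lemma sd_scale U m L c : selfdual U m L -> c != 0 ->
  selfdual U (m + 2 * ord c) (scale_set c L).
Proof.
move=> [sL bL] c0.
have key k x : P k (c^-1 * x) <-> P (k + ord c) x.
  by rewrite (ord_ge_mull hK) ?invr_eq0 // (ord_inv hK) // opprK.
have key2 k x : P k (c^-1 * (c^-1 * x)) <-> P (k + 2 * ord c) x.
  by rewrite !key; have -> : k + ord c + ord c = k + 2 * ord c by ring.
split=> [v|v vU].
  rewrite scale_setE // sL; split=> -[vU Lv]; split.
  - by rewrite -[v](scalerKV c0) memvZ.
  - by move=> y /(scale_setE _ _ c0) /Lv; rewrite formZl formZr => /key2.
  - by rewrite memvZ.
  - move=> y Ly; have := Lv (c *: y); rewrite formZr.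
    rewrite scale_setE // scalerA mulVf // scale1r => /(_ Ly)/key2.
    by rewrite mulKf // formZl.
have [C bC] := bL v vU; exists (C + ord c) => y /(scale_setE _ _ c0) /bC.
by rewrite formZl => /key.
Qed.

Lemma sd_scale_pi U m L : selfdual U m L -> selfdual U (m + 2) (scale_set pi L).
Proof.
by move=> /sd_scale/(_ (pi_neq0 hK)); rewrite (ord_pi hK).
Qed.

(** An inclusion between consecutive levels is sandwiched, with [varpi] L inside
    M, because <[varpi] v, M> lies in [varpi] <v, L>. *)
Lemma sd_nbr U m L M : selfdual U m L -> selfdual U (m + 1) M -> M `<=` L ->
  forall v, L v -> M (pi *: v).
Proof.
move=> sL sM ML v Lv; apply: (sd_mem sM); first by rewrite memvZ // (sd_sub sL).
move=> y /ML Ly; rewrite formZl (ord_ge_mull hK) ?(pi_neq0 hK) // (ord_pi hK) addrK.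
exact: sd_form sL _ _ Lv Ly.
Qed.

(** A hyperbolic pair (e, f) of U splits off a plane; U' is its orthogonal
    complement in U, a model of e^perp / K e. *)
Section Pair.
Variables (U : {vspace V}) (e f : V).
Hypothesis eU : e \in U.
Hypothesis fU : f \in U.
Hypothesis ef : form e f = 1.

Definition perp_pair : {vspace V} :=
  (U :&: lker (linfun (form e : V -> K^o)) :&: lker (linfun (form f : V -> K^o)))%VS.

Lemma mem_perp_pair v :
  v \in perp_pair <-> [/\ v \in U, form e v = 0 & form f v = 0].
Proof.
rewrite !memv_cap !memv_ker !lfunE /=; split.
  by move=> /andP[/andP[-> /eqP ->] /eqP ->].
by move=> [-> -> ->]; rewrite eqxx.
Qed.

Local Notation U' := perp_pair.

Lemma fe : form f e = -1. Proof. by rewrite form_anti ef. Qed.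

Lemma perp_decomp v : v \in U -> exists v' c d,
  [/\ v' \in U', v = c *: e + v' + d *: f, c = form v f & d = form e v].
Proof.
move=> vU; exists (v - form v f *: e - form e v *: f), (form v f), (form e v).
split => //; last by rewrite -addrA subrK addrC subrK.
apply/mem_perp_pair; split; first by rewrite !memvB ?memvZ.
  by rewrite !formE halt ef; ring.
by rewrite !formE halt fe (form_anti f v); ring.
Qed.


Lemma perp_decomp0 v : v \in U -> form e v = 0 ->
  exists2 v', v' \in U' & exists c, v = v' + c *: e.
Proof.
move=> vU ev; have [v' [c [d [v'U E _ dE]]]] := perp_decomp vU.
by exists v' => //; exists c; rewrite [LHS]E dE ev scale0r addr0 addrC.
Qed.

Lemma perp_sub v : v \in U' -> v \in U. Proof. by move/mem_perp_pair => []. Qed.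
Lemma perp_e v : v \in U' -> form e v = 0. Proof. by move/mem_perp_pair => []. Qed.
Lemma perp_el v : v \in U' -> form v e = 0.
Proof. by move=> /perp_e; rewrite form_anti => /eqP; rewrite oppr_eq0 => /eqP. Qed.
Lemma perp_f v : v \in U' -> form f v = 0. Proof. by move/mem_perp_pair => []. Qed.
Lemma perp_fl v : v \in U' -> form v f = 0.
Proof. by move=> /perp_f; rewrite form_anti => /eqP; rewrite oppr_eq0 => /eqP. Qed.

(** The image of L & e^perp in e^perp / K e. *)
Definition reduction (L : set V) : set V :=
  [set v | v \in U' /\ exists c, L (v + c *: e)].

(** The exponent of the fractional ideal L & K e.  For a self-dual L this ideal is
    determined, so the default value 0 is not reached. *)
Definition expo (L : set V) : int := xget 0 [set a | forall c, L (c *: e) <-> P a c].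

Section OneLattice.
Variables (m : int) (L : set V).
Hypothesis sL : selfdual U m L.

(** If <e, L> were 0, the line K e would lie in the dual of L, hence in L, against
    boundedness. *)
Let form_image : exists b, forall x, (exists2 y, L y & form e y = x) <-> P b x.
Proof.
have [C bC] := sL.2 e eU.
have [x0 [y0 Ly0 y0x] x00] : exists2 x0, (exists2 y, L y & form e y = x0) & x0 != 0.
  apply: contrapT => none.
  have Le c : L (c *: e).
    apply: (sd_mem sL); first by rewrite memvZ.
    move=> y Ly; rewrite formZl; case: (eqVneq (form e y) 0) => [->|ey].
      by rewrite mulr0; left.
    by case: none; exists (form e y) => //; exists y.
  have [D bD] := sL.2 f fU.
  apply: (@ord_ge_not_all _ _ _ _ hK D) => c.
  by have := bD _ (Le c); rewrite formZl ef mulr1.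
apply: (@fractional_ideal _ _ _ _ hK [set x | exists2 y, L y & form e y = x] C x0) => //.
- move=> x y [z Lz <-] Oy; exists (y *: z); first exact: (sdZ sL).
  by rewrite formZr.
- by exists y0.
move=> x [y Ly <-]; rewrite form_anti; apply: (ord_geN hK); exact: bC.
Qed.

(** The ideals L & K e and <e, L> are dual to each other up to [varpi]^m, hence
    have exponents of sum m. *)
Lemma expo_spec :
  (forall c, L (c *: e) <-> P (expo L) c) /\
  (forall x, (exists2 y, L y & form e y = x) <-> P (m - expo L) x).
Proof.
have [b bP] := form_image.
have LeP c : L (c *: e) <-> P (m - b) c.
  split=> [Lce|Pc].
    have /bP[y Ly yb] := ord_ge_pi hK b.
    have := sd_form sL Lce Ly; rewrite formZl yb mulrC.
    by move/(ord_ge_pi_mul hK).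
  apply: (sd_mem sL); first by rewrite memvZ.
  move=> y Ly; rewrite formZl -[m](subrK b); apply: (ord_geM hK) => //.
  by apply/bP; exists y.
have ex : exists a, forall c, L (c *: e) <-> P a c by exists (m - b).
have := xgetPex 0 ex; rewrite -/(expo L) => eP; split => // x.
have -> : expo L = m - b by apply: (ord_ge_inj hK) => c; rewrite -(eP c) LeP.
by rewrite bP; have -> : m - (m - b) = b by ring.
Qed.

Lemma expoP c : L (c *: e) <-> P (expo L) c.
Proof. exact: expo_spec.1. Qed.

Lemma expo_unique a : (forall c, L (c *: e) <-> P a c) -> expo L = a.
Proof. by move=> aP; apply: (ord_ge_inj hK) => c; rewrite -(aP c) expoP. Qed.

Lemma coexpoP x : (exists2 y, L y & form e y = x) <-> P (m - expo L) x.
Proof. exact: expo_spec.2. Qed.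

(** A pivot of L is a member y for which <e, y> generates the ideal <e, L>; then L is
    spanned by y and by L & e^perp. *)
Lemma pivot : exists2 y, L y & form e y = pi ^ (m - expo L).
Proof. by apply/coexpoP; exact: (ord_ge_pi hK). Qed.

(** Let v be in the dual of the reduction and choose the lift v + c e orthogonal to
    a pivot; it pairs correctly with the pivot and with L & e^perp, hence with
    L. *)
Lemma reduction_selfdual : selfdual U' m (reduction L).
Proof.
split=> [v|v vU']; last first.
  have [C bC] := sL.2 v (perp_sub vU'); exists C => y [yU [c /bC]].
  by rewrite formDl formZl (perp_e vU') mulr0 addr0.
split=> [[vU' [c Lv]]|[vU' vP]]; split => //.
  move=> y [yU' [d Ly]]; have := sd_form sL Lv Ly.
  by rewrite !formE halt (perp_e yU') (perp_el vU') !mulr0 !addr0.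
have [y0 Ly0 ey0] := pivot; set b := m - expo L in ey0.
pose c := - form v y0 / pi ^ b; exists c.
have vy0 : form (v + c *: e) y0 = 0.
  by rewrite formDl formZl ey0 divfK ?(pi_exp_neq0 hK) // subrr.
apply: (sd_mem sL); first by rewrite memvD ?memvZ // perp_sub.
move=> y Ly; pose t := form e y / pi ^ b.
have Ot : P 0 t.
  have : P b (form e y) by apply/coexpoP; exists y.
  by rewrite -[form e y](divfK (pi_exp_neq0 hK b)) mulrC (ord_ge_pi_mul hK) subrr.
pose y1 := y - t *: y0.
have Ly1 : L y1 by apply: (sdB sL) => //; exact: (sdZ sL).
have ey1 : form e y1 = 0.
  by rewrite formBr formZr ey0 divfK ?(pi_exp_neq0 hK) // subrr.
have [y' y'U [d yd]] := perp_decomp0 (sd_sub sL Ly1) ey1.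
have -> : form (v + c *: e) y = form v y'.
  rewrite -[y](subrK (t *: y0)) -/y1 formDr formZr vy0 mulr0 addr0.
  rewrite formDl formZl ey1 mulr0 addr0 yd formDr formZr.
  by rewrite (perp_el vU') mulr0 addr0.
by apply: vP; split => //; exists d; rewrite -yd.
Qed.

End OneLattice.

(** The self-dual module with reduction L' and pivot y: it is spanned by y and
    by those lifts of L' that pair with y as they should.  By [build_recover]
    every self-dual module is of this form, so pivots parametrize the fibres
    of the reduction. *)
Definition build (L' : set V) (m : int) (y : V) : set V :=
  [set x | exists t v c, [/\ P 0 t, L' v, P m (form (v + c *: e) y) &
     x = t *: y + (v + c *: e)]].

Section Build.
Variables (L' : set V) (m b : int) (y : V).
Hypothesis sL' : selfdual U' m L'.
Hypothesis yU : y \in U.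
Hypothesis ey : form e y = pi ^ b.

Let N := build L' m y.

Let pb0 : pi ^ b != 0 := pi_exp_neq0 hK b.

Lemma build_lift v : exists c, form (v + c *: e) y = 0.
Proof. by exists (- form v y / pi ^ b); rewrite formDl formZl ey divfK // subrr. Qed.

Lemma build_y : N y.
Proof.
exists 1, 0, 0; split; [exact: (ord_ge1 hK) | exact: (sd0 sL') | | ].
  by rewrite scale0r addr0 form0l; left.
by rewrite scale1r scale0r !addr0.
Qed.

Lemma build_low v c : L' v -> P m (form (v + c *: e) y) -> N (v + c *: e).
Proof.
by move=> L'v h; exists 0, v, c; split => //; [left | rewrite scale0r add0r].
Qed.

Lemma ord_ge_min k l x z : P k x -> P l z -> P (Num.min k l) (x + z).
Proof.
move=> kx lz; apply: (ord_geD hK); first by apply: ord_ge_le kx; rewrite ge_min lexx.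
by apply: ord_ge_le lz; rewrite ge_min lexx orbT.
Qed.

Lemma ord_ge_ord x : P (ord x) x. Proof. by right. Qed.

Lemma build_form v c v' c' : L' v -> L' v' ->
  form (v + c *: e) (v' + c' *: e) = form v v'.
Proof.
move=> /(sd_sub sL') vU /(sd_sub sL') v'U.
by rewrite !formE halt (perp_e v'U) (perp_el vU) !mulr0 !addr0.
Qed.

(** An element of the dual is brought into e^perp by subtracting a multiple of y;
    what is left is then tested against lifts of L' orthogonal to y. *)
Lemma build_selfdual : selfdual U m N.
Proof.
split=> [x|u uU]; last first.
  have [u' [c1 [d1 [u'U uE _ _]]]] := perp_decomp uU.
  have [y' [cy [dy [y'U yE _ _]]]] := perp_decomp yU.
  have [C1 bC1] := sL'.2 u' u'U; have [C2 bC2] := sL'.2 y' y'U.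
  exists (Num.min (ord (form y u)) (Num.min C1 (Num.min m C2 - b + ord (form e u)))).
  move=> _ [t [v [c [Ot L'v vy ->]]]].
  have vU := sd_sub sL' L'v.
  rewrite formDl formZl; apply: ord_ge_min.
    by rewrite -[ord _]add0r; apply: (ord_geM hK) => //; exact: ord_ge_ord.
  rewrite formDl; apply: ord_ge_min.
    by rewrite uE !formE (perp_el vU) (perp_fl vU) !mulr0 add0r addr0; exact: bC1.
  rewrite formZl; apply: (ord_geM hK); last exact: ord_ge_ord.
  apply/(ord_ge_pi_mul hK).
  have -> : pi ^ b * c = form (v + c *: e) y + - form v y'.
    rewrite formDl formZl ey {1}yE !formDr !formZr (perp_el vU) (perp_fl vU).
    by rewrite !mulr0 add0r addr0; ring.
  by apply: ord_ge_min => //; apply: (ord_geN hK); exact: bC2.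
split=> [[t [v [c [Ot L'v vy ->]]]]|[xU xP]].
  have vU := sd_sub sL' L'v; split.
    by rewrite !memvD ?memvZ // perp_sub.
  move=> _ [t' [v' [c' [Ot' L'v' vy' ->]]]].
  rewrite [form (_ + _) _]formDl ![form _ (_ + (_ + _))]formDr !formZl !formZr halt mulr0 mulr0 add0r.
  rewrite build_form // [form y _]form_anti.
  apply: (ord_geD hK); first by rewrite -[m]add0r; apply: (ord_geM hK) => //; exact: (ord_geN hK).
  apply: (ord_geD hK); first by rewrite -[m]add0r; apply: (ord_geM hK).
  exact: (sd_form sL').
pose t := form e x / pi ^ b.
have pe : N (pi ^ (m - b) *: e).
  rewrite -[_ *: e]add0r; apply: build_low; first exact: (sd0 sL').
  rewrite add0r formZl ey -expfzDr ?(pi_neq0 hK) // subrK; exact: (ord_ge_pi hK).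
have Ot : P 0 t.
  have := xP _ pe; rewrite formZr (ord_ge_pi_mul hK) form_anti => /(ord_geN hK).
  have -> : m - (m - b) = b by ring.
  rewrite opprK -{1}[form e x](divfK pb0) mulrC -/t (ord_ge_pi_mul hK).
  by rewrite subrr.
have x1U : x - t *: y \in U by rewrite memvB // memvZ.
have ex1 : form e (x - t *: y) = 0 by rewrite formBr formZr ey divfK // subrr.
have [v vU' [c vc]] := perp_decomp0 x1U ex1.
have xE : x = t *: y + (v + c *: e) by rewrite -vc addrC subrK.
have vy : P m (form (v + c *: e) y).
  by rewrite -vc formBl formZl halt mulr0 subr0; apply: xP; exact: build_y.
exists t, v, c; split => //; apply: (sd_mem sL') => // w L'w.
have [d wd] := build_lift w; have wU' := sd_sub sL' L'w.
have -> : form v w = form x (w + d *: e).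
  rewrite xE formDl formZl [form y _]form_anti wd oppr0 mulr0 add0r.
  by rewrite !formE halt (perp_e wU') (perp_el vU') !mulr0 !addr0.
by apply: xP; apply: build_low => //; rewrite wd; left.
Qed.

Lemma build_expo : expo N = m - b.
Proof.
apply: (expo_unique build_selfdual) => c; split; last first.
  move=> Pc; rewrite -[_ *: e]add0r; apply: build_low; first exact: (sd0 sL').
  by rewrite add0r formZl ey mulrC (ord_ge_pi_mul hK).
move=> Nc; have := sd_form build_selfdual Nc build_y.
by rewrite formZl ey mulrC (ord_ge_pi_mul hK).
Qed.

Lemma build_reduction : reduction N = L'.
Proof.
apply/esym; apply: (sd_eq sL' (reduction_selfdual build_selfdual)) => v L'v.
have [c vc] := build_lift v; split; first exact: sd_sub sL' _ L'v.
by exists c; apply: build_low => //; rewrite vc; left.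
Qed.

End Build.

(** By [sd_eq] an inclusion suffices. *)
Lemma build_recover m L y : selfdual U m L -> L y -> form e y = pi ^ (m - expo L) ->
  L = build (reduction L) m y.
Proof.
move=> sL Ly ey; have yU := sd_sub sL Ly.
have sR := reduction_selfdual sL.
apply: (sd_eq sL (build_selfdual sR yU ey)) => x Lx.
have Pex : P (m - expo L) (form e x) by apply/(coexpoP sL); exists x.
pose t := form e x / pi ^ (m - expo L).
have pb0 : pi ^ (m - expo L) != 0 := pi_exp_neq0 hK _.
have Ot : P 0 t.
  by move: Pex; rewrite -{1}[form e x](divfK pb0) mulrC -/t (ord_ge_pi_mul hK) subrr.
have Lx1 : L (x - t *: y) by apply: (sdB sL) => //; exact: (sdZ sL).
have ex1 : form e (x - t *: y) = 0 by rewrite formBr formZr ey divfK // subrr.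
have [v vU' [c vc]] := perp_decomp0 (sd_sub sL Lx1) ex1.
exists t, v, c; split => //; last by rewrite -vc addrC subrK.
  by split => //; exists c; rewrite -vc.
by rewrite -vc; exact: (sd_form sL).
Qed.

Section Neighbours.
Variables (m : int) (L : set V).
Hypothesis sL : selfdual U m L.

Lemma reduction_mono (A B : set V) : A `<=` B -> reduction A `<=` reduction B.
Proof. by move=> AB v [vU' [c Ac]]; split => //; exists c; exact: AB. Qed.

Lemma expo_nbr M : selfdual U (m + 1) M -> M `<=` L ->
  expo M = expo L \/ expo M = expo L + 1.
Proof.
move=> sM ML.
have h1 : expo L <= expo M.
  by apply: (ord_ge_mono hK) => c /(expoP sM) /ML /(expoP sL).
have h2 : expo M <= expo L + 1.
  apply: (ord_ge_mono hK) => c Pc; apply/(expoP sM).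
  have : L ((pi^-1 * c) *: e).
    apply/(expoP sL); have := pi_neq0 hK => p0.
    by rewrite (ord_ge_mull hK) ?invr_eq0 // (ord_inv hK) // (ord_pi hK) opprK.
  move/(sd_nbr sL sM ML); rewrite scalerA mulrA divff ?mul1r //; exact: (pi_neq0 hK).
by move: h1 h2; case: (ltgtP (expo M) (expo L)) => //; lia.
Qed.

Lemma expo_scale_pi : expo (scale_set pi L) = expo L + 1.
Proof.
apply: (expo_unique (sd_scale_pi sL)) => c; have p0 := pi_neq0 hK.
rewrite scale_setE // scalerA (expoP sL) (ord_ge_mull hK) ?invr_eq0 //.
by rewrite (ord_inv hK) // (ord_pi hK) opprK.
Qed.

Lemma reduction_scale_pi : reduction (scale_set pi L) = scale_set pi (reduction L).
Proof.
have p0 := pi_neq0 hK.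
apply/seteqP; split=> [v [vU' [c]]|v].
  rewrite scale_setE // => Lc; apply/scale_setE => //; split; first by rewrite memvZ.
  by exists (pi^-1 * c); rewrite -scalerA -scalerDr.
rewrite scale_setE // => -[vU' [c Lc]]; split; first by rewrite -[v](scalerKV p0) memvZ.
by exists (pi * c); apply/scale_setE => //; rewrite scalerDr scalerA mulKf.
Qed.

Variable M' : set V.
Hypothesis sM' : selfdual U' (m + 1) M'.
Hypothesis ML' : M' `<=` reduction L.

(** Every lift that is allowed for z in level m + 1 is allowed for y in level m, so
    it lies in L. *)
Lemma build_sub y : L y -> form e y = pi ^ (m - expo L) ->
  forall z (k : K), P 0 k -> z = k *: y -> (forall v c, P (m + 1) (form (v + c *: e) z) ->
    P m (form (v + c *: e) y)) ->
  build M' (m + 1) z `<=` L.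
Proof.
move=> Ly ey z k Ok -> imp _ [t [v [c [Ot M'v vz ->]]]].
apply: (sdD sL); first by rewrite scalerA; apply: (sdZ sL) => //; rewrite -[0]addr0; exact: (ord_geM hK).
rewrite [L](build_recover sL Ly ey); apply: build_low; [exact: ML' | exact: imp].
Qed.

(** Let y be a pivot of L.  Since [varpi] L lies in any such N, and since the
    exponent of <e, N> is one more than that of <e, L>, the vector [varpi] y is
    a pivot of N, which is thereby determined. *)
Lemma fibre_same : exists M, forall N,
  (selfdual U (m + 1) N /\ N `<=` L /\ reduction N = M' /\ expo N = expo L) <-> N = M.
Proof.
have [y Ly ey] := pivot sL; have yU := sd_sub sL Ly.
have p0 := pi_neq0 hK.
have epy : form e (pi *: y) = pi ^ (m - expo L + 1).
  by rewrite formZr ey [RHS]expfzDr // expr1z mulrC.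
have pyU : pi *: y \in U by rewrite memvZ.
exists (build M' (m + 1) (pi *: y)) => N; split=> [[sN [NL [<- eN]]]|->].
  apply: build_recover => //; first exact: (sd_nbr sL sN NL).
  by rewrite epy eN; congr (_ ^ _); ring.
split; first exact: (build_selfdual sM' pyU epy).
split.
  apply: (@build_sub y Ly ey (pi *: y) pi) => //.
    by right; rewrite (ord_pi hK).
  move=> v c; rewrite formZr (ord_ge_mull hK) // (ord_pi hK) addrK //.
split; first exact: (build_reduction sM' pyU epy).
by rewrite (build_expo sM' pyU epy); ring.
Qed.

(** Here <e, N> and <e, L> have the same exponent, so pivots of L may serve as
    pivots of N. *)
Lemma fibre_next_build y : L y -> form e y = pi ^ (m - expo L) ->
  let N := build M' (m + 1) y in
  selfdual U (m + 1) N /\ N `<=` L /\ reduction N = M' /\ expo N = expo L + 1.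
Proof.
move=> Ly ey N; have yU := sd_sub sL Ly.
split; first exact: (build_selfdual sM' yU ey).
split.
  apply: (build_sub Ly ey (ord_ge1 hK)); first by rewrite scale1r.
  by move=> v c; apply: ord_ge_le; lia.
split; first exact: (build_reduction sM' yU ey).
by rewrite (build_expo sM' yU ey); ring.
Qed.

Lemma fibre_next_recover N : selfdual U (m + 1) N -> N `<=` L ->
  reduction N = M' -> expo N = expo L + 1 ->
  forall y, N y -> form e y = pi ^ (m - expo L) -> N = build M' (m + 1) y.
Proof.
move=> sN NL <- eN y Ny ey; apply: build_recover => //; rewrite ey eN.
by congr (_ ^ _); ring.
Qed.

End Neighbours.

End Pair.
End SelfDual.

(** * Indices and counts *)

Section Counting.

(** A system of representatives of A modulo B; for subgroups this is the
    index. *)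
Definition has_index (T : zmodType) (N : nat) (A B : set T) : Prop :=
  exists g : 'I_N -> T, (forall i, A (g i)) /\
    forall v, A v -> exists2 i, B (v - g i) & forall j, B (v - g j) -> j = i.

Lemma has_index_fin (T : zmodType) (I : finType) (A B : set T) (g : I -> T) :
  (forall i, A (g i)) ->
  (forall v, A v -> exists2 i, B (v - g i) & forall j, B (v - g j) -> j = i) ->
  has_index #|I| A B.
Proof.
move=> gA gB; exists (g \o enum_val); split => [i|v /gB [i Bi iu]]; first exact: gA.
exists (enum_rank i) => /=; first by rewrite enum_rankK.
by move=> j /iu <-; rewrite enum_valK.
Qed.

Lemma has_index1 (T : zmodType) (A B : set T) :
  A 0 -> A `<=` B -> has_index 1 A B.
Proof.
move=> A0 AB; exists (fun=> 0); split => // v Av; exists ord0.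
  by rewrite subr0; exact: AB.
by move=> j _; rewrite ord1.
Qed.

(** Stated with A1 + B in the place of a group between B and A, so that it applies
    to a filtration of A whose steps need not contain B. *)
Lemma has_index_trans (T : zmodType) N1 N2 (A A1 B : set T) :
  (forall x y, B x -> B y -> B (x - y)) ->
  (forall x y, A x -> A1 y -> A (x + y)) ->
  has_index N1 A1 B -> has_index N2 A [set x + y | x in A1 & y in B] ->
  has_index (N1 * N2) A B.
Proof.
move=> BB AA [g1 [g1A g1B]] [g2 [g2A g2B]].
rewrite -[N1]card_ord -[N2]card_ord -card_prod.
apply: (@has_index_fin _ _ _ _ (fun p : 'I_N1 * 'I_N2 => g2 p.2 + g1 p.1)).
  by move=> [i j]; exact: AA.
have B0 : forall x, B x -> B 0 by move=> x Bx; rewrite -(subrr x); exact: BB.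
move=> v Av; have [j [a A1a [b Bb ab]] ju] := g2B v Av.
have [i Bi iu] := g1B a A1a.
exists (i, j) => /=.
  rewrite opprD addrA -ab addrAC -[b]opprK; apply: (BB) => //.
  by rewrite -sub0r; apply: (BB) => //; exact: B0 Bb.
move=> [k l] /= h.
have lj : l = j.
  apply: ju; exists (g1 k); first exact: g1A.
  by exists (v - (g2 l + g1 k)) => //; rewrite addrCA opprD [g1 k + _]addrCA subrr addr0.
rewrite lj in h *; congr pair; apply: iu.
have -> : a - g1 k = v - (g2 j + g1 k) - b by rewrite opprD addrA -ab addrAC addrK.
exact: (BB).
Qed.

Lemma has_index_transfer (T T' : zmodType) (phi : T -> T') N
    (A B : set T) (A' B' : set T') :
  (forall v, A v -> A' (phi v)) -> (forall x, A' x -> exists2 v, A v & phi v = x) ->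
  (forall v w, A v -> A w -> B (v - w) <-> B' (phi v - phi w)) ->
  has_index N A' B' -> has_index N A B.
Proof.
move=> AA' surj BB' [g [gA gB]].
have /choice[l lP] : forall i, exists v, A v /\ phi v = g i.
  by move=> i; have [v Av vE] := surj _ (gA i); exists v.
exists l; split => [i|v Av]; first by have [] := lP i.
have [i Bi iu] := gB _ (AA' _ Av); exists i.
  by have [Al El] := lP i; apply/BB' => //; rewrite El.
by move=> j; have [Al El] := lP j => /(BB' _ _ Av Al); rewrite El => /iu.
Qed.

Definition counts (T : Type) (N : nat) (A : set T) : Prop :=
  exists g : 'I_N -> T, injective g /\ forall x, A x <-> exists i, g i = x.

Lemma counts_fin (T : Type) (I : finType) (A : set T) (g : I -> T) :
  injective g -> (forall x, A x <-> exists i, g i = x) -> counts #|I| A.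
Proof.
move=> gi gA; exists (g \o enum_val); split; first exact: inj_comp gi enum_val_inj.
move=> x; rewrite gA; split=> [[i <-]|[i <-]]; last by exists (enum_val i).
by exists (enum_rank i) => /=; rewrite enum_rankK.
Qed.

Lemma counts1 (T : Type) (x : T) (A : set T) : (forall y, A y <-> y = x) -> counts 1 A.
Proof.
move=> Ax; exists (fun=> x); split; first by move=> i j _; rewrite !ord1.
by move=> y; rewrite Ax; split=> [->|[]//]; exists ord0.
Qed.

Lemma counts_ext (T : Type) N (A B : set T) :
  (forall x, A x <-> B x) -> counts N A -> counts N B.
Proof. by move=> AB [g [gi gA]]; exists g; split => // x; rewrite -AB. Qed.

Lemma counts_fibre (T T' : Type) N N' (A : set T) (A' : set T') (phi : T -> T') :
  (forall x, A x -> A' (phi x)) -> counts N' A' ->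
  (forall x', A' x' -> counts N [set x | A x /\ phi x = x']) ->
  counts (N' * N) A.
Proof.
move=> AA' [g' [gi' gA']] fib.
have /choice[l lP] : forall i, exists g : 'I_N -> T, injective g /\
    forall x, (A x /\ phi x = g' i) <-> exists j, g j = x.
  by move=> i; apply: fib; apply/gA'; exists i.
have lA i j : A (l i j) /\ phi (l i j) = g' i by apply/(lP i).2; exists j.
rewrite -[N']card_ord -[N]card_ord -card_prod.
apply: (@counts_fin _ _ _ (fun p : 'I_N' * 'I_N => l p.1 p.2)).
  move=> [i j] [i' j'] /= E.
  have ii : i = i' by apply: gi'; rewrite -(lA i j).2 E (lA i' j').2.
  by move: E; rewrite -ii => /(lP i).1 ->.
move=> x; split=> [Ax|[[i j] /= <-]]; last exact: (lA i j).1.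
have [i gi] := (gA' _).1 (AA' _ Ax).
have [|j lj] := ((lP i).2 x).1; first by split.
by exists (i, j).
Qed.

Lemma counts_card (T : Type) N (A : set T) : counts N A -> (A #= `I_N)%card.
Proof.
move=> [g [gi gA]].
have -> : A = g @` [set: 'I_N].
  by apply/seteqP; split => x; rewrite gA => -[j]; [exists j | move=> _ <-; exists j].
apply: card_eq_trans (inj_card_eq _) _; first by move=> x y _ _; exact: gi.
by rewrite card_eq_sym; exact: card_II.
Qed.

Lemma has_index_chain (T : zmodType) N1 N2 (A A1 B : set T) :
  (forall x y, B x -> B y -> B (x - y)) -> (forall x y, A1 x -> A1 y -> A1 (x + y)) ->
  (forall x y, A x -> A1 y -> A (x + y)) -> B 0 -> B `<=` A1 ->
  has_index N1 A1 B -> has_index N2 A A1 -> has_index (N1 * N2) A B.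
Proof.
move=> BB A1D AD B0 BA1 i1 i2; apply: (has_index_trans BB AD i1).
have -> // : [set x + y | x in A1 & y in B] = A1.
apply/seteqP; split => [_ [x A1x [y By <-]]|x A1x].
  by apply: A1D => //; exact: BA1.
by exists x => //; exists 0 => //; rewrite addr0.
Qed.

End Counting.

(** * Fibres of the reduction *)

Section FibreCounts.
Variables (K : fieldType) (ord : K -> int) (varpi : K) (q : nat).
Hypothesis hK : local_field ord varpi q.
Variables (V : vectType K) (form : {biscalar V}).
Hypothesis halt : alternating_form form.
Local Notation P := (ord_ge ord).
Local Notation pi := varpi.
Local Notation selfdual := (selfdual ord form).

Lemma index_ideal (b : int) : has_index q (P b : set K) (P (b + 1)).
Proof.
have [rep [repO repU]] := residue_reps hK.
have pb0 := pi_exp_neq0 hK b.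
have shiftP x k : P (b + k) (pi ^ b * x) <-> P k x.
  by rewrite (ord_ge_pi_mul hK) addrAC subrr add0r.
exists (fun i => pi ^ b * rep i); split=> [i|x Px].
  by have := (shiftP (rep i) 0).2; rewrite addr0; apply; exact: repO.
have : P 0 ((pi ^ b)^-1 * x).
  by apply/shiftP; rewrite mulrA divff // mul1r addr0.
move=> /repU[i Pi iu].
have xE y : x - pi ^ b * y = pi ^ b * ((pi ^ b)^-1 * x - y).
  by rewrite mulrBr mulrA divff // mul1r.
exists i; first by rewrite xE; apply/shiftP.
by move=> j; rewrite xE => /shiftP /iu.
Qed.

Section Pair.
Variables (U : {vspace V}) (e f : V).
Hypothesis eU : e \in U.
Hypothesis fU : f \in U.
Hypothesis ef : form e f = 1.

Local Notation U' := (perp_pair form U e f).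
Local Notation R := (reduction form U e f).
Local Notation expo := (expo ord e).

Section Neighbour.
Variables (m : int) (L : set V).
Hypothesis sL : selfdual U m L.

(** Filter L by L & K e and L & e^perp.  The middle layer contributes the index of
    the reductions.  Of the two outer layers exactly one contributes q and
    the other is trivial, because the exponents of L & K e and <e, L> have sum
    m while those of M have sum m + 1. *)
Lemma index_nbr M N : selfdual U (m + 1) M -> M `<=` L ->
  has_index N (R L) (R M) -> has_index (q * N) L M.
Proof.
move=> sM ML iN.
have MB x y : M x -> M y -> M (x - y) by exact: (sdB hK sM).
pose L0 := [set v | L v /\ form e v = 0].
pose Le := [set v | L v /\ exists c, v = c *: e].
have ee : form e e = 0 := halt e.
have LeE v : Le v -> exists2 c, v = c *: e & P (expo L) c.
  by move=> [Lv [c vE]]; exists c => //; apply/(expoP hK halt eU fU ef sL); rewrite -vE.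
have e_inj (c d : K) : c *: e = d *: e -> c = d.
  by move/(congr1 (form^~ f)); rewrite !formZl ef !mulr1.
have ia : has_index (if expo M == expo L then 1 else q)%N Le M.
  apply: (has_index_transfer (phi := form^~ f) (A' := P (expo L)) (B' := P (expo M))).
  - by move=> v /LeE[c -> Pc]; rewrite formZl ef mulr1.
  - move=> x Px; exists (x *: e); last by rewrite formZl ef mulr1.
    by split; [apply/(expoP hK halt eU fU ef sL) | exists x].
  - move=> _ _ /LeE[c -> Pc] /LeE[d -> Pd].
    by rewrite !formZl ef !mulr1 -scalerBl (expoP hK halt eU fU ef sM).
  case: (expo_nbr hK halt eU fU ef sL sM ML) => ->.
    by rewrite eqxx; apply: has_index1 => //; left.
  by rewrite ifF; [exact: index_ideal | apply/eqP; lia].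
have i0 : has_index N L0 [set x + y | x in Le & y in M].
  apply: (has_index_transfer (phi := fun v => v - form v f *: e) (A' := R L) (B' := R M)) => //.
  - move=> v [Lv ev]; split; last by exists (form v f); rewrite subrK.
    apply/mem_perp_pair; rewrite memvB ?memvZ //; last exact: sd_sub sL _ _.
    split => //; first by rewrite formBr ev formZr ee mulr0 subr0.
    by rewrite formBr formZr (fe halt ef) (form_anti halt f v); ring.
  - move=> v [vU' [c Lv]]; exists (v + c *: e).
      by split => //; rewrite formDr formZr ee (perp_e vU') mulr0 addr0.
    by rewrite formDl formZl ef (perp_fl halt vU') add0r mulr1 addrK.
  - move=> v w [Lv ev] [Lw ew].
    have -> : v - form v f *: e - (w - form w f *: e) = (v - w) - form (v - w) f *: e.
      by rewrite formBl scalerBl !opprB (AC (2*2) ((1*4)*(3*2)))%AC.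
    have Lu : L (v - w) by exact: (sdB hK sL).
    have eu : form e (v - w) = 0 by rewrite formBr ev ew subrr.
    move: (v - w) Lu eu => u Lu eu; split.
      move=> [_ /LeE[c -> Pc] [y My yu]]; split.
        apply/mem_perp_pair; rewrite memvB ?memvZ //; last exact: sd_sub sL _ _.
        split => //; first by rewrite formBr formZr eu ee mulr0 subr0.
        by rewrite formBr formZr (fe halt ef) (form_anti halt f u); ring.
      exists (form y f); rewrite -yu formDl formZl ef mulr1 scalerDl opprD addrA.
      by rewrite subrK addrAC subrr add0r.
    move=> [_ [d Md]]; exists ((form u f - d) *: e).
      split; last by exists (form u f - d).
      have -> : (form u f - d) *: e = u - (u - form u f *: e + d *: e).
        by rewrite scalerBl !opprD opprK addrA addrA subrr add0r.
      by apply: (sdB hK sL) => //; exact: ML.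
    exists (u - form u f *: e + d *: e) => //.
    by rewrite scalerBl (AC (2*(2*1)) ((3*(1*4))*(2*5)))%AC /= subrr addr0 addNr addr0.
have i1 : has_index (if expo M == expo L then q else 1)%N L [set x + y | x in L0 & y in M].
  apply: (has_index_transfer (phi := form e) (A' := P (m - expo L)) (B' := P (m + 1 - expo M))).
  - by move=> v Lv; apply/(coexpoP hK halt eU fU ef sL); exists v.
  - by move=> x /(coexpoP hK halt eU fU ef sL).
  - move=> v w Lv Lw; rewrite -formBr; have Lu : L (v - w) by exact: (sdB hK sL).
    move: (v - w) Lu => u Lu; split.
      move=> [x [Lx ex] [y My <-]]; rewrite formDr ex add0r.
      by apply/(coexpoP hK halt eU fU ef sM); exists y.
    move=> /(coexpoP hK halt eU fU ef sM)[y My ey]; exists (u - y).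
      by split; [apply: (sdB hK sL) => //; exact: ML | rewrite formBr ey subrr].
    by exists y => //; rewrite subrK.
  case: (expo_nbr hK halt eU fU ef sL sM ML) => ->.
    by rewrite eqxx addrAC; exact: index_ideal.
  rewrite ifF; last by apply/eqP; lia.
  by apply: has_index1; [left | move=> x; apply: ord_ge_le; lia].
have AA0 x y : L0 x -> Le y -> L0 (x + y).
  move=> [Lx ex] [Ly [c yE]]; split; first exact: (sdD hK sL).
  by rewrite formDr ex yE formZr ee mulr0 addr0.
have AA1 x y : L x -> L0 y -> L (x + y) by move=> Lx [Ly _]; exact: (sdD hK sL).
have -> : (q * N = (if expo M == expo L then 1 else q) * N * (if expo M == expo L then q else 1))%N.
  by case: ifP => _; rewrite ?mul1n ?muln1 mulnC.
exact: has_index_trans MB AA1 (has_index_trans MB AA0 ia i0) i1.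
Qed.

Section Fibres.
Variable M' : set V.
Hypothesis sM' : selfdual U' (m + 1) M'.
Hypothesis ML' : M' `<=` R L.

Lemma count_fibre_same : counts 1
  [set N | selfdual U (m + 1) N /\ N `<=` L /\ R N = M' /\ expo N = expo L].
Proof.
by have [M MP] := fibre_same hK halt eU fU ef sL sM' ML'; exact: counts1 MP.
Qed.

(** By [build_recover] such an N is determined by any of its pivots, and these are
    pivots of L.  Fix a pivot y0 of L.  Modulo N, a pivot is pinned down by
    the class modulo M' of the component of y - y0 in the reduction of L and,
    once this component is normalized, by the component along e modulo
    [varpi]^(a + 1).  The two normalizations come in this order because
    the unipotent group at work is a Heisenberg group, whose centre moves the
    component along e. *)
Lemma count_fibre_next k : has_index k (R L) M' -> counts (q * k)
  [set N | selfdual U (m + 1) N /\ N `<=` L /\ R N = M' /\ expo N = expo L + 1].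
Proof.
move=> [t [tR tU]]; have [rep [repO repU]] := residue_reps hK.
have [y0 Ly0 ey0] := pivot hK halt eU fU ef sL.
have ee : form e e = 0 := halt e.
have LeP := expoP hK halt eU fU ef sL.
set a := expo L in ey0 LeP *.
have /choice[d dP] : forall j, exists c, L (t j + c *: e) by move=> j; have [_] := tR j.
have tU' j : t j \in U' by have [] := tR j.
pose y (p : 'I_q * 'I_k) := y0 + (t p.2 + (d p.2 + rep p.1 * pi ^ a) *: e).
have Ly p : L (y p).
  apply: (sdD hK sL) => //; rewrite scalerDl addrA; apply: (sdD hK sL) => //.
  by apply/LeP; have := ord_geM hK (repO p.1) (ord_ge_pi hK a); rewrite add0r.
have ey p : form e (y p) = pi ^ (m - a).
  by rewrite /y !formDr formZr ee mulr0 addr0 (perp_e (tU' _)) addr0.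
have nextP p := fibre_next_build hK halt eU fU ef sL sM' ML' (Ly p) (ey p).
rewrite -[q]card_ord -[k]card_ord -card_prod.
apply: (@counts_fin _ _ _ (fun p => build ord form e M' (m + 1) (y p))).
  move=> [i j] [i' j'] E.
  set N := build _ _ _ _ _ _ in E.
  have [sN [NL [RN eN]]] := nextP (i, j).
  have N1 : N (y (i, j)) by apply: (build_y hK); exact: sM'.
  have N2 : N (y (i', j')) by rewrite E; apply: (build_y hK); exact: sM'.
  have N12 := sdB hK sN N1 N2.
  have dif : y (i, j) - y (i', j') =
      (t j - t j') + (d j + rep i * pi ^ a - (d j' + rep i' * pi ^ a)) *: e.
    by rewrite /y /= scalerBl opprD addrACA subrr add0r opprD addrACA.
  have jj : j = j'.
    have [j1 _ ju] := tU _ (tR j).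
    have j1E : j = j1 by apply: ju; rewrite subrr; exact: (sd0 sM').
    rewrite [LHS]j1E; apply/esym/ju; rewrite -RN; split; first by rewrite memvB.
    by exists (d j + rep i * pi ^ a - (d j' + rep i' * pi ^ a)); rewrite -dif.
  rewrite -jj in dif N12 *; congr pair.
  rewrite dif subrr add0r in N12.
  have : P (a + 1) (pi ^ a * (rep i - rep i')).
    have := (expoP hK halt eU fU ef sN _).1 N12; rewrite eN.
    by congr P; ring.
  rewrite (ord_ge_pi_mul hK) addrAC subrr add0r => Pii.
  have [i1 _ iu] := repU _ (repO i).
  have i1E : i = i1 by apply: iu; rewrite subrr; left.
  by rewrite [LHS]i1E; apply/esym/iu.
move=> N; split=> [[sN [NL [RN eN]]]|[p <-]]; last exact: nextP.
have [yN NyN eyN] := pivot hK halt eU fU ef sN.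
have eyN' : form e yN = pi ^ (m - a) by rewrite eyN eN; congr (_ ^ _); ring.
have Lv : L (yN - y0) by apply: (sdB hK sL) => //; exact: NL.
have ev : form e (yN - y0) = 0 by rewrite formBr eyN' ey0 subrr.
have [v' v'U [c vE]] := perp_decomp0 halt eU fU ef (sd_sub sL Lv) ev.
have [j Mj _] : exists2 j, M' (v' - t j) & forall j', M' (v' - t j') -> j' = j.
  by apply: tU; split => //; exists c; rewrite -vE.
have [_ [d' Nmu]] : R N (v' - t j) by rewrite RN.
have Lz : L ((c - d' - d j) *: e).
  have -> : (c - d' - d j) *: e = (yN - y0) - (v' - t j + d' *: e) - (t j + d j *: e).
    rewrite vE !scalerBl !opprD !opprK.
    by rewrite [RHS](AC (2*3*2) ((1*3)*(4*6)*(2*5*7)))%AC /= !subrr !add0r.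
  by apply: (sdB hK sL) => //; apply: (sdB hK sL) => //; exact: NL.
have Pz := (LeP _).1 Lz.
have [i Pi _] : exists2 i, P 1 ((pi ^ a)^-1 * (c - d' - d j) - rep i) &
    forall i', P 1 ((pi ^ a)^-1 * (c - d' - d j) - rep i') -> i' = i.
  apply: repU; have -> : 0 = a + - a by ring.
  have := ord_geM hK Pz (_ : P (- a) (pi ^ a)^-1); rewrite mulrC; apply.
  by right; rewrite (ord_inv hK) ?(pi_exp_neq0 hK) // (ord_pi_exp hK).
exists (i, j); apply/esym.
apply: (fibre_next_recover hK halt eU fU ef sN NL RN eN); last exact: ey.
have -> : y (i, j) = yN - (v' - t j + d' *: e) - (c - d' - d j - rep i * pi ^ a) *: e.
  rewrite -[yN](subrK y0) vE /y /= !scalerBl scalerDl !opprD !opprK.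
  by rewrite [RHS](AC (3*3*4) ((1*4)*(2*7)*(6*8)*(3*(5*(9*10)))))%AC /= !subrr addNr !add0r.
apply: (sdB hK sN); first exact: (sdB hK sN).
apply/(expoP hK halt eU fU ef sN); rewrite eN.
have pa0 := pi_exp_neq0 hK a.
have -> : c - d' - d j - rep i * pi ^ a = pi ^ a * ((pi ^ a)^-1 * (c - d' - d j) - rep i).
  by rewrite mulrBr mulVKf // [pi ^ a * rep i]mulrC.
by rewrite (ord_ge_pi_mul hK) addrAC subrr add0r.
Qed.

End Fibres.
End Neighbour.
End Pair.
End FibreCounts.

(** * Horocyclic types by induction on the dimension *)

Section Horocyclic.
Variables (K : fieldType) (ord : K -> int) (varpi : K) (q : nat).
Hypothesis hK : local_field ord varpi q.
Variables (V : vectType K) (form : {biscalar V}).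
Hypothesis halt : alternating_form form.
Local Notation P := (ord_ge ord).
Local Notation pi := varpi.
Local Notation selfdual := (selfdual ord form).

Definition submodule (B : set V) : Prop :=
  [/\ B 0, forall x y, B x -> B y -> B (x + y) &
      forall c x, P 0 c -> B x -> B (c *: x)].

Definition in_window (n w : nat) (a : nat -> int) : Prop :=
  forall i, (i < n)%N -> 0 <= a i <= w%:Z.

(** [window_closed] says that edges between types of the box do not leave G;
    [window_bounded] puts all members of G inside one bounded module, from which
    finiteness will follow. *)
Record window (U : {vspace V}) (n : nat) (a : set V -> nat -> int) (w : nat)
    (G : bool -> set (set V)) : Prop := Window {
  window_type : forall b L, G b L -> selfdual U b%:Z L /\ in_window n w (a L);
  window_base : exists2 L, G false L & forall i, (i < n)%N -> a L i = 0;
  window_closed : forall L M, selfdual U 0 L -> selfdual U 1 M -> M `<=` L ->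
    in_window n w (a L) -> in_window n w (a M) -> G false L <-> G true M;
  window_bounded : exists B c, [/\ submodule B, forall x, B x -> x \in U,
    forall x y, B x -> B y -> P c (form x y) & forall b L, G b L -> L `<=` B]
}.

(** The properties of the type that the induction carries along: [horo_index]
    feeds the count of the next dimension, and the last coordinate has the
    largest weight. *)
Record horocyclic (U : {vspace V}) (n : nat) (a : set V -> nat -> int) : Prop := Horocyclic {
  horo_shift : forall m L M, selfdual U m L -> selfdual U (m + 1) M -> M `<=` L ->
    forall i, (i < n)%N -> a M i = a L i \/ a M i = a L i + 1;
  horo_count : forall m L (eps : nat -> bool), selfdual U m L ->
    counts (q ^ \sum_(i < n) eps i * i.+1)
      [set M | [/\ selfdual U (m + 1) M, M `<=` L &
                   forall i, (i < n)%N -> a M i = a L i + (eps i)%:Z]];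
  horo_scale : forall m L, selfdual U m L ->
    forall i, (i < n)%N -> a (scale_set pi L) i = a L i + 1;
  horo_index : forall m L M, selfdual U m L -> selfdual U (m + 1) M -> M `<=` L ->
    has_index (q ^ n) L M;
  horo_window : forall w, exists G, window U n a w G
}.

Definition nondegenerate_on (U : {vspace V}) : Prop :=
  forall x, x \in U -> (forall y, y \in U -> form x y = 0) -> x = 0.

Section Base.
Variable U : {vspace V}.
Hypothesis U0 : forall x, x \in U -> x = 0.

Lemma selfdual_trivial m L : selfdual U m L <-> L = [set 0].
Proof.
split=> [sL|->].
  apply/seteqP; split => [x Lx|_ ->]; last exact: sd0 sL.
  exact: (U0 (sd_sub sL Lx)).
split=> [v|v vU]; last by exists 0 => y _; rewrite (U0 vU) form0r; left.
split=> [->|[/U0 -> _] //]; split; first exact: mem0v.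
by move=> y _; rewrite form0l; left.
Qed.

Lemma horocyclic_trivial : horocyclic U 0 (fun _ _ => 0).
Proof.
split => //.
- move=> m L eps sL; rewrite big_ord0 expn0; apply: (@counts1 _ [set 0]) => M.
  split=> [[sM _ _]|->]; first by move/selfdual_trivial: sM.
  split => //; first exact/selfdual_trivial.
  by move=> _ ->; exact: sd0 sL.
- move=> m L M sL sM ML; rewrite expn0; apply: has_index1; first exact: sd0 sL.
  by move=> x /(sd_sub sL)/U0 ->; exact: sd0 sM.
move=> w; exists (fun _ L => L = [set 0]); split.
- by move=> b L L0; split => //; apply/selfdual_trivial.
- by exists [set 0].
- by move=> L M /selfdual_trivial -> /selfdual_trivial ->.
exists [set 0], 0; split => //.
- split => //; first by move=> x y -> ->; rewrite addr0.
  by move=> c x _ ->; rewrite scaler0.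
- by move=> x ->; exact: mem0v.
- by move=> x y -> _; rewrite form0l; left.
- by move=> b L ->.
Qed.
End Base.

Section Step.
Variables (U : {vspace V}) (e f : V).
Hypothesis eU : e \in U.
Hypothesis fU : f \in U.
Hypothesis ef : form e f = 1.
Local Notation U' := (perp_pair form U e f).
Local Notation R := (reduction form U e f).
Local Notation expo := (expo ord e).

Variables (n : nat) (a' : set V -> nat -> int).
Hypothesis horo' : horocyclic U' n a'.

(** The new coordinate comes last, so that the weight of coordinate i is i + 1 in
    every dimension. *)
Definition extend_type (L : set V) (i : nat) : int :=
  if i == n then expo L else a' (R L) i.
Local Notation a := extend_type.

Let a_last L : a L n = expo L. Proof. by rewrite /a eqxx. Qed.
Let a_low L i : (i < n)%N -> a L i = a' (R L) i.
Proof. by move=> ni; rewrite /a ltn_eqF. Qed.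

Let a_all (Q : nat -> int -> Prop) L :
  (forall i, (i < n.+1)%N -> Q i (a L i)) <->
  (forall i, (i < n)%N -> Q i (a' (R L) i)) /\ Q n (expo L).
Proof.
split=> [h|[h1 h2] i].
  split=> [i ni|]; first by rewrite -a_low //; apply: h; exact: ltnW.
  by rewrite -a_last; exact: h.
by rewrite ltnS leq_eqVlt => /orP[/eqP ->|ni]; [rewrite a_last | rewrite a_low //; exact: h1].
Qed.

Let Rsd m L : selfdual U m L -> selfdual U' m (R L).
Proof. exact: (reduction_selfdual hK halt eU fU ef). Qed.


Lemma step_shift m L M : selfdual U m L -> selfdual U (m + 1) M -> M `<=` L ->
  forall i, (i < n.+1)%N -> a M i = a L i \/ a M i = a L i + 1.
Proof.
move=> sL sM ML i; rewrite ltnS leq_eqVlt => /orP[/eqP ->|ni].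
  by rewrite !a_last; exact: (expo_nbr hK halt eU fU ef sL sM ML).
rewrite !a_low //; apply: (horo_shift horo' (Rsd sL) (Rsd sM) _ ni).
exact: (reduction_mono ML).
Qed.

Lemma step_index m L M : selfdual U m L -> selfdual U (m + 1) M -> M `<=` L ->
  has_index (q ^ n.+1) L M.
Proof.
move=> sL sM ML; rewrite expnS; apply: (index_nbr hK halt eU fU ef sL sM ML).
exact: (horo_index horo' (Rsd sL) (Rsd sM) (reduction_mono ML)).
Qed.

Lemma step_scale m L : selfdual U m L ->
  forall i, (i < n.+1)%N -> a (scale_set pi L) i = a L i + 1.
Proof.
move=> sL i; rewrite ltnS leq_eqVlt => /orP[/eqP ->|ni].
  by rewrite !a_last; exact: (expo_scale_pi hK halt eU fU ef sL).
rewrite !a_low // (reduction_scale_pi hK).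
exact: (horo_scale horo' (Rsd sL) ni).
Qed.

(** A neighbour M of L is a neighbour of the reduction together with a point of the
    fibre over it. *)
Lemma step_count m L (eps : nat -> bool) : selfdual U m L ->
  counts (q ^ \sum_(i < n.+1) eps i * i.+1)
    [set M | [/\ selfdual U (m + 1) M, M `<=` L &
                 forall i, (i < n.+1)%N -> a M i = a L i + (eps i)%:Z]].
Proof.
move=> sL; rewrite big_ord_recr /= expnD.
have allE M : (forall i, (i < n.+1)%N -> a M i = a L i + (eps i)%:Z) <->
    (forall i, (i < n)%N -> a' (R M) i = a' (R L) i + (eps i)%:Z) /\
    expo M = expo L + (eps n)%:Z.
  rewrite (a_all (fun i x => x = a L i + (eps i)%:Z)) a_last.
  by split=> -[h1 h2]; split => // i ni; rewrite h1 // a_low.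
apply: (counts_fibre (phi := R) _ (horo_count horo' eps (Rsd sL))).
  move=> M [sM ML /allE[h1 h2]]; split => //; first exact: Rsd.
  exact: reduction_mono.
move=> M' [sM' ML' h].
have ext : forall M, (selfdual U (m + 1) M /\ M `<=` L /\ R M = M' /\ expo M = expo L + (eps n)%:Z)
   <-> ([/\ selfdual U (m + 1) M, M `<=` L &
      forall i, (i < n.+1)%N -> a M i = a L i + (eps i)%:Z] /\ R M = M').
  move=> M; split=> [[sM [ML [RM eM]]]|[[sM ML /allE[_ eM]] RM]] //.
  by split => //; split => //; apply/allE; rewrite RM.
apply: (counts_ext ext).
case: (eps n) => /=; rewrite ?mul1n ?mul0n ?expn0 ?expnS.
  apply: (count_fibre_next hK halt eU fU ef sL sM' ML').
  exact: (horo_index horo' (Rsd sL) sM' ML').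
by have := count_fibre_same hK halt eU fU ef sL sM' ML'; rewrite addr0.
Qed.

Section Window.
Variables (w : nat) (G' : bool -> set (set V)).
Hypothesis wG' : window U' n a' w G'.
Variables (B' : set V) (c0 : int).
Hypothesis B'_sub : submodule B'.
Hypothesis B'_U' : forall x, B' x -> x \in U'.
Hypothesis B'_form : forall x y, B' x -> B' y -> P c0 (form x y).
Hypothesis G'_B' : forall b L, G' b L -> L `<=` B'.

(* The exponent beta of a pivot is at most 1 at the levels 0 and 1; this
   accounts for the 1 here and for the square of varpi in [good]. *)
Let D : int := Num.min 0 (c0 - 2) - 1.

(** The pivots y = [varpi]^beta n f with n in a fixed compact part of the
    Heisenberg group fixing e: z and s are the parameters of n. *)
Definition good (beta : int) (y : V) : Prop := exists z s,
  [/\ B' (pi ^ (2 : int) *: z), P D s & y = pi ^ beta *: (f + z + s *: e)].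

Definition extend_window (b : bool) (L : set V) : Prop :=
  [/\ selfdual U b%:Z L, 0 <= expo L <= w%:Z, G' b (R L) &
      exists2 y, L y & good (b%:Z - expo L) y].

Let scaled_U' k z : B' (pi ^ (k : int) *: z) -> z \in U'.
Proof.
move=> /B'_U'; move/(memvZ (pi ^ k)^-1); rewrite scalerA mulVf ?scale1r //.
exact: pi_exp_neq0 hK _.
Qed.

Let form_good beta y : good beta y -> form e y = pi ^ beta.
Proof.
move=> [z [s [Bz _ ->]]]; have zU := scaled_U' Bz.
by rewrite formZr !formDr formZr ef (perp_e zU) halt mulr0 !addr0 mulr1.
Qed.

(** Pairing with a good pivot bounds the component along e of the members of
    L & e^perp. *)
Let low_bound (b : bool) L y v c : selfdual U b%:Z L -> R L `<=` B' -> 0 <= expo L ->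
  L y -> good (b%:Z - expo L) y -> L (v + c *: e) -> v \in U' ->
  P (Num.min 0 (c0 - 2)) c.
Proof.
move=> sL RB e0 Ly gy Lv vU.
have Bv : B' v by apply: RB; split => //; exists c.
case: gy => z [s [Bz _ yE]]; have zU := scaled_U' Bz.
have : P b%:Z (form (v + c *: e) y) by exact: (sd_form sL Lv Ly).
have -> : form (v + c *: e) y = pi ^ (b%:Z - expo L) * (form v z + c).
  rewrite yE formZr; congr (_ * _).
  rewrite !formE (perp_fl halt vU) (perp_el halt vU) ef (perp_e zU) halt.
  by rewrite !mulr0 !addr0 add0r mulr1.
move/(ord_ge_pi_mul hK) => Pvzc.
have Pvz : P (c0 - 2) (form v z).
  have := B'_form Bv Bz; rewrite formZr => /(ord_ge_pi_mul hK).
  by congr P; ring.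
have -> : c = (form v z + c) - form v z by ring.
apply: (ord_geD hK); first by apply: ord_ge_le Pvzc; rewrite ge_min; apply/orP; left; lia.
by apply: (ord_geN hK); apply: ord_ge_le Pvz; rewrite ge_min lexx orbT.
Qed.

(** Two pivots of L differ by a member v + c e of L & e^perp, where v lies in B'
    and c is controlled by [low_bound].  Thus D has been chosen so that being
    good does not depend on the pivot. *)
Let transfer (b : bool) L y y1 : selfdual U b%:Z L -> R L `<=` B' -> 0 <= expo L ->
  L y -> good (b%:Z - expo L) y -> L y1 -> form e y1 = pi ^ (b%:Z - expo L) ->
  good (b%:Z - expo L) y1.
Proof.
move=> sL RB e0 Ly gy Ly1 ey1; set beta := b%:Z - expo L.
have beta1 : beta <= 1 by rewrite /beta; case: (b); lia.
have Ld : L (y1 - y) by exact: (sdB hK sL).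
have ed : form e (y1 - y) = 0 by rewrite formBr ey1 (form_good gy) subrr.
have [v vU [c vE]] := perp_decomp0 halt eU fU ef (sd_sub sL Ld) ed.
have Lv : L (v + c *: e) by rewrite -vE.
have Pc := low_bound sL RB e0 Ly gy Lv vU.
have Bv : B' v by apply: RB; split => //; exists c.
case: gy => z [s [Bz Ps yE]].
have [B0 BD BZ] := B'_sub.
exists (z + pi ^ (- beta) *: v), (s + pi ^ (- beta) * c); split.
- rewrite scalerDr scalerA; apply: (BD) => //; apply: (BZ) => //.
  rewrite -expfzDr ?(pi_neq0 hK) //; apply: ord_ge_le (ord_ge_pi hK _); lia.
- apply: (ord_geD hK) => //; apply/(ord_ge_pi_mul hK); apply: ord_ge_le Pc.
  by rewrite /D; lia.
have -> : y1 = y + (v + c *: e) by rewrite -vE addrC subrK.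
have E : pi ^ beta * pi ^ (- beta) = 1 by rewrite -expfzDr ?(pi_neq0 hK) // subrr.
rewrite yE -/beta !scalerDr !scalerA mulrDr mulrA E mul1r scale1r scalerDl.
by rewrite (AC (3*2) ((1*(2*4))*(3*5)))%AC.
Qed.

Let window_all L : in_window n.+1 w (a L) <->
  in_window n w (a' (R L)) /\ 0 <= expo L <= w%:Z.
Proof. exact: (a_all (fun _ x => 0 <= x <= w%:Z)). Qed.

(** One of L and M inherits a pivot, possibly multiplied by [varpi], from the
    other, and [transfer] passes from it to any pivot. *)
Lemma extend_closed L M : selfdual U 0 L -> selfdual U 1 M -> M `<=` L ->
  in_window n.+1 w (a L) -> in_window n.+1 w (a M) ->
  extend_window false L <-> extend_window true M.
Proof.
move=> sL sM ML /window_all[wL /andP[eL eL']] /window_all[wM /andP[eM eM']].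
have G'LM := window_closed wG' (Rsd sL) (Rsd sM) (reduction_mono ML) wL wM.
have eLM := expo_nbr hK halt eU fU ef sL sM ML.
have p0 := pi_neq0 hK.
have pi_good beta z : pi ^ (beta + 1) *: z = pi *: (pi ^ beta *: z).
  by rewrite scalerA expfzDr // expr1z mulrC.
split=> -[_ _ G'R [y Hy gy]].
  have RL := G'_B' G'R.
  split => //; [by rewrite eM | exact/G'LM |].
  case: eLM => E.
    exists (pi *: y); first exact: (sd_nbr hK sL sM ML).
    have [z [s [Bz Ps ->]]] := gy; exists z, s; split => //.
    by rewrite -pi_good; congr (_ ^ _ *: _); rewrite E /=; lia.
  have [y1 My1 ey1] := pivot hK halt eU fU ef sM.
  have E' : true%:Z - expo M = false%:Z - expo L by rewrite E /=; lia.
  exists y1 => //; rewrite E'; apply: (@transfer false L y y1 sL RL eL Hy gy); first exact: ML.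
  by rewrite ey1; congr (_ ^ _).
have RM := G'_B' G'R.
split => //; [by rewrite eL | exact/G'LM |].
case: eLM => E; last first.
  have E' : true%:Z - expo M = false%:Z - expo L by rewrite E /=; lia.
  by exists y; [exact: ML | rewrite -E'].
have [y1 Ly1 ey1] := pivot hK halt eU fU ef sL.
have E' : true%:Z - expo M = false%:Z - expo L + 1 by rewrite E /=; lia.
exists y1 => //.
have [|z [s [Bz Ps yE]]] := @transfer true M y _ sM RM eM Hy gy (sd_nbr hK sL sM ML Ly1).
  by rewrite formZr ey1 E' [RHS]expfzDr // expr1z mulrC.
exists z, s; split => //; apply: (scalerI p0).
by rewrite yE E' pi_good.
Qed.

Lemma extend_base : exists2 L, extend_window false L &
  forall i, (i < n.+1)%N -> a L i = 0.
Proof.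
have [L' GL' aL'] := window_base wG'.
have [sL'0 wL'] := window_type wG' GL'.
have sL' : selfdual U' 0 L' := sL'0.
have ef0 : form e f = pi ^ (0 : int) by rewrite ef.
have sL := build_selfdual hK halt eU fU ef sL' fU ef0.
have eL : expo (build ord form e L' 0 f) = 0.
  by rewrite (build_expo hK halt eU fU ef sL' fU ef0).
have RL : R (build ord form e L' 0 f) = L'.
  exact: (build_reduction hK halt eU fU ef sL' fU ef0).
exists (build ord form e L' 0 f); last first.
  by apply/(a_all (fun _ x => x = 0)); rewrite RL eL.
split => //; [by rewrite eL | by rewrite RL |].
exists f; first by exact: (build_y hK f sL').
exists 0, 0; split; [by rewrite scaler0; case: B'_sub | by left |].
by rewrite eL subrr expr0z scale1r scale0r !addr0.
Qed.

(** L is spanned by a good pivot and by L & e^perp, and [low_bound] controls the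
    latter. *)
Lemma extend_bounded : exists B c, [/\ submodule B, forall x, B x -> x \in U,
    forall x y, B x -> B y -> P c (form x y) & forall b L, extend_window b L -> L `<=` B].
Proof.
have [B0 BD BZ] := B'_sub.
(* A good pivot has its component in U' in varpi^(-w - 2) B'. *)
pose k : int := w%:Z + 2.
exists [set x | exists al v be, [/\ P (D - w%:Z) al, B' (pi ^ k *: v), P (- w%:Z) be &
   x = al *: e + v + be *: f]].
exists (Num.min (D - w%:Z - w%:Z) (c0 - 2 * k)); split.
- split.
  + exists 0, 0, 0; split; [by left | by rewrite scaler0 | by left |].
    by rewrite !scale0r !addr0.
  + move=> _ _ [al [v [be [Pal Bv Pbe ->]]]] [al' [v' [be' [Pal' Bv' Pbe' ->]]]].
    exists (al + al'), (v + v'), (be + be'); split.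
    * exact: (ord_geD hK).
    * by rewrite scalerDr; exact: BD.
    * exact: (ord_geD hK).
    by rewrite !scalerDl (AC (3*3) ((1*4)*(2*5)*(3*6)))%AC.
  move=> c _ Oc [al [v [be [Pal Bv Pbe ->]]]].
  exists (c * al), (c *: v), (c * be); split.
  + by rewrite -[D - _]add0r; exact: (ord_geM hK).
  + by rewrite scalerA mulrC -scalerA; exact: BZ.
  + by rewrite -[- _]add0r; exact: (ord_geM hK).
  by rewrite !scalerDr !scalerA.
- move=> _ [al [v [be [_ Bv _ ->]]]]; have vU := scaled_U' Bv.
  by rewrite !memvD ?memvZ //; exact: perp_sub vU.
- move=> _ _ [al [v [be [Pal Bv Pbe ->]]]] [al' [v' [be' [Pal' Bv' Pbe' ->]]]].
  have vU := scaled_U' Bv; have vU' := scaled_U' Bv'.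
  have -> : form (al *: e + v + be *: f) (al' *: e + v' + be' *: f) =
     (al * be' - be * al') + form v v'.
    rewrite !(formDl, formDr, formZl, formZr) !halt ef (fe halt ef) (perp_e vU') (perp_el halt vU).
    by rewrite (perp_f vU') (perp_fl halt vU); ring.
  apply: (ord_ge_min hK).
    apply: (ord_geB hK); first exact: (ord_geM hK).
    by rewrite [_ - _ - _]addrC; exact: (ord_geM hK).
  have := B'_form Bv Bv'; rewrite formZl formZr => /(ord_ge_pi_mul hK)/(ord_ge_pi_mul hK).
  by congr P; ring.
move=> b L [sL /andP[e0 ew] G'R [y Ly gy]] x Lx.
have RB := G'_B' G'R.
set beta := b%:Z - expo L in gy.
have beta1 : - w%:Z <= beta <= 1 by rewrite /beta; case: (b); lia.
have := Lx; rewrite [L in L x](build_recover hK halt eU fU ef sL Ly (form_good gy)).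
move=> [t [v [c [Ot Rv Py xE]]]].
have vU : v \in U' by case: Rv.
have Lvc : L (v + c *: e).
  have -> : v + c *: e = x - t *: y by rewrite xE [RHS]addrC addKr.
  by apply: (sdB hK sL) => //; exact: (sdZ hK sL).
have Pc := low_bound sL RB e0 Ly gy Lvc vU.
have [z [s [Bz Ps yE]]] := gy.
exists (t * (pi ^ beta * s) + c), (t *: (pi ^ beta *: z) + v), (t * pi ^ beta); split.
- apply: (ord_geD hK); last by apply: ord_ge_le Pc; rewrite /D; lia.
  have := ord_geM hK Ot (ord_geM hK (ord_ge_pi hK beta) Ps).
  by apply: ord_ge_le; lia.
- rewrite scalerDr; apply: (BD); last first.
    by apply: (BZ); [apply: ord_ge_le (ord_ge_pi hK k); rewrite /k; lia | exact: RB].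
  rewrite scalerA mulrC -scalerA; apply: (BZ) => //.
  have -> : pi ^ k *: (pi ^ beta *: z) = pi ^ (w%:Z + beta) *: (pi ^ (2 : int) *: z).
    by rewrite !scalerA -!expfzDr ?(pi_neq0 hK) //; congr (_ ^ _ *: _); rewrite /k; ring.
  by apply: (BZ) => //; apply: ord_ge_le (ord_ge_pi hK _); lia.
- have := ord_geM hK Ot (ord_ge_pi hK beta); rewrite add0r.
  by apply: ord_ge_le; lia.
rewrite xE yE !scalerDr !scalerDl !scalerA !mulrA.
by rewrite (AC (3*2) ((3*5)*(2*4)*1))%AC.
Qed.

End Window.

Lemma horocyclic_step : horocyclic U n.+1 extend_type.
Proof.
split; [exact: step_shift | exact: step_count | exact: step_scale | exact: step_index |].
move=> w; have [G' wG'] := horo_window horo' w.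
have [B' [c0 [Bs BU Bf GB]]] := window_bounded wG'.
exists (extend_window w G' B' c0); split.
- move=> b L [sL eL GL _]; split => //.
  apply/(a_all (fun _ x => 0 <= x <= w%:Z)); split => //.
  exact: (window_type wG' GL).2.
- exact: (extend_base wG' _ Bs).
- exact: (extend_closed wG' Bs BU Bf GB).
exact: (extend_bounded w Bs BU Bf GB).
Qed.

End Step.

Section Pairs.
Variable U : {vspace V}.
Hypothesis ndU : nondegenerate_on U.

Lemma exists_hyperbolic_pair e : e \in U -> e != 0 ->
  exists2 f, f \in U & form e f = 1.
Proof.
move=> eU e0; apply: contrapT => none; case/eqP: e0; apply: ndU => // y yU.
apply/eqP/negPn/negP => ey; apply: none; exists ((form e y)^-1 *: y).
  by rewrite memvZ.
by rewrite formZr mulVf.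
Qed.

Variables (e f : V).
Hypothesis eU : e \in U.
Hypothesis fU : f \in U.
Hypothesis ef : form e f = 1.
Local Notation U' := (perp_pair form U e f).

(** U is spanned by e, f and the orthogonal complement. *)
Lemma perp_pair_nondegenerate : nondegenerate_on U'.
Proof.
move=> x xU xP; apply: ndU; first exact: perp_sub xU.
move=> y yU; have [y' [c [d [y'U -> _ _]]]] := perp_decomp halt eU fU ef yU.
by rewrite !formE (perp_el halt xU) (perp_fl halt xU) xP // !mulr0 !addr0.
Qed.

Let dim_ker (W : {vspace V}) (u v : V) : v \in W -> form u v != 0 ->
  \dim W = (\dim (W :&: lker (linfun (form u : V -> K^o)))).+1.
Proof.
move=> vW uv; rewrite -(limg_ker_dim (linfun (form u : V -> K^o)) W) -addn1; congr addn.
apply/eqP; rewrite eqn_leq; apply/andP; split.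
  apply: leq_trans (dimvS (subvf _)) _; by rewrite dimvf.
rewrite lt0n dimv_eq0; apply/eqP => E.
have : linfun (form u : V -> K^o) v \in (linfun (form u : V -> K^o) @: W)%VS by exact: memv_img.
by rewrite E memv0 lfunE /= (negPf uv).
Qed.

Lemma dim_perp_pair : \dim U = (\dim U').+2.
Proof.
rewrite (@dim_ker U e f) ?ef ?oner_eq0 //; congr S.
rewrite (@dim_ker _ f e) //; last by rewrite (fe halt ef) oppr_eq0 oner_eq0.
by rewrite memv_cap eU memv_ker lfunE /= halt.
Qed.

End Pairs.

(** Induction on n, splitting off a hyperbolic pair. *)
Theorem horocyclic_exists n (U : {vspace V}) : nondegenerate_on U ->
  \dim U = (2 * n)%N -> exists a, horocyclic U n a.
Proof.
elim: n U => [|n ih] U ndU dU.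
  exists (fun _ _ => 0); apply: horocyclic_trivial => x.
  by move/eqP: dU; rewrite muln0 dimv_eq0 => /eqP ->; rewrite memv0 => /eqP.
have U0 : U != 0%VS by rewrite -dimv_eq0 dU.
have [|f fU ef] := exists_hyperbolic_pair ndU (memv_pick U); first by rewrite vpick0.
have ndU' := perp_pair_nondegenerate ndU (memv_pick U) fU ef.
have [|a' ha'] := ih _ ndU'.
  have := dim_perp_pair (memv_pick U) fU ef; lia.
by exists (extend_type U (vpick U) f n a'); apply: horocyclic_step ha'; rewrite ?memv_pick.
Qed.
End Horocyclic.

(** * Symplectic lattices *)

Section SymplecticLattices.
Variables (K : fieldType) (ord : K -> int) (varpi : K) (q : nat).
Hypothesis hK : local_field ord varpi q.
Variables (V : vectType K) (form : {biscalar V}).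
Hypothesis halt : alternating_form form.
Local Notation P := (ord_ge ord).
Local Notation pi := varpi.
Local Notation selfdual := (selfdual ord form).
Local Notation O := (valring ord).

(** Otherwise L would be stable under division by [varpi], and so would the
    ideal L & K e. *)
Lemma level_ge (U : {vspace V}) e f k m L : e \in U -> f \in U -> form e f = 1 ->
  selfdual U m L -> (forall x y, L x -> L y -> P k (form x y)) -> k <= m.
Proof.
move=> eU fU ef sL Lk; rewrite leNgt; apply/negP => mk.
have p0 := pi_neq0 hK.
have shrink v : L v -> L (pi^-1 *: v).
  move=> Lv; apply: (sd_mem sL); first by rewrite memvZ // (sd_sub sL).
  move=> y Ly; rewrite formZl (ord_ge_mull hK) ?invr_eq0 // (ord_inv hK) // (ord_pi hK) opprK.
  by apply: ord_ge_le (Lk _ _ Lv Ly); lia.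
set a := expo ord e L.
have eP := expoP hK halt eU fU ef sL.
have : L (pi ^ a *: e) by apply/eP; exact: (ord_ge_pi hK).
move/shrink; rewrite scalerA => /eP.
rewrite (ord_ge_mull hK) ?invr_eq0 // (ord_inv hK) // (ord_pi hK) opprK.
by case=> [/eqP|]; rewrite ?(negPf (pi_exp_neq0 hK _)) // (ord_pi_exp hK) -/a; lia.
Qed.

Lemma level_anti (U : {vspace V}) e f m m' L M : e \in U -> f \in U -> form e f = 1 ->
  selfdual U m L -> selfdual U m' M -> L `<=` M -> m' <= m.
Proof.
move=> eU fU ef sL sM LM; apply: (level_ge eU fU ef sL) => x y Lx Ly.
by apply: (sd_form sM); exact: LM.
Qed.

Lemma ord_ge_sum (I : Type) (s : seq I) m (F : I -> K) :
  (forall i, P m (F i)) -> P m (\sum_(i <- s) F i).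
Proof.
move=> Fm; elim/big_ind: _ => //; first by left.
by move=> x y; exact: (ord_geD hK).
Qed.

Lemma exists_lower_bound (I : finType) (c : I -> int) : exists C, forall i, C <= c i.
Proof.
exists (- \sum_i `|c i|) => i; rewrite (bigD1 i) //= opprD.
set S := \sum_(j | _) _; have S0 : 0 <= S by apply: sumr_ge0.
move: (c i) => ci; have := ler_norm (- ci); rewrite normrN.
by move: (`|ci|) S S0 => x y; clear; lia.
Qed.

Section Symplectic.
Variable n : nat.
Variables (u w : n.-tuple V).
Hypothesis uw : forall i j, form (tnth u i) (tnth w j) = (i == j)%:R.
Hypothesis uu : forall i j, form (tnth u i) (tnth u j) = 0.
Hypothesis ww : forall i j, form (tnth w i) (tnth w j) = 0.
Variables (a b : 'I_n -> int).
Local Notation L := (symplectic_lattice ord varpi u w a b).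

Let wu i j : form (tnth w i) (tnth u j) = - (i == j)%:R.
Proof. by rewrite (form_anti halt) uw eq_sym. Qed.

Lemma form_suml (I : finType) (F : I -> V) x : form (\sum_i F i) x = \sum_i form (F i) x.
Proof.
apply: (big_morph (fun v => form v x)); last exact: form0l.
by move=> y z; rewrite formDl.
Qed.

Lemma form_sumr (I : finType) (F : I -> V) x : form x (\sum_i F i) = \sum_i form x (F i).
Proof. by apply: (big_morph (form x)); [move=> y z; rewrite formDr | exact: form0r]. Qed.

Lemma sum_delta (F : 'I_n -> K) j : \sum_i F i * (i == j)%:R = F j.
Proof.
rewrite (bigD1 j) //= eqxx mulr1 big1 ?addr0 // => i /negPf ->; exact: mulr0.
Qed.

Definition comb (x y : 'I_n -> K) : V :=
  \sum_i x i *: tnth u i + \sum_i y i *: tnth w i.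

Lemma comb_w x y j : form (comb x y) (tnth w j) = x j.
Proof.
rewrite formDl !form_suml [X in _ + X]big1 => [|i _]; last by rewrite formZl ww mulr0.
by rewrite addr0 -[RHS]sum_delta; apply: eq_bigr => i _; rewrite formZl uw.
Qed.

Lemma comb_u x y j : form (tnth u j) (comb x y) = y j.
Proof.
rewrite formDr !form_sumr big1 => [|i _]; last by rewrite formZr uu mulr0.
by rewrite add0r -[RHS]sum_delta; apply: eq_bigr => i _; rewrite formZr uw eq_sym.
Qed.

Lemma comb_form x y v : form (comb x y) v =
  \sum_i x i * form (tnth u i) v + \sum_i y i * form (tnth w i) v.
Proof.
by rewrite formDl !form_suml; congr (_ + _); apply: eq_bigr => i _; rewrite formZl.
Qed.

Lemma symplectic_latticeP v : L v <->
  exists x y, [/\ forall i, P (a i) (x i), forall i, P (b i) (y i) & v = comb x y].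
Proof.
split.
  move=> [_ [c Oc <-] [_ [d Od <-] <-]].
  exists (fun i => c i * pi ^ a i), (fun i => d i * pi ^ b i); split.
  - by move=> i; rewrite -[a i]add0r; apply: (ord_geM hK) (Oc i) _; rewrite add0r; exact: (ord_ge_pi hK).
  - by move=> i; rewrite -[b i]add0r; apply: (ord_geM hK) (Od i) _; rewrite add0r; exact: (ord_ge_pi hK).
  by congr (_ + _); apply: eq_bigr => i _; rewrite scalerA.
move=> [x [y [xa yb ->]]].
have scal k z : P k z -> O ((pi ^ k)^-1 * z).
  by rewrite /valring (ord_ge_mull hK) ?invr_eq0 ?(pi_exp_neq0 hK) // (ord_inv hK) ?(pi_exp_neq0 hK) // opprK (ord_pi_exp hK) add0r.
exists (\sum_i x i *: tnth u i).
  exists (fun i => (pi ^ a i)^-1 * x i); first by move=> i; exact: scal.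
  by apply: eq_bigr => i _; rewrite scalerA mulrAC mulVf ?mul1r ?(pi_exp_neq0 hK).
exists (\sum_i y i *: tnth w i) => //.
exists (fun i => (pi ^ b i)^-1 * y i); first by move=> i; exact: scal.
by apply: eq_bigr => i _; rewrite scalerA mulrAC mulVf ?mul1r ?(pi_exp_neq0 hK).
Qed.

Section Spanning.
Hypothesis span_uw : forall v, v = comb (fun i => form v (tnth w i)) (fun i => form (tnth u i) v).
Variable m : int.
Hypothesis ab : forall i, a i + b i = m.

Lemma symplectic_mem v : L v <->
  (forall i, P (a i) (form v (tnth w i))) /\ (forall i, P (b i) (form (tnth u i) v)).
Proof.
rewrite symplectic_latticeP; split.
  by move=> [x [y [xa yb ->]]]; split => i; rewrite ?comb_w ?comb_u.
by move=> [h1 h2]; eexists _, _; split; [exact: h1 | exact: h2 | exact: span_uw].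
Qed.

(** In a symplectic basis duality acts on pairs of coordinates and exchanges the
    exponents a and m - b. *)
Lemma symplectic_selfdual : selfdual fullv m L.
Proof.
split=> [v|v _].
  split=> [/symplectic_mem[va vb]|[_ vP]].
    split; first exact: memvf.
    move=> y /symplectic_mem[ya yb].
    rewrite [v]span_uw comb_form; apply: (ord_geD hK); apply: ord_ge_sum => i.
      by rewrite -(ab i); exact: (ord_geM hK).
    rewrite -(ab i) addrC; apply: (ord_geM hK) => //.
    by rewrite (form_anti halt); exact: (ord_geN hK).
  have scal i : (forall j, P (a j) (form (pi ^ a i *: tnth u i) (tnth w j))) /\
      (forall j, P (b j) (form (pi ^ b i *: tnth w i) (tnth u j))).
    split=> j; rewrite formZl ?uw ?wu.
      by case: eqP => [->|_]; rewrite ?mulr1 ?mulr0; [exact: (ord_ge_pi hK) | left].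
    case: eqP => [->|_]; rewrite ?mulrN ?mulr1 ?mulr0; last by rewrite oppr0; left.
    by apply: (ord_geN hK); exact: (ord_ge_pi hK).
  apply/symplectic_mem; split => i.
    have : L (pi ^ b i *: tnth w i).
      apply/symplectic_mem; split => j; first by rewrite formZl ww mulr0; left.
      by rewrite (form_anti halt); apply: (ord_geN hK); exact: (scal i).2.
    move/vP; rewrite formZr (ord_ge_pi_mul hK); have -> // : m - b i = a i by rewrite -(ab i); ring.
  have : L (pi ^ a i *: tnth u i).
    apply/symplectic_mem; split => j; first exact: (scal i).1.
    by rewrite formZr uu mulr0; left.
  move/vP; rewrite formZr (ord_ge_pi_mul hK) (form_anti halt) => /(ord_geN hK).
  have -> : m - a i = b i by rewrite -(ab i); ring.
  by rewrite opprK.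
have [C1 C1P] := exists_lower_bound (fun i => a i + ord (form (tnth u i) v)).
have [C2 C2P] := exists_lower_bound (fun i => b i + ord (form (tnth w i) v)).
exists (Num.min C1 C2) => y /symplectic_mem[ya yb].
rewrite [y]span_uw comb_form; apply: (ord_ge_min hK).
  apply: ord_ge_sum => i; apply: ord_ge_le (C1P i) _.
  by apply: (ord_geM hK) => //; exact: ord_ge_ord.
apply: ord_ge_sum => i; apply: ord_ge_le (C2P i) _.
by apply: (ord_geM hK) => //; exact: ord_ge_ord.
Qed.

End Spanning.

Lemma symplectic_is_lattice : lattice ord n L.
Proof.
pose E (p : 'I_n + 'I_n) : V :=
  match p with inl i => pi ^ a i *: tnth u i | inr i => pi ^ b i *: tnth w i end.
have n2 : (2 * n = n + n)%N by lia.
pose h (i : 'I_(2 * n)) : 'I_n + 'I_n := fintype.split (cast_ord n2 i).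
pose k (p : 'I_n + 'I_n) : 'I_(2 * n) := cast_ord (esym n2) (unsplit p).
have hk : cancel h k by move=> i; rewrite /k /h splitK cast_ordK.
have kh : cancel k h by move=> i; rewrite /k /h cast_ordKV unsplitK.
have sumE (c : 'I_(2 * n) -> K) : \sum_i c i *: E (h i) =
    comb (fun i => c (k (inl i)) * pi ^ a i) (fun i => c (k (inr i)) * pi ^ b i).
  rewrite (reindex k) /=; last by exists h => i _.
  rewrite big_sumType /comb; congr (_ + _); apply: eq_bigr => i _; rewrite kh /= scalerA //.
have OE c k' : O c -> P k' (c * pi ^ k').
  by move=> Oc; have := ord_geM hK Oc (ord_ge_pi hK k'); rewrite add0r.
exists (E \o h); split.
  move=> c Oc; rewrite sumE => c0 i; rewrite -(hk i).
  have x0 j := comb_w (fun i => c (k (inl i)) * pi ^ a i) (fun i => c (k (inr i)) * pi ^ b i) j.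
  have y0 j := comb_u (fun i => c (k (inl i)) * pi ^ a i) (fun i => c (k (inr i)) * pi ^ b i) j.
  rewrite c0 in x0 y0; case: (h i) => j.
    have := x0 j; rewrite form0l => /esym/eqP; rewrite mulf_eq0 (negPf (pi_exp_neq0 hK _)) orbF.
    by move/eqP.
  have := y0 j; rewrite form0r => /esym/eqP; rewrite mulf_eq0 (negPf (pi_exp_neq0 hK _)) orbF.
  by move/eqP.
apply/seteqP; split => v.
  move=> [_ [c Oc <-] [_ [d Od <-] <-]].
  exists (fun i => match h i with inl j => c j | inr j => d j end).
    by move=> i; case: (h i).
  rewrite (reindex k) /=; last by exists h => i _.
  rewrite big_sumType /=; congr (_ + _); apply: eq_bigr => i _; rewrite kh //.
move=> [c Oc <-]; rewrite sumE; apply/symplectic_latticeP.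
by eexists _, _; split; [move=> i; exact: OE | move=> i; exact: OE |].
Qed.

End Symplectic.
End SymplecticLattices.

(** * Special vertices as self-dual lattices *)

Section SpecialVertices.
Variables (K : fieldType) (ord : K -> int) (varpi : K) (q : nat).
Hypothesis hK : local_field ord varpi q.
Variables (V : vectType K) (form : {biscalar V}).
Hypothesis halt : alternating_form form.
Local Notation P := (ord_ge ord).
Local Notation pi := varpi.
Local Notation selfdual := (selfdual ord form).
Local Notation O := (valring ord).

Lemma comb_cons n (u0 w0 : V) (u w : n.-tuple V) x0 y0 x y :
  comb [tuple of u0 :: u] [tuple of w0 :: w]
    (fun i => if unlift ord0 i is Some j then x j else x0)
    (fun i => if unlift ord0 i is Some j then y j else y0) =
  x0 *: u0 + comb u w x y + y0 *: w0.
Proof.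
rewrite /comb !big_ord_recl /= unlift_none !tnth0.
under eq_bigr do rewrite liftK tnthS.
under [X in _ + (_ + X)]eq_bigr do rewrite liftK tnthS.
by rewrite (AC (2*2) ((1*(2*4))*3))%AC.
Qed.

(** Gram-Schmidt over O: if y is a pivot of L, then e and f = [varpi]^-b y form a
    hyperbolic pair and L is the orthogonal sum of [varpi]^a O e + [varpi]^b O f
    and of its reduction along this very pair. *)
Lemma symplectic_exists n (U : {vspace V}) m L : nondegenerate_on form U ->
  \dim U = (2 * n)%N -> selfdual U m L ->
  exists (u w : n.-tuple V) (a b : 'I_n -> int),
  [/\ [/\ forall i, tnth u i \in U, forall i, tnth w i \in U,
          forall i j, form (tnth u i) (tnth w j) = (i == j)%:R,
          forall i j, form (tnth u i) (tnth u j) = 0 &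
          forall i j, form (tnth w i) (tnth w j) = 0],
      forall v, v \in U -> exists x y, v = comb u w x y,
      forall i, a i + b i = m &
      forall v, L v <-> exists x y, [/\ forall i, P (a i) (x i), forall i, P (b i) (y i) &
                                      v = comb u w x y]].
Proof.
elim: n U L => [|n ih] U L ndU dU sL.
  have U0 x : x \in U -> x = 0.
    by move/eqP: dU; rewrite muln0 dimv_eq0 => /eqP ->; rewrite memv0 => /eqP.
  have c0 x y : comb [tuple] [tuple] x y = 0 :> V by rewrite /comb !big_ord0 addr0.
  exists [tuple], [tuple], (fun=> 0), (fun=> 0); split.
  - by split => [] [].
  - by move=> v /U0 ->; exists (fun=> 0), (fun=> 0); rewrite c0.
  - by case.
  move=> v; split=> [/(sd_sub sL)/U0 ->|[x [y [_ _ ->]]]]; last by rewrite c0; exact: sd0 sL.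
  by exists (fun=> 0), (fun=> 0); rewrite c0; split => // -[].
set e := vpick U; have eU : e \in U := memv_pick U.
have e0 : e != 0 by rewrite vpick0 -dimv_eq0 dU.
have [f0 f0U ef0] := exists_hyperbolic_pair ndU eU e0.
have [y Ly ey] := pivot hK halt eU f0U ef0 sL.
set a := expo ord e L in ey; set b := m - a in ey.
have pb0 := pi_exp_neq0 hK b.
pose f := (pi ^ b)^-1 *: y.
have fU : f \in U by rewrite memvZ // (sd_sub sL).
have yE : y = pi ^ b *: f by rewrite scalerA mulfV // scale1r.
have ef : form e f = 1 by rewrite formZr ey mulVf.
have ndU' := perp_pair_nondegenerate halt ndU eU fU ef.
have dU' : \dim (perp_pair form U e f) = (2 * n)%N.
  by have := dim_perp_pair halt eU fU ef; rewrite dU; lia.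
have sR := reduction_selfdual hK halt eU fU ef sL.
have [u [w [a' [b' [[uU wU uw uu ww] spn ab RP]]]]] := ih _ _ ndU' dU' sR.
have ui i := uU i; have wi i := wU i.
exists [tuple of e :: u], [tuple of f :: w].
exists (fun i => if unlift ord0 i is Some j then a' j else a).
exists (fun i => if unlift ord0 i is Some j then b' j else b).
have tn (z0 : V) (z : n.-tuple V) i : tnth [tuple of z0 :: z] i =
    if unlift ord0 i is Some j then tnth z j else z0.
  by case: unliftP => [j ->|->]; rewrite ?tnthS ?tnth0.
split.
- split.
  + by move=> i; rewrite tn; case: unliftP => // j _; exact: perp_sub (uU j).
  + by move=> i; rewrite tn; case: unliftP => // j _; exact: perp_sub (wU j).
  + move=> i j; rewrite !tn; case: unliftP => [i' ->|->]; case: unliftP => [j' ->|->].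
    * by rewrite uw (inj_eq (@lift_inj _ _)).
    * by rewrite (perp_fl halt (uU _)).
    * by rewrite (perp_e (wU _)).
    by rewrite ef eqxx.
  + move=> i j; rewrite !tn; case: unliftP => [i' _|_]; case: unliftP => [j' _|_] //.
    * by rewrite (perp_el halt (uU _)).
    by rewrite (perp_e (uU _)).
  move=> i j; rewrite !tn; case: unliftP => [i' _|_]; case: unliftP => [j' _|_] //.
    by rewrite (perp_fl halt (wU _)).
  by rewrite (perp_f (wU _)).
- move=> v vU; have [v' [c [d [v'U -> _ _]]]] := perp_decomp halt eU fU ef vU.
  have [x [z ->]] := spn _ v'U.
  exists (fun i => if unlift ord0 i is Some j then x j else c).
  exists (fun i => if unlift ord0 i is Some j then z j else d).
  by rewrite comb_cons.
- by move=> i; case: unliftP => [j _|_]; [exact: ab | rewrite /b addrC subrK].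
move=> v; rewrite {1}[L](build_recover hK halt eU fU ef sL Ly ey); split.
  move=> [t [v' [c [Ot Rv Pc ->]]]].
  have v'U := sd_sub sR Rv.
  have [x [z [xa zb v'E]]] := (RP v').1 Rv.
  have Pac : P a c.
    move: Pc; rewrite yE formDl formZl !(formZr form (pi ^ b) f) (perp_fl halt v'U) ef mulr0 add0r mulr1 mulrC.
    move/(ord_ge_pi_mul hK); congr P; rewrite /b; ring.
  exists (fun i => if unlift ord0 i is Some j then x j else c).
  exists (fun i => if unlift ord0 i is Some j then z j else t * pi ^ b); split.
  - by move=> i; case: unliftP.
  - move=> i; case: unliftP => // _; have := ord_geM hK Ot (ord_ge_pi hK b).
    by rewrite add0r.
  by rewrite comb_cons -v'E yE scalerA addrC (addrC v').
move=> [x [z [xa zb vE]]].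
have xa0 := xa ord0; rewrite unlift_none in xa0.
have zb0 := zb ord0; rewrite unlift_none in zb0.
pose x' j := x (lift ord0 j); pose z' j := z (lift ord0 j).
have Rv : reduction form U e f L (comb u w x' z').
  apply/RP; exists x', z'; split => // j.
    by have := xa (lift ord0 j); rewrite liftK.
  by have := zb (lift ord0 j); rewrite liftK.
have v'U := sd_sub sR Rv.
exists ((pi ^ b)^-1 * z ord0), (comb u w x' z'), (x ord0); split => //.
- by rewrite (ord_ge_mull hK) ?invr_eq0 // (ord_inv hK) // opprK (ord_pi_exp hK) add0r.
- rewrite yE formDl formZl !(formZr form (pi ^ b) f) (perp_fl halt v'U) ef mulr0 add0r mulr1 mulrC.
  apply/(ord_ge_pi_mul hK); have -> // : m - b = a by rewrite /b; ring.
rewrite vE yE scalerA mulrAC mulVf // mul1r addrC (addrC (comb _ _ _ _)) -comb_cons.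
by congr comb; apply/funext => i; case: unliftP => [j ->|->].
Qed.

Section Full.
Variable n : nat.
Hypothesis n_gt0 : (0 < n)%N.
Hypothesis hV : \dim {:V} = (2 * n)%N.
Hypothesis hnd : nondegenerate_form form.

Local Notation SD := (selfdual fullv).

Lemma nondegenerate_full : nondegenerate_on form fullv.
Proof. by move=> x _ xP; apply: hnd => y; apply: xP; exact: memvf. Qed.

Lemma full_pair : exists e f, form e f = 1.
Proof.
have [] := exists_hyperbolic_pair nondegenerate_full (memv_pick fullv).
  by rewrite vpick0 -dimv_eq0 hV muln_eq0 /= -lt0n.
by move=> f _ ef; exists (vpick fullv), f.
Qed.

Lemma symplectic_basis_span u w : symplectic_basis form u w ->
  forall v, v = comb u w (fun i : 'I_n => form v (tnth w i)) (fun i => form (tnth u i) v).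
Proof.
move=> [bas uw uu ww] v; apply/eqP; rewrite -subr_eq0; apply/eqP/hnd => y.
set z := v - _.
have zw j : form z (tnth w j) = 0 by rewrite formBl comb_w // subrr.
have zu j : form z (tnth u j) = 0.
  by rewrite (form_anti halt) formBr comb_u // subrr oppr0.
have : y \in <<u ++ w>>%VS by rewrite (span_basis bas) memvf.
rewrite span_def big_cat /= => /memv_addP[y1 y1u [y2 y2w ->]].
rewrite formDr.
have zero (s : n.-tuple V) x : (forall j, form z (tnth s j) = 0) ->
    x \in (\sum_(i <- s) <[i]>)%VS -> form z x = 0.
  move=> zs; rewrite -span_def => /coord_span ->; rewrite form_sumr big1 // => i _.
  by rewrite formZr -tnth_nth zs mulr0.
by rewrite (zero u) // (zero w) // addr0.
Qed.

Lemma selfdual_symplectic m L : SD m L -> exists u w a b,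
  [/\ symplectic_basis form u w, L = symplectic_lattice ord varpi u w a b &
      forall i : 'I_n, a i + b i = m].
Proof.
move=> sL.
have [u [w [a [b [[uU wU uw uu ww] spn ab LP]]]]] := symplectic_exists nondegenerate_full hV sL.
exists u, w, a, b; split => //.
  split => //; rewrite basisEdim size_cat !size_tuple hV mul2n addnn leqnn andbT.
  apply/subvP => v /spn[x [y ->]].
  apply: memvD; apply: memv_suml => i _; apply: memvZ; apply: memv_span.
    by rewrite mem_cat mem_tnth.
  by rewrite mem_cat mem_tnth orbT.
by apply/seteqP; split => v; rewrite LP (symplectic_latticeP hK).
Qed.

Lemma symplectic_SD u w (a b : 'I_n -> int) m : symplectic_basis form u w ->
  (forall i, a i + b i = m) -> SD m (symplectic_lattice ord varpi u w a b).
Proof.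
move=> uwb ab; have spn := symplectic_basis_span uwb.
by case: uwb => _ uw uu ww; exact: (symplectic_selfdual hK halt uw uu ww spn ab).
Qed.

Lemma SD_lattice m L : SD m L -> lattice ord n L.
Proof.
move=> /selfdual_symplectic[u [w [a [b [[_ uw uu ww] -> _]]]]].
exact: (symplectic_is_lattice hK).
Qed.

Lemma piOE x : piO ord varpi x <-> P 1 x.
Proof.
have p0 := pi_neq0 hK.
split; first by move=> [y Oy <-]; rewrite (ord_ge_mull hK) // (ord_pi hK) subrr.
move=> Px; exists (pi^-1 * x); last by rewrite mulVKf.
by rewrite /valring (ord_ge_mull hK) ?invr_eq0 // (ord_inv hK) // (ord_pi hK).
Qed.

Lemma SD_primitive L : SD 0 L -> primitive ord varpi form n L.
Proof.
move=> sL; split; first exact: SD_lattice sL.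
  by move=> x y Lx Ly; exact: (sd_form sL).
move=> x Lx xP; apply/scale_setE; first exact: pi_neq0 hK.
apply: (sd_mem sL); first exact: memvf.
move=> y Ly; have p0 := pi_neq0 hK.
rewrite formZl (ord_ge_mull hK) ?invr_eq0 // (ord_inv hK) // (ord_pi hK) opprK add0r.
by apply/piOE; exact: xP.
Qed.

(** Let v pair integrally with L.  Some [varpi]^k v lies in L, and
    non-degeneracy modulo [varpi] allows k to be lowered step by step. *)
Lemma primitive_SD L : primitive ord varpi form n L -> SD 0 L.
Proof.
move=> [[E [Efree LE]] Lform Lnd].
have p0 := pi_neq0 hK.
pose X := [tuple E i | i < (2 * n)].
have XE (i : 'I_(2 * n)) : X`_i = E i by rewrite -tnth_nth tnth_mktuple.
have freeX : free X.
  apply/freeP => k k0 i.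
  have [C CP] := exists_lower_bound (fun i => ord (k i)).
  have := Efree (fun i => pi ^ (- C) * k i) _ _ i.
  have pc0 := pi_exp_neq0 hK (- C).
  move=> h; apply/eqP; have : pi ^ (- C) * k i == 0.
    apply/eqP/h.
      move=> j; rewrite /valring (ord_ge_pi_mul hK) add0r opprK; right; exact: CP.
    have := congr1 (fun x => pi ^ (- C) *: x) k0; rewrite scaler0 scaler_sumr; apply: etrans.
    by apply: eq_bigr => j _; rewrite scalerA XE.
  by rewrite mulf_eq0 (negPf pc0).
have basX : basis_of fullv X by rewrite basisEfree freeX subvf hV size_tuple leqnn.
have Lmem v : L v <-> exists2 c, (forall i, O (c i)) & \sum_i c i *: E i = v.
  by rewrite LE; split => -[c Oc cv]; exists c.
have absorb v : exists k : nat, L (pi ^+ k *: v).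
  have [C CP] := exists_lower_bound (fun i => ord (coord X i v)).
  exists `|C|%N; apply/Lmem; exists (fun i => pi ^+ `|C|%N * coord X i v).
    move=> i; rewrite /valring exprnP (ord_ge_pi_mul hK); right.
    by apply: le_trans (CP i); lia.
  rewrite [in RHS](coord_basis basX (memvf v)) scaler_sumr; apply: eq_bigr => i _.
  by rewrite scalerA XE.
split=> [v|v _].
  split=> [Lv|[_ vP]]; first by split; [exact: memvf | move=> y Ly; exact: Lform].
  have [k] := absorb v; elim: k => [|k ih]; first by rewrite expr0 scale1r.
  move=> Lx; apply: ih.
  have : scale_set pi L (pi ^+ k.+1 *: v).
    apply: Lnd => // y Ly; apply/piOE; rewrite formZl.
    have := ord_geM hK (ord_ge_pi hK k.+1) (vP y Ly); rewrite addr0.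
    by apply: ord_ge_le; lia.
  by rewrite scale_setE // exprS scalerA mulKf.
have [C CP] := exists_lower_bound (fun i => ord (form (E i) v)).
exists C => y /Lmem[c Oc <-]; rewrite form_suml; apply: (ord_ge_sum hK) => i.
have Pi : P C (form (E i) v) by right; exact: CP i.
by rewrite formZl; have := ord_geM hK (Oc i) Pi; rewrite add0r.
Qed.

Lemma level_unique m m' L : SD m L -> SD m' L -> m = m'.
Proof.
have [e [f ef]] := full_pair => s1 s2; apply/eqP; rewrite eq_le.
by rewrite (level_anti hK halt (memvf e) (memvf f) ef s2 s1) //
           (level_anti hK halt (memvf e) (memvf f) ef s1 s2).
Qed.

Lemma class_self (L : set V) : homothety_class L L.
Proof.
exists 1; first exact: oner_neq0.
by apply/seteqP; split => v; rewrite scale_setE ?oner_neq0 // invr1 scale1r.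
Qed.

Lemma class_scale c (L : set V) : c != 0 -> homothety_class (scale_set c L) = homothety_class L.
Proof.
move=> c0.
have sc a M : a != 0 -> scale_set a (scale_set c M) = scale_set (a * c) M :> set V.
  move=> a0; apply/seteqP; split => v; rewrite !scale_setE ?mulf_neq0 // scalerA invfM //.
    by rewrite mulrC.
  by rewrite mulrC.
apply/seteqP; split => M [a a0 ->].
  by exists (a * c); [rewrite mulf_neq0 | rewrite sc].
exists (a / c); first by rewrite mulf_neq0 ?invr_eq0.
by rewrite sc ?mulf_neq0 ?invr_eq0 // divfK.
Qed.

Lemma class_SD m L M : SD m L -> homothety_class L = homothety_class M ->
  exists c, [/\ c != 0, M = scale_set c L & SD (m + 2 * ord c) M].
Proof.
move=> sL E; have := class_self M; rewrite -E => -[c c0 ->]; exists c; split => //.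
exact: (sd_scale hK sL c0).
Qed.

(** Scaling by c changes the level by 2 ord c, so levels 0 and 1 cannot be
    mixed and c must be a unit. *)
Lemma class_inj (b b' : bool) L M : SD b%:Z L -> SD b'%:Z M ->
  homothety_class L = homothety_class M -> b = b' /\ L = M.
Proof.
move=> sL sM /(class_SD sL)[c [c0 ME sM']].
have lev := level_unique sM sM'.
have [bb' oc] : b = b' /\ ord c = 0 by move: lev; case: (b); case: (b'); lia.
split => //; apply/esym; apply: (sd_eq sM); first by rewrite -bb'.
rewrite ME => v /scale_setE; move=> /(_ c0) Lv.
rewrite -[v](scalerKV c0); apply: (sdZ hK sL) => //.
by right; rewrite oc.
Qed.

(** At level 0, L is primitive and [varpi] L is a suitable representative; at level
    1, L is one, inside the primitive lattice obtained by enlarging the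
    second half of an adapted symplectic basis. *)
Lemma SD_special (b : bool) L : SD b%:Z L ->
  special_vertex ord varpi form n (homothety_class L).
Proof.
move=> sL; have p0 := pi_neq0 hK; have [u [w [a [d [uwb LE ab]]]]] := selfdual_symplectic sL.
split; last by exists u, w, a, d; split; [ | rewrite LE | exists b%:Z].
case: b sL ab => sL ab.
  exists L; split => //; first exact: SD_lattice sL.
  pose L0 := symplectic_lattice ord varpi u w a (fun i => d i - 1).
  have sL0 : SD 0 L0.
    by apply: symplectic_SD => // i; have := ab i; lia.
  have spn := symplectic_basis_span uwb; have [_ uw uu ww] := uwb.
  have memL a' d' := symplectic_mem hK uw uu ww a' d' spn.
  exists L0; split; first exact: SD_primitive.
  - by move=> x y Lx Ly; apply/piOE; exact: (sd_form sL).
  - move=> v /scale_setE; move=> /(_ p0); rewrite LE /L0 !memL => -[h1 h2]; split => i.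
      have := h1 i; rewrite formZl (ord_ge_mull hK) ?invr_eq0 // (ord_inv hK) // (ord_pi hK).
      by apply: ord_ge_le; lia.
    have := h2 i; rewrite formZr (ord_ge_mull hK) ?invr_eq0 // (ord_inv hK) // (ord_pi hK).
    by apply: ord_ge_le; lia.
  move=> v; rewrite LE /L0 !memL => -[h1 h2]; split => // i.
  by apply: ord_ge_le (h2 i); lia.
have sL2 := sd_scale_pi hK sL.
exists (scale_set pi L); split; first exact: SD_lattice sL2.
  by rewrite class_scale.
exists L; split => //; first exact: SD_primitive.
  move=> x y Lx Ly; apply/piOE; apply: ord_ge_le (sd_form sL2 Lx Ly); lia.
move=> v /scale_setE; move=> /(_ p0) Lv; rewrite -[v](scalerKV p0).
by apply: (sdZ hK sL) => //; right; rewrite (ord_pi hK).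
Qed.

Lemma special_SD t : special_vertex ord varpi form n t ->
  exists (b : bool) L, SD b%:Z L /\ t = homothety_class L.
Proof.
move=> [_ [u [w [a [d [uwb -> [m ab]]]]]]]; have sL := symplectic_SD uwb ab.
(* Dividing by varpi^k brings the level m down to 0 or 1. *)
pose k : int := (m %/ 2)%Z.
have c0 := pi_exp_neq0 hK (- k).
have sM := sd_scale hK sL c0; rewrite (ord_pi_exp hK) in sM.
have [b bE] : exists b : bool, m + 2 * - k = b%:Z.
  have := divz_eq m 2; have := modz_ge0 m (_ : 2 != 0 :> int); have := ltz_pmod m (_ : 0 < 2 :> int).
  rewrite -/k => /(_ isT) h2 /(_ isT) h1 h3.
  have : (m %% 2)%Z = 0 \/ (m %% 2)%Z = 1 by move: (m %% 2)%Z h1 h2; clear; lia.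
  by case=> h; [exists false | exists true]; move: h3; rewrite h /=; lia.
exists b, (scale_set (pi ^ (- k)) (symplectic_lattice ord varpi u w a d)).
by rewrite -bE class_scale.
Qed.

Lemma adjacent_below L M : SD 0 L -> SD 1 M -> M `<=` L ->
  Defs.adjacent ord varpi form n (homothety_class L) (homothety_class M) /\
  Defs.adjacent ord varpi form n (homothety_class M) (homothety_class L).
Proof.
move=> sL sM ML; have p0 := pi_neq0 hK.
have ne : homothety_class L <> homothety_class M.
  by move=> /(class_inj (b := false) (b' := true) sL sM)[].
have sL2 := sd_scale_pi hK sL.
have pLM : scale_set pi L `<=` M.
  move=> v /scale_setE; move=> /(_ p0) Lv; rewrite -[v](scalerKV p0).
  exact: (sd_nbr hK sL sM ML).
have l1 : lattice ord n (scale_set pi L) by exact: SD_lattice sL2.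
have l2 : lattice ord n M by exact: SD_lattice sM.
have cE : homothety_class L = homothety_class (scale_set pi L) by rewrite class_scale.
have f1 : form_maps_to form (scale_set pi L) (piO ord varpi).
  by move=> x y Lx Ly; apply/piOE; apply: ord_ge_le (sd_form sL2 Lx Ly); lia.
have f2 : form_maps_to form M (piO ord varpi).
  by move=> x y Lx Ly; apply/piOE; exact: (sd_form sM).
have pr := SD_primitive sL.
split; split.
- exact: ne.
- exists (scale_set pi L), M, L; split; [by split | by split | exact: pr | by split | left].
  by split.
- by move=> E; exact: ne.
exists M, (scale_set pi L), L; split; [by split | by split | exact: pr | by split | right].
by split.
Qed.

(** Levels do all the work.  Those of L1 and L2 are at least 1, since the form maps
    both to the maximal ideal, and at most 2, since both contain [varpi] L0.
    Equal levels would make L1 and L2 equal, so L1 has level 2, hence is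
    [varpi] L0, and L2 has level 1. *)
Lemma chain_levels (b b' : bool) L M L1 L2 L0 : SD b%:Z L -> SD b'%:Z M ->
  homothety_class L = homothety_class L1 -> homothety_class M = homothety_class L2 ->
  homothety_class L <> homothety_class M -> SD 0 L0 ->
  form_maps_to form L1 (piO ord varpi) -> form_maps_to form L2 (piO ord varpi) ->
  scale_set pi L0 `<=` L1 -> L1 `<=` L2 -> L2 `<=` L0 ->
  [/\ b = false, b' = true & M `<=` L].
Proof.
move=> sL sM E1 E2 ne s0 f1 f2 h01 h12 h20.
have [e [f ef]] := full_pair; have p0 := pi_neq0 hK.
have [c1 [_ _ s1]] := class_SD sL E1; have [c2 [_ _ s2]] := class_SD sM E2.
move: (b%:Z + _) (b'%:Z + _) s1 s2 => m1 m2 s1 s2.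
have m2ge : 1 <= m2.
  by apply: (level_ge hK halt (memvf e) (memvf f) ef s2) => x y Lx Ly; apply/piOE; exact: f2.
have m12 : m2 <= m1 := level_anti hK halt (memvf e) (memvf f) ef s1 s2 h12.
have s02 := sd_scale_pi hK s0; rewrite add0r in s02.
have m1le : m1 <= 2 := level_anti hK halt (memvf e) (memvf f) ef s02 s1 h01.
have [E|[m1E m2E]] : m1 = m2 \/ m1 = 2 /\ m2 = 1 by lia.
  case: ne; rewrite E1 E2; congr homothety_class.
  by apply: (sd_eq s1); rewrite // E.
rewrite m1E in s1; rewrite m2E in s2.
have L1E : scale_set pi L0 = L1 := sd_eq s02 s1 h01.
have E0 : homothety_class L = homothety_class L0 by rewrite E1 -L1E class_scale.
have [bE LE] := class_inj (b' := false) sL s0 E0.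
have [b'E ME] := class_inj (b' := true) sM s2 E2.
by split => //; rewrite LE ME.
Qed.

Lemma adjacentP (b b' : bool) L M : SD b%:Z L -> SD b'%:Z M ->
  Defs.adjacent ord varpi form n (homothety_class L) (homothety_class M) <->
  [/\ b = false, b' = true & M `<=` L] \/ [/\ b' = false, b = true & L `<=` M].
Proof.
move=> sL sM; split; last first.
  case=> -[bE b'E H]; rewrite bE b'E in sL sM *.
    exact: (adjacent_below sL sM H).1.
  exact: (adjacent_below sM sL H).2.
move=> [ne [L1 [L2 [L0 [[_ E1] [_ E2] /primitive_SD s0 [f1 f2] H]]]]].
case: H => -[h1 h2 h3]; [left | right].
  exact: (chain_levels sL sM E1 E2 ne s0 f1 f2 h1 h2 h3).
by apply: (chain_levels sM sL E2 E1 _ s0 f2 f1 h1 h2 h3) => E; exact: ne.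
Qed.

End Full.
End SpecialVertices.

(** * The graph of special vertices *)

Section Assembly.
Variables (R : realType) (K : fieldType) (ord : K -> int) (varpi : K) (q n : nat).
Hypothesis hK : local_field ord varpi q.
Variables (V : vectType K) (form : {biscalar V}).
Hypothesis halt : alternating_form form.
Hypothesis hnd : nondegenerate_form form.
Hypothesis n_gt0 : (0 < n)%N.
Hypothesis hV : \dim {:V} = (2 * n)%N.
Local Notation P := (ord_ge ord).
Local Notation pi := varpi.
Local Notation SD := (selfdual ord form fullv).
Local Notation X := (special_vertex ord varpi form n).

Variable a : set V -> nat -> int.
Hypothesis ha : horocyclic ord varpi q form fullv n a.

(** Between L and [varpi] L there is a neighbour of L, so one step has index
    q^(2n); only finiteness matters. *)
Lemma index_pi_power j m L : SD m L -> exists N, has_index N L (scale_set (pi ^+ j) L).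
Proof.
have p0 := pi_neq0 hK.
elim: j m L => [|j ih] m L sL.
  exists 1%N; apply: has_index1; first exact: sd0 sL.
  by move=> v Lv; rewrite scale_setE ?oner_neq0 // expr0 invr1 scale1r.
have [g [_ gP]] := horo_count ha (fun=> false) sL.
have [M [sM ML _]] : exists M, [set M | [/\ SD (m + 1) M, M `<=` L &
     forall i, (i < n)%N -> a M i = a L i + false%:Z]] M.
  have q0 : (0 < q ^ \sum_(i < n) false * i.+1)%N by rewrite expn_gt0 (q_gt0 hK).
  by exists (g (Ordinal q0)); apply/gP; exists (Ordinal q0).
have sL2 := sd_scale_pi hK sL.
have pM : scale_set pi L `<=` M.
  move=> v /scale_setE; move=> /(_ p0) Lv; rewrite -[v](scalerKV p0).
  exact: (sd_nbr hK sL sM ML).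
have sL2' : SD (m + 1 + 1) (scale_set pi L).
  by have -> : m + 1 + 1 = m + 2 by ring.
have i1 := horo_index ha sL sM ML.
have i2 := horo_index ha sM sL2' pM.
have [N iN] := ih _ _ sL2.
have E : scale_set (pi ^+ j) (scale_set pi L) = scale_set (pi ^+ j.+1) L.
  by apply/seteqP; split => v; rewrite !scale_setE ?expf_neq0 // scalerA exprS invfM.
rewrite E in iN.
have sLj : SD (m + 2 * ord (pi ^+ j.+1)) (scale_set (pi ^+ j.+1) L).
  by apply: (sd_scale hK sL); rewrite expf_neq0.
have pL : scale_set pi L `<=` L by move=> v /pM /ML.
have i3 : has_index (q ^ n * q ^ n) L (scale_set pi L).
  apply: (has_index_chain _ _ _ _ pM i2 i1) => [x y|x y|x y Lx /ML|].
  - exact: (sdB hK sL2).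
  - exact: (sdD hK sM).
  - exact: (sdD hK sL).
  exact: sd0 sL2.
exists (N * (q ^ n * q ^ n))%N.
apply: (has_index_chain _ _ _ _ _ iN i3) => [x y|x y|x y Lx /pL||].
- exact: (sdB hK sLj).
- exact: (sdD hK sL2).
- exact: (sdD hK sL).
- exact: sd0 sLj.
move=> v /scale_setE; rewrite expf_neq0 // => /(_ isT) Lv; apply/scale_setE => //.
have -> : pi^-1 *: v = pi ^+ j *: (pi ^- j.+1 *: v).
  by rewrite scalerA exprS invfM mulrCA mulfV ?mulr1 // expf_neq0.
by apply: (sdZ hK sL) => //; rewrite exprnP; apply: ord_ge_le (ord_ge_pi hK _); lia.
Qed.

Lemma exists_lattice_data : exists (lev : X -> bool) (lat : X -> set V),
  [/\ forall x, SD (lev x)%:Z (lat x),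
      forall x y, lev x = lev y -> lat x = lat y -> x = y,
      forall (b : bool) L, SD b%:Z L -> exists2 x, lev x = b & lat x = L &
      forall x y, Y_adj x y <-> [/\ lev x = false, lev y = true & lat y `<=` lat x] \/
         [/\ lev y = false, lev x = true & lat x `<=` lat y]].
Proof.
have ex (x : X) : exists p : bool * set V, SD p.1%:Z p.2 /\ val x = homothety_class p.2.
  have [b [L [sL xL]]] := special_SD hK halt n_gt0 hV hnd (set_valP x).
  by exists (b, L).
have /choice[d dP] := ex.
exists (fun x => (d x).1), (fun x => (d x).2); split.
- by move=> x; case: (dP x).
- by move=> x y _ E; apply: val_inj; rewrite (dP x).2 (dP y).2 E.
- move=> b L sL; have sp := SD_special hK halt n_gt0 hV hnd sL.
  pose x : X := exist (fun t => t \in X) _ (mem_set sp); exists x.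
    by have [] := class_inj hK halt n_gt0 hV hnd (dP x).1 sL (esym (dP x).2).
  by have [] := class_inj hK halt n_gt0 hV hnd (dP x).1 sL (esym (dP x).2).
move=> x y; rewrite /Y_adj (dP x).2 (dP y).2.
exact: (adjacentP hK halt n_gt0 hV hnd (dP x).1 (dP y).1).
Qed.

Variables (lev : X -> bool) (lat : X -> set V).
Hypothesis latP : forall x, SD (lev x)%:Z (lat x).
Hypothesis lat_inj : forall x y, lev x = lev y -> lat x = lat y -> x = y.
Hypothesis lat_surj : forall (b : bool) L, SD b%:Z L -> exists2 x, lev x = b & lat x = L.
Hypothesis adjP : forall x y, Y_adj x y <->
  [/\ lev x = false, lev y = true & lat y `<=` lat x] \/
  [/\ lev y = false, lev x = true & lat x `<=` lat y].

Let typ (x : X) : {ffun 'I_n -> int} := [ffun i : 'I_n => a (lat x) i].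
Let c (i : 'I_n) : nat := i.+1.

Let Y_sym (x y : X) : Y_adj x y -> Y_adj y x.
Proof. by move=> /adjP[]h; apply/adjP; [right | left]. Qed.

Let Y_shift (x y : X) : Y_adj x y ->
  lev y = ~~ lev x /\ exists e, typ y = shift (lev x) e (typ x).
Proof.
move=> /adjP[[lx ly sub]|[ly lx sub]]; rewrite lx ly; split => //;
  exists [ffun i : 'I_n => a (lat y) i != a (lat x) i]; apply/ffunP => i; rewrite !ffunE.
  have s1 := latP x; have s2 := latP y; rewrite lx in s1; rewrite ly in s2.
  by case: (horo_shift ha s1 s2 sub (ltn_ord i)) => ->; case: eqP; lia.
have s1 := latP x; have s2 := latP y; rewrite lx in s1; rewrite ly in s2.
by case: (horo_shift ha s2 s1 sub (ltn_ord i)) => ->; case: eqP; lia.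
Qed.

Let eps_of (e : {ffun 'I_n -> bool}) (i : nat) : bool := oapp e false (insub i).
Let eps_ofE e (i : 'I_n) : eps_of e i = e i.
Proof. by rewrite /eps_of valK. Qed.

Let counts_vertices N (b : bool) (Q : set (set V)) :
  (forall L, Q L -> SD b%:Z L) -> counts N Q ->
  counts N [set y | lev y = b /\ Q (lat y)].
Proof.
move=> QS [g [gi gQ]].
have ex i : exists y, lev y = b /\ lat y = g i.
  have [|y ly Ly] := lat_surj (b := b) (L := g i); last by exists y.
  by apply: QS; apply/gQ; exists i.
have /choice[h hP] := ex; exists h; split.
  by move=> i j E; apply: gi; rewrite -(hP i).2 E (hP j).2.
move=> y; split=> [[ly /gQ[i gy]]|[i <-]].
  by exists i; apply: lat_inj; rewrite ?(hP i).1 ?(hP i).2.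
by split; [exact: (hP i).1 | apply/gQ; exists i; rewrite (hP i).2].
Qed.

Let Y_count (x : X) e :
  ([set y | Y_adj x y /\ typ y = shift (lev x) e (typ x)] #=
   `I_(q ^ (if lev x then total_cost c - cost c e else cost c e)))%card.
Proof.
have p0 := pi_neq0 hK.
apply: counts_card; have sx := latP x.
case lx : (lev x) in sx *.
  (* neighbours above lat x correspond to their multiples by pi below it *)
  have cN := horo_count ha (eps_of [ffun i => ~~ e i]) sx.
  have -> : (total_cost c - cost c e = \sum_(i < n) eps_of [ffun i => ~~ e i] i * i.+1)%N.
    rewrite /total_cost (bigID (fun i => e i)) /= -/(cost c e) addKn.
    rewrite big_mkcond; apply: eq_bigr => i _; rewrite eps_ofE ffunE.
    by case: (e i); rewrite ?mul1n ?mul0n.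
  have pinv : pi^-1 != 0 by rewrite invr_eq0.
  have scK (L : set V) : scale_set pi^-1 (scale_set pi L) = L.
    by apply/seteqP; split => v; rewrite !scale_setE // invrK scalerA mulVf // scale1r.
  have scK' (L : set V) : scale_set pi (scale_set pi^-1 L) = L.
    by apply/seteqP; split => v; rewrite !scale_setE // invrK scalerA mulfV // scale1r.
  pose Q := [set L | SD 0 L /\ lat x `<=` L /\
     forall i : 'I_n, a L i = a (lat x) i - (e i)%:Z].
  apply: (@counts_ext _ _ [set y | lev y = false /\ Q (lat y)]).
    move=> y; split=> [[ly [sy [xy ay]]]|[/adjP[[]|[ly _ xy] ty]]]; [|by rewrite lx|].
      split; first by apply/adjP; right.
      by apply/ffunP => i; rewrite !ffunE ay.
    split => //; split; first by have := latP y; rewrite ly.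
    by split => // i; move/ffunP: ty => /(_ i); rewrite !ffunE.
  apply: counts_vertices; first by move=> L [].
  have [g [gi gA]] := cN.
  exists (fun i => scale_set pi^-1 (g i)); split.
    by move=> i j E; apply: gi; rewrite -[LHS]scK' E scK'.
  move=> L; split=> [[sL [xL aL]]|[i <-]].
    have [|i gE] := (gA (scale_set pi L)).1; last by exists i; rewrite gE scK.
    split.
    - by have -> : true%:Z + 1 = 0 + 2 by []; exact: (sd_scale_pi hK sL).
    - move=> v /scale_setE; move=> /(_ p0) Lv; rewrite -[v](scalerKV p0).
      exact: (sd_nbr hK sL sx xL).
    move=> i ni; rewrite (horo_scale ha sL ni).
    have := aL (Ordinal ni); have := eps_ofE [ffun i => ~~ e i] (Ordinal ni).
    by rewrite /= => -> ->; rewrite ffunE; case: (e _); lia.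
  have [sN Nx aN] := (gA (g i)).2 (ex_intro _ i erefl).
  have sL : SD 0 (scale_set pi^-1 (g i)).
    have := sd_scale hK sN pinv; rewrite (ord_inv hK) // (ord_pi hK).
    by have -> : true%:Z + 1 + 2 * - 1 = 0 by [].
  split => //; split.
    move=> v xv; apply/scale_setE => //; rewrite invrK.
    exact: (sd_nbr hK sx sN Nx).
  move=> j; have := aN j (ltn_ord j); rewrite eps_ofE ffunE.
  have := horo_scale ha sL (ltn_ord j); rewrite scK' => ->.
  by case: (e j); lia.
have cN := horo_count ha (eps_of e) sx.
have -> : (cost c e = \sum_(i < n) eps_of e i * i.+1)%N.
  rewrite /cost big_mkcond; apply: eq_bigr => i _; rewrite eps_ofE.
  by case: (e i); rewrite ?mul1n ?mul0n.
pose Q := [set M | [/\ SD (false%:Z + 1) M, M `<=` lat x &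
   forall i, (i < n)%N -> a M i = a (lat x) i + (eps_of e i)%:Z]].
apply: (@counts_ext _ _ [set y | lev y = true /\ Q (lat y)]).
  move=> y; split=> [[ly [sy xy ay]]|[/adjP[[_ ly xy] ty|[]]]]; [| |by rewrite lx].
    split; first by apply/adjP; left.
    by apply/ffunP => i; rewrite !ffunE ay // eps_ofE.
  split => //; split => //; first by have := latP y; rewrite ly.
  move=> i ni; move/ffunP: ty => /(_ (Ordinal ni)); rewrite !ffunE /= => ->.
  by rewrite -(eps_ofE e (Ordinal ni)).
by apply: counts_vertices => // L [].
Qed.

Let box_window w x : in_box w (typ x) <-> in_window n w (a (lat x)).
Proof.
split=> [/forallP h i ni|h]; first by have := h (Ordinal ni); rewrite ffunE.
by apply/forallP => i; rewrite ffunE; exact: h.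
Qed.

(** The vertices of a window are given by lattices inside a bounded module B.  A
    common power of [varpi] maps B into each of them, so they all lie between
    two multiples of one of them, L0, and are determined by the representatives
    of a finite quotient which they contain. *)
Let Y_windows (w : nat) : exists F : set X,
  [/\ finite_set F, forall x, F x -> in_box w (typ x),
      exists2 x, F x & lev x = false /\ forall i, typ x i = 0 &
      forall x y, F x -> Y_adj x y -> in_box w (typ y) -> F y].
Proof.
have [G wG] := horo_window ha w.
have [L0 GL0 aL0] := window_base wG.
have [s0 w0] := window_type wG GL0.
exists [set x | G (lev x) (lat x)]; split.
- have [B [k0 [[B0 BD BZ] _ Bform GB]]] := window_bounded wG.
  pose k := (`|k0|%N + 1)%N.
  have absorb (b : bool) L x : G b L -> B x -> L (pi ^+ k *: x).
    move=> GL Bx; have sL := (window_type wG GL).1.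
    apply: (sd_mem sL); first exact: memvf.
    move=> y /(GB _ _ GL) By; rewrite formZl exprnP.
    have := ord_geM hK (ord_ge_pi hK k) (Bform _ _ Bx By).
    by apply: ord_ge_le; rewrite /k; case: (b); lia.
  have pk0 : pi ^+ k != 0 by rewrite expf_neq0 // (pi_neq0 hK).
  pose A := scale_set (pi ^+ k)^-1 L0.
  have sA := sd_scale hK s0 (_ : (pi ^+ k)^-1 != 0).
  have [N [g [gA gU]]] := index_pi_power (k + k) (sA ltac:(by rewrite invr_eq0)).
  have BA x : B x -> A x.
    by move=> Bx; apply/scale_setE; rewrite ?invr_eq0 // invrK; exact: absorb GL0 Bx.
  have low (b : bool) L x : G b L -> scale_set (pi ^+ (k + k)) A x -> L x.
    move=> GL /scale_setE; rewrite expf_neq0 ?(pi_neq0 hK) // => /(_ isT).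
    move=> /scale_setE; rewrite invr_eq0 invrK scalerA => /(_ pk0).
    rewrite exprD invfM mulrA mulfV // mul1r => L0x.
    by rewrite -[x](scalerKV pk0); apply: (absorb b) => //; exact: GB GL0 _ L0x.
  pose code (x : X) : bool * {ffun 'I_N -> bool} := (lev x, [ffun i => `[< lat x (g i) >]]).
  have sub x y : G (lev x) (lat x) -> G (lev y) (lat y) -> code x = code y -> lat x `<=` lat y.
    move=> Gx Gy [_ /ffunP E] v xv.
    have [i gi _] := gU v (BA _ (GB _ _ Gx _ xv)).
    have xg : lat x (g i).
      have -> : g i = v - (v - g i) by rewrite opprB addrC subrK.
      by apply: (sdB hK (latP x)) => //; exact: low Gx gi.
    have yg : lat y (g i).
      by have := E i; rewrite !ffunE asboolT // => /esym/asboolP.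
    have -> : v = (v - g i) + g i by rewrite subrK.
    by apply: (sdD hK (latP y)) => //; exact: low Gy gi.
  suff -> : finite_set [set x | G (lev x) (lat x)] =
     finite_set (code @` [set x | G (lev x) (lat x)]) by exact: finite_finset.
  apply/esym/eq_finite_set/inj_card_eq => x y /set_mem Gx /set_mem Gy E.
  apply: lat_inj; first by case: E.
  by apply/seteqP; split; apply: sub.
- by move=> x Gx; apply/box_window; exact: (window_type wG Gx).2.
- have [x lx Lx] := lat_surj (b := false) s0; exists x; first by rewrite /= lx Lx.
  by split => // i; rewrite ffunE Lx aL0.
move=> x y Gx xy /box_window wy.
have wx := (window_type wG Gx).2; have sx := latP x; have sy := latP y.
move: Gx => /=; case: ((adjP _ _).1 xy) => -[l1 l2 sub].
  rewrite l1 in sx; rewrite l2 in sy; rewrite l1 l2.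
  exact: (window_closed wG sx sy sub wx wy).1.
rewrite l1 in sy; rewrite l2 in sx; rewrite l1 l2.
exact: (window_closed wG sy sx sub wy wx).2.
Qed.

Lemma spectral_radius_building :
  spectral_radius R (@Y_adj K ord varpi V form n) =
  2 ^+ n * Num.sqrt (q%:R : R) ^+ (\sum_(i < n) i.+1).
Proof.
exact: (spectral_radius_horocyclic R (q_gt0 hK) Y_sym Y_shift Y_count Y_windows).
Qed.

End Assembly.

Lemma sqrt_exp_powR (R : realType) (q n : nat) :
  Num.sqrt (q%:R : R) ^+ (\sum_(i < n) i.+1) = q%:R `^ ((n * (n + 1))%:R / 4).
Proof.
have E : (2 * \sum_(i < n) i.+1 = n * (n + 1))%N.
  elim: n => [|n ih]; first by rewrite big_ord0.
  by rewrite big_ord_recr /= mulnDr ih; lia.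
rewrite -powR12_sqrt // -powR_mulrn ?powR_ge0 // -powRrM -E natrM.
by congr (_ `^ _); field.
Qed.

Local Close Scope classical_set_scope.
Unset Implicit Arguments.

Theorem proposition2p6 (R : realType) (K : fieldType) (ord : K -> int)
    (varpi : K) (q n : nat) (V : vectType K) (form : {biscalar V})
    (hn : (2 <= n)%N) (hK : local_field ord varpi q)
    (hV : \dim {:V} = (2 * n)%N)
    (halt : alternating_form form) (hnd : nondegenerate_form form) :
  spectral_radius R (@Y_adj K ord varpi V form n) =
    2 ^+ n * (q%:R `^ ((n * (n + 1))%:R / 4)).
Proof.
have n_gt0 : (0 < n)%N by exact: ltnW.
have [a ha] := horocyclic_exists hK halt (nondegenerate_full hnd) hV.
have [lev [lat [latP lat_inj lat_surj adjP]]] :=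
  exists_lattice_data hK halt hnd n_gt0 hV.
by rewrite (spectral_radius_building R hK n_gt0 hV ha latP lat_inj lat_surj adjP) sqrt_exp_powR.
Qed.
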